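(* Let $\mathbb B$ be a stochastic set of interval type and let $M,N\in(\mathcal M^c_{\mathrm{loc}})^{\mathbb B}$. Then there exists a unique $V\in(\mathcal A_{\mathrm{loc}}\cap\mathcal C)^{\mathbb B}$ such that $MN-V\in(\mathcal M^c_{\mathrm{loc},0})^{\mathbb B}$.
   Context: Fix a probability space $(\Omega,\mathcal F,\mathbf P)$ with a filtration $\mathbb F=(\mathcal F_t)_{t\ge0}$ satisfying the usual conditions; $\mathbf R^+=[0,+\infty[$, $\mathbf N^+=\{1,2,\dots\}$. Indistinguishable processes are identified. $[\![S,T]\!]=\{(\omega,t)\in\Omega\times\mathbf R^+:S(\omega)\le t\le T(\omega)\}$. $X^T$ is $X$ stopped at $T$. For sets, $AB=A\cap B$. For $C\subseteq\Omega\times\mathbf R^+$ and a real function $X$ on $\widetilde C\subseteq\Omega\times\mathbf R^+$, $XI_C$ equals $X$ on $C\cap\widetilde C$ and $0$ elsewhere. A stochastic set of interval type $\mathbb B$ is an optional (or predictable) subset of $\Omega\times\mathbf R^+$ such that for some nonnegative random variable $T$ each section $\mathbb B_\omega=\{t:(\omega,t)\in\mathbb B\}$ is nonempty and equal to $[0,T(\omega)[$ or $[0,T(\omega)]$. Here $T$ (the debut of $\mathbb B^c$) is a stopping time. For a class $\mathcal D$ of processes, $\mathcal D^{\mathbb B}$ is the set of real functions $X$ on $\mathbb B$ for which there exist an increasing sequence of stopping times $T_n\uparrow T$ with $\bigcup_n[\![0,T_n]\!]\supseteq\mathbb B$ and $X^{(n)}\in\mathcal D$ with $(XI_{\mathbb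 B})^{T_n}=(X^{(n)}I_{\mathbb B})^{T_n}$ for all $n$ (equivalently $XI_{\mathbb B[\![0,T_n]\!]}=X^{(n)}I_{\mathbb B[\![0,T_n]\!]}$). $X=Y$ for functions on $\mathbb B$ means $XI_{\mathbb B}$ and $YI_{\mathbb B}$ are indistinguishable. $\mathcal C$: continuous processes; $\mathcal A_{\mathrm{loc}}$: adapted processes of locally integrable variation; $\mathcal M^c_{\mathrm{loc}}$: continuous local martingales; $\mathcal M^c_{\mathrm{loc},0}$: those with null initial value. *)

(* Defs.v *)
From HB Require Import structures.
From mathcomp Require Import all_boot all_order all_algebra.
From mathcomp Require Import all_classical all_reals all_analysis.
From mathcomp Require Import measurable_realfun.

Set Implicit Arguments.
Unset Strict Implicit.
Unset Printing Implicit Defensive.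
Import Order.TTheory GRing.Theory Num.Theory.
Import numFieldNormedType.Exports.
Local Open Scope classical_set_scope.
Local Open Scope ring_scope.

(* The time set R^+ is the subset [0, +oo[ of R : a process is a function
   Omega -> R -> R, of which only the values at times t >= 0 are ever used.
   Likewise a filtration is only constrained at times t >= 0.  *)
Section filtration.
Context {d : measure_display} (Omega : measurableType d) (R : realType).

Record filtration := Filtration {
  filt :> R -> set (set Omega) ;
  filt_sigma_algebra : forall t, 0 <= t -> sigma_algebra setT (filt t) ;
  filt_sub : forall t, 0 <= t -> filt t `<=` measurable ;
  filt_mono : forall s t, 0 <= s -> s <= t -> filt s `<=` filt t }.

Definition usual_conditions (P : probability Omega R) (F : filtration) :=
  [/\ measure_is_complete P,
      P.-negligible `<=` F 0 &
      forall t, 0 <= t -> F t = \bigcap_(s in [set s | t < s]) F s].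

Definition measurable_wrt (G : set (set Omega)) (f : Omega -> R) :=
  measurable_fun setT (f : g_sigma_algebraType G -> R).

End filtration.

Section processes.
Context {d : measure_display} {Omega : measurableType d} {R : realType}.
Variables (P : probability Omega R) (F : filtration Omega R).

Definition process := Omega -> R -> R.

Definition indistinguishable (X Y : process) :=
  {ae P, forall w, forall t, 0 <= t -> X w t = Y w t}.

Definition adapted (X : process) :=
  forall t, 0 <= t -> measurable_wrt (F t) (fun w => X w t).

Definition continuous_paths (X : process) :=
  forall w, {within `[0, +oo[, continuous (X w)}.

Definition left_continuous_paths (X : process) :=
  forall w t, 0 < t -> X w s @[s --> t^'-] --> X w t.

Definition cadlag_paths (X : process) :=
  forall w, (forall t, 0 <= t -> X w s @[s --> t^'+] --> X w t) /\
            (forall t, 0 < t -> cvg (X w s @[s --> t^'-])).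

Definition stopping_time (tau : Omega -> \bar R) :=
  (forall w, (0 <= tau w)%E) /\
  (forall t, 0 <= t -> F t [set w | (tau w <= t%:E)%E]).

(* X^tau; the minimum is finite since t is. *)
Definition stopped (tau : Omega -> \bar R) (X : process) : process :=
  fun w t => X w (fine (Order.min t%:E (tau w))).

Definition stochastic_interval (S T : Omega -> \bar R) : set (Omega * R) :=
  [set p | [/\ 0 <= p.2, (S p.1 <= p.2%:E)%E & (p.2%:E <= T p.1)%E]].

Definition time_space : set (Omega * R) := [set p | 0 <= p.2].

Definition process_sigma_algebra (C : set process) : set (set (Omega * R)) :=
  <<s time_space,
      [set A | exists X, exists U : set R, [/\ C X, measurable U &
         A = time_space `&` [set p | U (X p.1 p.2)]] ]>>.

Definition optional_set :=
  process_sigma_algebra [set X | adapted X /\ cadlag_paths X].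

Definition predictable_set :=
  process_sigma_algebra [set X | adapted X /\ left_continuous_paths X].

Definition debut (A : set (Omega * R)) (w : Omega) : \bar R :=
  ereal_inf [set t%:E | t in xsection A w].

(* The end time T may be +oo, in which case the section is all of R^+. *)
Definition interval_type (B : set (Omega * R)) :=
  (optional_set B \/ predictable_set B) /\
  exists T : Omega -> \bar R,
    [/\ measurable_fun setT T, forall w, (0 <= T w)%E &
     forall w, xsection B w !=set0 /\
       (xsection B w = [set t | 0 <= t /\ (t%:E < T w)%E] \/
        xsection B w = [set t | 0 <= t /\ (t%:E <= T w)%E])].

Definition end_time (B : set (Omega * R)) := debut (time_space `\` B).

(* X I_C *)
Definition restr (C : set (Omega * R)) (X : process) : process :=
  fun w t => X w t * \1_C (w, t).

(* A function on B is represented by any of its extensions to Omega * R;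
   eq_on and on_set below depend only on the values on B. *)
Definition eq_on (B : set (Omega * R)) (X Y : process) :=
  indistinguishable (restr B X) (restr B Y).

(* on_set D B is the class D^B. *)
Definition on_set (D : set process) (B : set (Omega * R)) : set process :=
  [set X | exists (tau : nat -> Omega -> \bar R) (Xn : nat -> process),
    [/\ forall n, stopping_time (tau n),
        forall w, {homo (fun n => tau n w) : m n / (m <= n)%N >-> (m <= n)%E},
        forall w, tau n w @[n --> \oo] --> end_time B w,
        B `<=` \bigcup_n stochastic_interval (cst 0%E) (tau n) &
        forall n, D (Xn n) /\
          indistinguishable (stopped (tau n) (restr B X))
                            (stopped (tau n) (restr B (Xn n)))]].

Definition localizing_sequence (tau : nat -> Omega -> \bar R) :=
  [/\ forall n, stopping_time (tau n),
      forall w, {homo (fun n => tau n w) : m n / (m <= n)%N >-> (m <= n)%E} &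
      forall w, tau n w @[n --> \oo] --> +oo%E].

(* The initial value is F_0-measurable but not necessarily integrable: only
   the increment X - X_0 is localized. *)
Definition localized (D : set process) : set process :=
  [set X | measurable_wrt (F 0) (fun w => X w 0) /\
     exists tau, localizing_sequence tau /\
       forall n, D (fun w t => stopped (tau n) X w t - X w 0)].

(* Y is a version of the conditional expectation of X given G. *)
Definition is_cond_exp (G : set (set Omega)) (X Y : Omega -> R) :=
  [/\ measurable_wrt G Y, P.-integrable setT (EFin \o Y) &
      forall A, G A -> (\int[P]_(w in A) (Y w)%:E = \int[P]_(w in A) (X w)%:E)%E].

Definition martingale : set process :=
  [set X | [/\ adapted X, cadlag_paths X,
     forall t, 0 <= t -> P.-integrable setT (fun w => (X w t)%:E) &
     forall s t, 0 <= s -> s <= t ->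
       is_cond_exp (F s) (fun w => X w t) (fun w => X w s)]].

(* The variation of a path on [0, +oo[, with the initial value counted as a
   jump at 0. *)
Definition path_variation (f : R -> R) : \bar R :=
  (`|f 0|%:E + ereal_sup [set total_variation 0 t f | t in [set t | (0 <= t)%R]])%E.

Definition integrable_variation : set process :=
  [set X | [/\ adapted X, cadlag_paths X,
     forall w (t : R), 0 <= t -> bounded_variation 0 t (X w) &
     (\int[P]_w path_variation (X w) < +oo)%E]].

(* C *)
Definition Cont : set process := [set X | continuous_paths X].

(* A_loc *)
Definition Aloc : set process := localized integrable_variation.

(* M^c_loc *)
Definition Mcloc : set process := localized martingale `&` Cont.

(* M^c_{loc,0} *)
Definition Mcloc0 : set process := Mcloc `&` [set X | forall w, X w 0 = 0].

End processes.

(* Main.v *)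
(* Uniqueness. A continuous local martingale null at 0 whose paths have finite
   variation vanishes: once it is stopped so as to be bounded and of integrable
   variation, the expectation of its square is that of the sum of its squared
   increments over a fine grid, which tends to 0. Hence the finite variation part
   is determined on each [[0, rho_n]], for localizing times rho_n.

   Existence. For a bounded continuous martingale X the Riemann sums of the
   integral of X against X over the dyadic grids form a Cauchy sequence in L^2;
   by Doob's inequality and the Borel-Cantelli lemma a subsequence converges
   almost surely uniformly to a continuous martingale W, and
   X^2 - X_0^2 - 2 W is a limit of sums of squared increments, hence
   nondecreasing. Polarization gives the covariation of two bounded
   martingales. For local martingales, and then for processes on B, the
   covariations obtained along a localizing sequence agree almost surely by
   uniqueness, so they are glued by a pointwise limit, which is eventually
   constant. *)
Require Import Defs.
From HB Require Import structures.
From mathcomp Require Import all_boot all_order all_algebra.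
From mathcomp Require Import all_classical all_reals all_analysis.
From mathcomp Require Import measurable_realfun.
From mathcomp Require Import ring lra.
Import Order.TTheory GRing.Theory Num.Theory.
Import numFieldNormedType.Exports.
Set Implicit Arguments.
Unset Strict Implicit.
Unset Printing Implicit Defensive.
Local Open Scope classical_set_scope.
Local Open Scope ring_scope.

(** * Expectations of real functions *)

Section expectation.
Context {d : measure_display} {T : measurableType d} {R : realType}.
Variable P : probability T R.
Implicit Types (f g h : T -> R) (A : set T).

(** The martingale property is always tested against indicators of events, so no version of a
    conditional expectation is ever manipulated. The main obstacle is the null sets. The classes ask
    for adaptedness and for continuity of all paths, whereas the limits taken here exist only almost
    surely. The usual conditions put every negligible set in [F 0]: the exceptional set is known at
    time 0, and multiplying by the indicator of its complement repairs the paths while keeping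
    adaptedness and the martingale property. A second obstacle is the initial value, which is
    measurable but perhaps not integrable. Martingales are cut by the event that the initial values
    are small; the covariations are built null at 0, and the product of the initial values is added
    at the end. A third is the end of [B], which may or may not belong to it. Times strictly before
    a localizing time lie in [B], the localizing time itself may not; identities are therefore
    proved strictly before it and extended by continuity. *)

Definition integ f : Prop := P.-integrable setT (EFin \o f).
Definition Ex f : R := Rintegral P setT f.

Lemma integ_meas f : integ f -> measurable_fun setT f.
Proof. by move=> /integrableP[mf _]; exact/measurable_EFinP. Qed.

Lemma integ_cst (k : R) : integ (fun=> k).
Proof. exact: finite_measure_integrable_cst. Qed.

Lemma integ_le f g : measurable_fun setT f -> (forall w, `|f w| <= g w) ->
  integ g -> integ f.
Proof.
move=> mf fg ig; apply: (le_integrable _ _ _ ig) => //; first exact/measurable_EFinP.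
by move=> w _ /=; rewrite lee_fin (le_trans (fg w))// ler_norm.
Qed.

Lemma integ_bd f (K : R) : measurable_fun setT f -> (forall w, `|f w| <= K) ->
  integ f.
Proof. by move=> mf fK; apply: (integ_le mf fK); exact: integ_cst. Qed.

Lemma integD f g : integ f -> integ g -> integ (fun w => f w + g w).
Proof. by move=> fi gi; apply: (integrableD _ fi gi). Qed.

Lemma integZ (k : R) f : integ f -> integ (fun w => k * f w).
Proof. by move=> fi; apply: (integrableZl _ k fi). Qed.

Lemma integB f g : integ f -> integ g -> integ (fun w => f w - g w).
Proof. by move=> fi gi; apply: (integrableB _ fi gi). Qed.

Lemma integ_norm f : integ f -> integ (fun w => `|f w|).
Proof. by move=> fi; exact: integrable_norm. Qed.

Lemma integ_sum (I : Type) (s : seq I) (f : I -> T -> R) :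
  (forall i, integ (f i)) -> integ (fun w => \sum_(i <- s) f i w).
Proof.
move=> fi; elim: s => [|i s ih].
  by under eq_fun do rewrite big_nil; exact: integ_cst.
by under eq_fun do rewrite big_cons; exact: integD.
Qed.

Lemma integM_bd h f (K : R) : measurable_fun setT h -> (forall w, `|h w| <= K) ->
  integ f -> integ (fun w => h w * f w).
Proof.
move=> mh hK fi; apply: (integ_le (g := fun w => K * `|f w|)).
- by apply: measurable_funM => //; exact: integ_meas.
- by move=> w; rewrite normrM ler_wpM2r.
- exact/integZ/integ_norm.
Qed.

Lemma norm_indic_le1 A w : `|\1_A w : R| <= 1.
Proof. by rewrite indicE; case: (_ \in _); rewrite ?normr1 ?normr0. Qed.

Lemma integ_indic A f : measurable A -> integ f -> integ (fun w => \1_A w * f w).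
Proof.
move=> mA; apply: integM_bd (norm_indic_le1 A).
exact: measurable_indic.
Qed.

Lemma ExD f g : integ f -> integ g -> Ex (fun w => f w + g w) = Ex f + Ex g.
Proof. by move=> fi gi; exact: RintegralD. Qed.

Lemma ExB f g : integ f -> integ g -> Ex (fun w => f w - g w) = Ex f - Ex g.
Proof. by move=> fi gi; exact: RintegralB. Qed.

Lemma ExZ (k : R) f : integ f -> Ex (fun w => k * f w) = k * Ex f.
Proof. by move=> fi; exact: RintegralZl. Qed.

Lemma Ex_cst (k : R) : Ex (fun=> k) = k.
Proof.
rewrite /Ex Rintegral_cst// [X in fine X](_ : _ = 1%E) ?mulr1//.
exact: probability_setT.
Qed.

Lemma Ex_sum (I : Type) (s : seq I) (f : I -> T -> R) :
  (forall i, integ (f i)) ->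
  Ex (fun w => \sum_(i <- s) f i w) = \sum_(i <- s) Ex (f i).
Proof.
move=> fi; elim: s => [|i s ih].
  by under eq_fun do rewrite big_nil; rewrite Ex_cst big_nil.
under eq_fun do rewrite big_cons.
by rewrite ExD// ?ih ?big_cons//; exact: integ_sum.
Qed.

Lemma Ex_le f g : integ f -> integ g -> (forall w, f w <= g w) -> Ex f <= Ex g.
Proof. by move=> fi gi fg; exact: le_Rintegral. Qed.

Lemma Ex_ge0 f : (forall w, 0 <= f w) -> 0 <= Ex f.
Proof. by move=> f0; apply: Rintegral_ge0. Qed.

Lemma Ex_norm_le f : integ f -> `|Ex f| <= Ex (fun w => `|f w|).
Proof. by move=> fi; apply: le_normr_Rintegral. Qed.

Lemma Ex_ae f g : measurable_fun setT f -> integ g ->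
  {ae P, forall w, f w = g w} -> integ f /\ Ex f = Ex g.
Proof.
move=> mf gi fg; have mg := integ_meas gi.
have fi : integ f.
  apply/integrableP; split; first exact/measurable_EFinP.
  rewrite (ae_eq_integral (fun w => `|(g w)%:E|%E))//; first by case/integrableP : gi.
  - by do 2 apply: measurableT_comp => //.
  - by do 2 apply: measurableT_comp => //.
  - by move: fg; apply: filterS => w /= ->.
split => //; rewrite /Ex /Rintegral; congr fine.
apply: ae_eq_integral => //; [exact/measurable_EFinP..|].
by move: fg; apply: filterS => w /= ->.
Qed.

Lemma Ex_EFin f : integ f -> (\int[P]_w (f w)%:E = (Ex f)%:E)%E.
Proof.
by move=> fi; rewrite /Ex /Rintegral fineK//; exact: integrable_fin_num.
Qed.

Lemma Ex_cvg (f_ : nat -> T -> R) f g : (forall n, measurable_fun setT (f_ n)) ->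
  measurable_fun setT f -> integ g -> {ae P, forall w n, `|f_ n w| <= g w} ->
  {ae P, forall w, f_ n w @[n --> \oo] --> f w} ->
  integ f /\ Ex (f_ n) @[n --> \oo] --> Ex f.
Proof.
move=> mf_ mf gi fg ff.
have [fi _ cv] : [/\ P.-integrable setT (EFin \o f),
  [sequence (\int[P]_(w in setT) `|(f_ n w)%:E - (f w)%:E|)%E]_n @ \oo --> 0%E &
  [sequence (\int[P]_(w in setT) (f_ n w)%:E)%E]_n @ \oo --> (\int[P]_w (f w)%:E)%E].
  apply: (@dominated_convergence _ _ _ P setT measurableT
     (fun n w => (f_ n w)%:E) (EFin \o f) (EFin \o g)) => //.
  - by move=> n; exact/measurable_EFinP.
  - exact/measurable_EFinP.
  - by move: ff; apply: filterS => w /= h _; apply: cvg_EFin => //; exact: nearW.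
  - by move: fg; apply: filterS => w h n _ /=; rewrite lee_fin.
split => //; apply: fine_cvg; rewrite -Ex_EFin//.
Qed.

Lemma Ex_fatou (f_ : nat -> T -> R) f (c : R) : (forall n, integ (f_ n)) ->
  measurable_fun setT f -> (forall n w, 0 <= f_ n w) -> (forall w, 0 <= f w) ->
  {ae P, forall w, f_ n w @[n --> \oo] --> f w} ->
  (\forall n \near \oo, Ex (f_ n) <= c) ->
  integ f /\ Ex f <= c.
Proof.
move=> fi mf f_0 f0 ff fc.
have mE n : measurable_fun setT (fun w => (f_ n w)%:E).
  by apply/measurable_EFinP; exact: integ_meas.
have le : (\int[P]_w (f w)%:E <= c%:E)%E.
  rewrite (ae_eq_integral (fun w => limn_einf (fun n => (f_ n w)%:E)))//; last 3 first.
  - exact/measurable_EFinP.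
  - apply: measurableT_comp => //.
    apply: (@measurable_fun_limn_esup _ _ _ setT (fun n w => - (f_ n w)%:E)%E) => n.
    exact: measurableT_comp.
  - move: ff; apply: filterS => w /= h _ /=.
    by apply/esym; apply: (cvg_limn_einf_sup _).1; apply: cvg_EFin => //; exact: nearW.
  apply: (le_trans (fatou P measurableT mE _)).
    by move=> n w _; rewrite lee_fin.
  rewrite limn_einf_lim; apply: lime_le; first exact: is_cvg_einfs.
  apply: nearW => n; case: fc => m _ mc.
  apply: (@le_trans _ _ (\int[P]_w (f_ (n + m)%N w)%:E)%E).
    by apply: ereal_inf_lbound; exists (n + m)%N => //=; rewrite leq_addr.
  by rewrite Ex_EFin// lee_fin; apply: mc => /=; rewrite leq_addl.
have if_ : integ f.
  apply/integrableP; split; first exact/measurable_EFinP.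
  under eq_integral do rewrite /= ger0_norm//.
  by rewrite (le_lt_trans le)// ltry.
by split => //; rewrite -lee_fin -Ex_EFin.
Qed.

End expectation.

(** * Functions continuous on the half-line *)

Section continuous_on_halfline.
Context {R : realType}.
Implicit Types (f g : R -> R).

Definition hcont f := {within `[0, +oo[, continuous f}.

(** Freezing the argument at 0 for negative times turns continuity on the half-line into continuity
    on all of [R], to which the ordinary limit lemmas apply. *)
Lemma hcontP f : hcont f <-> continuous (fun t : R => f (Num.max t 0)).
Proof.
rewrite /hcont subspace_continuousP; split=> cf t.
- have A : `[0, +oo[%classic (Num.max t 0) by rewrite /= in_itv/= andbT le_max lexx orbT.
  have mc : Num.max (s : R) 0 @[s --> t] --> Num.max t 0.
    by apply: normed_module.continuous_max; [exact: cvg_id|exact: cvg_cst].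
  move=> W Wf.
  have h : \forall s \near Num.max t 0, `[0, +oo[%classic s -> W (f s) := cf _ A W Wf.
  have h' : \forall s \near t, `[0, +oo[%classic (Num.max s 0) -> W (f (Num.max s 0)) := mc _ h.
  have : \forall s \near t, W (f (Num.max s 0)).
    by apply: filterS h' => s; apply; rewrite /= in_itv/= andbT le_max lexx orbT.
  by [].
- rewrite /= in_itv/= andbT => t0 W.
  have := cf t; rewrite /continuous_at max_l// => /(_ W) h /h.
  move=> {}h.
  have h' : \forall s \near t, W (f (Num.max s 0)) := h.
  have : \forall s \near t, `[0, +oo[%classic s -> W (f s).
    apply: filterS h' => s Ws.
    by rewrite /= in_itv/= andbT => s0; rewrite max_l in Ws.
  by [].
Qed.

Lemma eq_hcont f g : (forall t, 0 <= t -> f t = g t) -> hcont f -> hcont g.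
Proof.
move=> fg /hcontP cf; apply/hcontP.
rewrite (_ : (fun t => g _) = (fun t : R => f (Num.max t 0)))//.
by apply/funext => t; rewrite fg// le_max lexx orbT.
Qed.

Lemma hcont_cst (k : R) : hcont (fun=> k).
Proof. by apply/hcontP => t; exact: cvg_cst. Qed.

Lemma hcontD f g : hcont f -> hcont g -> hcont (fun t => f t + g t).
Proof.
move=> /hcontP cf /hcontP cg; apply/hcontP => t.
by apply: cvgD; [exact: cf|exact: cg].
Qed.

Lemma hcontM f g : hcont f -> hcont g -> hcont (fun t => f t * g t).
Proof.
move=> /hcontP cf /hcontP cg; apply/hcontP => t.
by apply: cvgM; [exact: cf|exact: cg].
Qed.

Lemma hcontZ (k : R) f : hcont f -> hcont (fun t => k * f t).
Proof. by move=> cf; apply: hcontM => //; exact: hcont_cst. Qed.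

Lemma hcontN f : hcont f -> hcont (fun t => - f t).
Proof. by move=> /(@hcontZ (-1) _); apply: eq_hcont => t _; rewrite mulN1r. Qed.

Lemma hcontB f g : hcont f -> hcont g -> hcont (fun t => f t - g t).
Proof. by move=> cf cg; apply: hcontD => //; exact: hcontN. Qed.

Lemma hcont_norm f : hcont f -> hcont (fun t => `|f t|).
Proof.
move=> /hcontP cf; apply/hcontP => t.
by apply: cvg_norm; exact: cf.
Qed.

Lemma hcont_min (c : R) f : 0 <= c -> hcont f -> hcont (fun t => f (Num.min t c)).
Proof.
move=> c0 /hcontP cf; apply/hcontP => t.
have E s : Num.min (Num.max s 0) c = Num.max (Num.min s c) 0.
  by rewrite /Num.max /Num.min; do ! case: ifPn; lra.
under eq_fun do rewrite E.
have mc : Num.min (s : R) c @[s --> t] --> Num.min t c.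
  by apply: normed_module.continuous_min; [exact: cvg_id|exact: cvg_cst].
rewrite /continuous_at; exact: (@cvg_comp _ _ _ (fun s : R => Num.min s c) (fun s : R => f (Num.max s 0)) _ _ _ mc (cf _)).
Qed.

Lemma hcont_cvg f (u : nat -> R) (t : R) : hcont f -> (forall n, 0 <= u n) -> 0 <= t ->
  u n @[n --> \oo] --> t -> f (u n) @[n --> \oo] --> f t.
Proof.
move=> /hcontP cf u0 t0 ut.
have := cvg_comp _ _ ut (cf t); rewrite max_l//.
by rewrite (_ : _ \o _ = f \o u)//; apply/funext => n /=; rewrite max_l.
Qed.

Lemma hcont_at f (t : R) : hcont f -> 0 < t -> {for t, continuous f}.
Proof.
move=> /hcontP cf t0; have := cf t; rewrite /continuous_at max_l ?ltW//.
apply: cvg_trans; apply: near_eq_cvg.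
have : \forall s \near t, 0 < s by exact: lt_nbhsr.
by apply: filterS => s s0; rewrite /= max_l ?ltW.
Qed.

Lemma hcont_right f (t : R) : hcont f -> 0 <= t -> f s @[s --> t^'+] --> f t.
Proof.
move=> /hcontP cf t0; have := cf t; rewrite /continuous_at max_l// => ct.
apply: cvg_trans (cvg_at_right_filter ct).
apply: near_eq_cvg; near=> s.
have ts : t < s by near: s; exact: nbhs_right_gt.
by rewrite /= max_l// (le_trans t0 (ltW ts)).
Unshelve. all: by end_near. Qed.

Lemma hcont_left f (t : R) : hcont f -> 0 < t -> f s @[s --> t^'-] --> f t.
Proof.
by move=> cf t0; exact: (cvg_at_left_filter (hcont_at cf t0)).
Qed.

Lemma hcont_seg f (a b : R) : hcont f -> 0 <= a -> {within `[a, b], continuous f}.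
Proof.
move=> cf a0; apply: continuous_subspaceW cf => t /=; rewrite !in_itv/= andbT => /andP[at_ _].
exact: le_trans at_.
Qed.

Lemma hcont_bounded f (T : R) : hcont f -> 0 <= T ->
  exists K, forall t, 0 <= t -> t <= T -> `|f t| <= K.
Proof.
move=> cf T0.
have [c _ hc] := EVT_max T0 (hcont_seg (b := T) (hcont_norm cf) (lexx 0)).
by exists `|f c| => t t0 tT; apply: hc; rewrite in_itv/= t0.
Qed.

(** Compactness of [[0, T]], used as a near-covering property. Only [s] is confined to the segment;
    [t] may overshoot [T]. *)
Lemma hcont_unif f (T e : R) : hcont f -> 0 < e ->
  exists2 del, 0 < del & forall s t, 0 <= s -> s <= T -> 0 <= t ->
    `|s - t| < del -> `|f s - f t| < e.
Proof.
move=> /hcontP cf e0.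
set g := fun t => _ in cf.
have /compact_near_coveringP nc := @segment_compact R 0 T.
have := nc R (0^'+) (fun del s => forall t, `|s - t| < del -> `|g s - g t| < e) _.
have H : forall x, `[0, T]%classic x -> \forall x' \near x & i \near 0^'+,
    forall t, `|x' - t| < i -> `|g x' - g t| < e.
  move=> x _; have /cvgrPdist_lt /(_ (e / 2) ltac:(lra)) := cf x.
  move=> /nbhs_ballP[r /= r0 xr].
  exists (ball x (r / 2), [set i | i < r / 2]).
    split => /=; first by apply: nbhsx_ballx; lra.
    by apply: nbhs_right_lt; lra.
  move=> [x' i] /= [xx' ir] t x't.
  have h1 : `|g x - g x'| < e / 2.
    by apply: xr; apply: le_ball xx'; lra.
  have h2 : `|g x - g t| < e / 2.
    apply: xr; rewrite /ball/= in xx' *; rewrite (_ : x - t = (x - x') + (x' - t)); last by ring.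
    by rewrite (le_lt_trans (ler_normD _ _))//; lra.
  rewrite (_ : g x' - g t = (g x - g t) - (g x - g x')); last by ring.
  by rewrite (le_lt_trans (ler_normB _ _))//; lra.
move=> /(_ _ H) [del /= del0 hd].
exists (del / 2); first lra.
move=> s t s0 sT t0 st.
have := hd (del / 2) _ _ s _ t st.
rewrite /g !max_l//; apply; last 2 first.
- lra.
- by rewrite /= in_itv/= s0.
- by rewrite /ball_/= sub0r normrN ger0_norm; lra.
Qed.

End continuous_on_halfline.

(** * Measurability with respect to the filtration *)

Section filtration_measurability.
Context {d : measure_display} {Omega : measurableType d} {R : realType}.
Variables (P : probability Omega R) (F : filtration Omega R).
Implicit Types (f g : Omega -> R) (A : set Omega) (G : set (set Omega)).

Lemma wrt_cst G (k : R) : measurable_wrt G (fun=> k).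
Proof. exact: measurable_cst. Qed.

Lemma wrtD G f g : measurable_wrt G f -> measurable_wrt G g ->
  measurable_wrt G (fun w => f w + g w).
Proof. exact: (@measurable_funD _ (g_sigma_algebraType G)). Qed.

Lemma wrtB G f g : measurable_wrt G f -> measurable_wrt G g ->
  measurable_wrt G (fun w => f w - g w).
Proof. exact: (@measurable_funB _ (g_sigma_algebraType G)). Qed.

Lemma wrtM G f g : measurable_wrt G f -> measurable_wrt G g ->
  measurable_wrt G (fun w => f w * g w).
Proof. exact: (@measurable_funM _ (g_sigma_algebraType G)). Qed.

Lemma wrtZ G (k : R) f : measurable_wrt G f -> measurable_wrt G (fun w => k * f w).
Proof. by apply: wrtM; exact: wrt_cst. Qed.

Lemma wrt_norm G f : measurable_wrt G f -> measurable_wrt G (fun w => `|f w|).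
Proof. by move=> mf; apply: (@measurableT_comp _ _ _ (g_sigma_algebraType G)). Qed.

Lemma wrt_sum G (I : Type) (s : seq I) (f : I -> Omega -> R) :
  (forall i, measurable_wrt G (f i)) ->
  measurable_wrt G (fun w => \sum_(i <- s) f i w).
Proof.
move=> mf; elim: s => [|i s ih].
  by under eq_fun do rewrite big_nil; exact: wrt_cst.
by under eq_fun do rewrite big_cons; exact: wrtD.
Qed.

Lemma wrt_cvg G (f_ : nat -> Omega -> R) f : (forall n, measurable_wrt G (f_ n)) ->
  (forall w, f_ n w @[n --> \oo] --> f w) -> measurable_wrt G f.
Proof.
move=> mf ff.
by apply: (@measurable_fun_cvg _ (g_sigma_algebraType G) _ setT f_) => // w _; exact: ff.
Qed.

Lemma FtE t : 0 <= t -> @measurable _ (g_sigma_algebraType (F t)) = F t.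
Proof. by move=> t0; apply: sigma_algebra_id; exact: filt_sigma_algebra. Qed.

Lemma wrt_pre t f (U : set R) : 0 <= t -> measurable_wrt (F t) f -> measurable U ->
  F t (f @^-1` U).
Proof.
by move=> t0 mf mU; rewrite -(FtE t0) -[X in measurable X]setTI; exact: mf.
Qed.

Lemma wrt_ge t f (a : R) : 0 <= t -> measurable_wrt (F t) f -> F t [set w | a <= f w].
Proof.
move=> t0 mf; have := wrt_pre t0 mf (measurable_itv `[a, +oo[).
by congr (F t _); apply/seteqP; split => w /=; rewrite in_itv/= andbT.
Qed.

Lemma wrt_gt t f (a : R) : 0 <= t -> measurable_wrt (F t) f -> F t [set w | a < f w].
Proof.
move=> t0 mf; have := wrt_pre t0 mf (measurable_itv `]a, +oo[).
by congr (F t _); apply/seteqP; split => w /=; rewrite in_itv/= andbT.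
Qed.

Lemma wrt_of_pre t f : 0 <= t -> (forall U, measurable U -> F t (f @^-1` U)) ->
  measurable_wrt (F t) f.
Proof. by move=> t0 H _ U mU; rewrite setTI FtE//; exact: H. Qed.

Lemma FtC t A : 0 <= t -> F t A -> F t (~` A).
Proof. by move=> t0; rewrite -(FtE t0); exact: measurableC. Qed.

Lemma FtI t A B : 0 <= t -> F t A -> F t B -> F t (A `&` B).
Proof. by move=> t0; rewrite -(FtE t0); exact: measurableI. Qed.

Lemma FtU t A B : 0 <= t -> F t A -> F t B -> F t (A `|` B).
Proof. by move=> t0; rewrite -(FtE t0); exact: measurableU. Qed.

Lemma FtT t : 0 <= t -> F t setT.
Proof. by move=> t0; rewrite -(FtE t0); exact: measurableT. Qed.

Lemma Ft_bigcup t (A : nat -> set Omega) : 0 <= t -> (forall n, F t (A n)) ->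
  F t (\bigcup_n A n).
Proof. by move=> t0 mA; rewrite -(FtE t0); apply: bigcup_measurable => n _; rewrite FtE. Qed.

Lemma Ft_bigcap t (A : nat -> set Omega) : 0 <= t -> (forall n, F t (A n)) ->
  F t (\bigcap_n A n).
Proof. by move=> t0 mA; rewrite -(FtE t0); apply: bigcap_measurable => [|n _]; [by exists 0%N|rewrite FtE]. Qed.

Lemma wrt_indic t A : 0 <= t -> F t A -> measurable_wrt (F t) (\1_A : Omega -> R).
Proof.
move=> t0 FA; have mA : measurable (A : set (g_sigma_algebraType (F t))) by rewrite FtE.
exact: (@measurable_indic _ (g_sigma_algebraType (F t))).
Qed.

Lemma wrt_mono s t f : 0 <= s -> s <= t -> measurable_wrt (F s) f ->
  measurable_wrt (F t) f.
Proof.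
move=> s0 st mf; apply: wrt_of_pre => [|U mU]; first exact: le_trans st.
by apply: (filt_mono s0 st); exact: wrt_pre.
Qed.

Lemma wrt_meas t f : 0 <= t -> measurable_wrt (F t) f -> measurable_fun setT f.
Proof.
move=> t0 mf _ U mU; rewrite setTI; apply: (@filt_sub _ _ _ F _ t0).
exact: wrt_pre.
Qed.

Lemma Ft_meas t A : 0 <= t -> F t A -> measurable A.
Proof. by move=> t0; exact: filt_sub. Qed.

Lemma Ft_negl t A : usual_conditions P F -> 0 <= t -> P.-negligible A -> F t A.
Proof. by move=> [_ hN _] t0 nA; apply: (filt_mono (lexx 0) t0); exact: hN. Qed.

(** The preimages under [f] and [g] differ only inside a negligible set, every subset of which
    belongs to [F t] under the usual conditions. *)
Lemma wrt_ae t f g : usual_conditions P F -> 0 <= t -> measurable_wrt (F t) f ->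
  {ae P, forall w, f w = g w} -> measurable_wrt (F t) g.
Proof.
move=> HF t0 mf fg; apply: wrt_of_pre => // U mU.
set N := ~` [set w | f w = g w].
have nN : P.-negligible N := fg.
rewrite (_ : g @^-1` U = (f @^-1` U `&` ~` N) `|` (g @^-1` U `&` N)).
  apply: FtU => //.
    apply: FtI => //; first exact: wrt_pre.
    by apply: FtC => //; exact: Ft_negl.
  by apply: Ft_negl => //; apply: negligibleS nN => w [].
apply/seteqP; split => w /=.
- move=> Ug; have [e|ne] := pselect (f w = g w); last by right.
  by left; split; [rewrite /= e|move=> /(_ e)].
- by move=> [[Uf] /contrapT/= <-|[]].
Qed.

End filtration_measurability.

(** * Continuous martingales *)

Section continuous_martingales.
Context {d : measure_display} {Omega : measurableType d} {R : realType}.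
Variables (P : probability Omega R) (F : filtration Omega R).
Implicit Types (X Y : process (Omega := Omega) (R := R)).
Local Notation Ex := (Ex P).
Local Notation integ := (integ P).

(** A martingale all of whose paths are continuous, with the conditional expectation written as an
    equality of expectations over each event of [F s]. *)
Definition cmart X := [/\ adapted F X, forall w, hcont (X w),
  forall t, 0 <= t -> integ (X ^~ t) &
  forall s t A, 0 <= s -> s <= t -> F s A ->
    Ex (fun w => \1_A w * X w t) = Ex (fun w => \1_A w * X w s)].

Lemma integral_setE (A : set Omega) (f : Omega -> R) :
  (\int[P]_(w in A) (f w)%:E = \int[P]_w (\1_A w * f w)%:E)%E.
Proof.
rewrite integral_mkcond; apply: eq_integral => w _.
by rewrite patchE indicE; case: ifPn => _; rewrite ?mul1r ?mul0r.
Qed.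

Lemma cadlag_hcont X : (forall w, hcont (X w)) -> cadlag_paths X.
Proof.
move=> cX w; split => t t0; first exact: hcont_right.
by apply/cvg_ex; exists (X w t); exact: hcont_left.
Qed.

Lemma cmart_martingale X : cmart X -> martingale P F X.
Proof.
move=> [aX cX iX mX]; split => //; first exact: cadlag_hcont.
move=> s t s0 st; have t0 := le_trans s0 st; split => //; first exact: aX.
- exact: iX.
- move=> A FA; have mA := Ft_meas s0 FA.
  rewrite [LHS]integral_setE [RHS]integral_setE [LHS]Ex_EFin; last by apply: integ_indic => //; exact: iX.
  rewrite [RHS]Ex_EFin; last by apply: integ_indic => //; exact: iX.
  by congr EFin; apply/esym; exact: mX.
Qed.

Lemma martingale_cmart X : (forall w, hcont (X w)) -> martingale P F X -> cmart X.
Proof.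
move=> cX [aX _ iX mX]; split => // s t A s0 st FA.
have [_ _ /(_ A FA)] := mX s t s0 st; have mA := Ft_meas s0 FA.
rewrite [X in X = _ -> _]integral_setE [X in _ = X -> _]integral_setE.
rewrite [X in X = _ -> _]Ex_EFin; last by apply: integ_indic => //; exact: iX.
rewrite [X in _ = X -> _]Ex_EFin; first by move=> [->].
by apply: integ_indic => //; apply: iX; exact: le_trans st.
Qed.

(** As long as [N] is at least [x], the sum is the integer part of [x]. It serves to replace a
    bounded weight by a sum of indicators of its level sets. *)
Lemma count_le_dist (N : nat) (x : R) : 0 <= x -> x <= N%:R ->
  `|x - \sum_(j < N) (if j.+1%:R <= x then 1 else 0)| <= 1.
Proof.
have up : forall n, 0 <= x -> \sum_(j < n) (if j.+1%:R <= x then 1 else 0) <= x.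
  elim=> [|n ih] x0; first by rewrite big_ord0.
  rewrite big_ord_recr/=; case: ifPn => h; last by rewrite addr0 ih.
  apply: le_trans h; rewrite -natr1 lerD2r.
  rewrite (le_trans (ler_sum _ (G := fun=> 1) _)) ?sumr_const ?card_ord//.
  by move=> i _; case: ifP.
move=> x0 xN; rewrite ger0_norm ?subr_ge0 ?up//.
elim: N xN => [|n ih] xn; first by rewrite big_ord0; lra.
have [xn'|nx] := leP x n%:R.
  by rewrite big_ord_recr/= opprD addrA; have := ih xn'; case: ifP => _; lra.
rewrite big_ord_recr/= (eq_bigr (fun=> 1)) ?sumr_const ?card_ord.
  by case: ifPn => _; rewrite -natr1 in xn; lra.
move=> i _; rewrite ifT// (le_trans _ (ltW nx))// ler_nat.
exact: ltn_ord.
Qed.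

Lemma cmart_wt0 X s t (H : Omega -> R) K : cmart X -> 0 <= s -> s <= t ->
  measurable_wrt (F s) H -> (forall w, `|H w| <= K) ->
  Ex (fun w => H w * (X w t - X w s)) = 0.
Proof.
move=> [aX cX iX mX] s0 st mH HK; have t0 := le_trans s0 st.
have iD : integ (fun w => X w t - X w s) by apply: integB; exact: iX.
have D0 A : F s A -> Ex (fun w => \1_A w * (X w t - X w s)) = 0.
  move=> FA; have mA := Ft_meas s0 FA.
  under eq_fun do rewrite mulrBr.
  rewrite ExB; [|by apply: integ_indic => //; exact: iX..].
  by rewrite (mX _ _ _ s0 st FA) subrr.
(* The shift makes the weight nonnegative, with values in [[0, 2 * K]], as counting levels
   requires. *)
pose G w := H w + K.
have mHm := wrt_meas s0 mH.
have mG : measurable_wrt (F s) G by apply: wrtD => //; exact: wrt_cst.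
have G0 w : 0 <= G w by have := HK w; rewrite /G ler_norml => /andP[]; lra.
have G2 w : G w <= 2 * K by have := HK w; rewrite /G ler_norml => /andP[]; lra.
have iG : integ (fun w => G w * (X w t - X w s)).
  apply: (integM_bd (K := 2 * K)) => //; first exact: (wrt_meas s0 mG).
  by move=> w; rewrite ger0_norm.
have [m Km] : exists m : nat, 2 * K <= m%:R.
  by exists (Num.trunc (2 * K)).+1; exact/ltW/truncnS_gt.
(* [n G] is within 1 of a sum of indicators of the [F s]-sets [j + 1 <= n G],
   for which the identity is the martingale property. *)
have step (n : nat) : n%:R * `|Ex (fun w => G w * (X w t - X w s))| <=
    Ex (fun w => `|X w t - X w s|).
  pose A (j : nat) := [set w | j.+1%:R <= n%:R * G w].
  have FA j : F s (A j) by apply: wrt_ge => //; exact: wrtZ.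
  pose S w := \sum_(j < n * m) (\1_(A j) w : R).
  have SE w : S w = \sum_(j < n * m) (if j.+1%:R <= n%:R * G w then 1 else 0).
    apply: eq_bigr => j _; rewrite indicE; case: ifPn => h.
      by rewrite mem_set.
    by rewrite memNset//; exact/negP.
  have dS w : `|n%:R * G w - S w| <= 1.
    rewrite SE; apply: count_le_dist; first by rewrite mulr_ge0.
    by rewrite natrM ler_wpM2l// (le_trans (G2 w)).
  have iS : integ (fun w => S w * (X w t - X w s)).
    under eq_fun do rewrite mulr_suml.
    apply: integ_sum => j; apply: integ_indic => //; exact: (Ft_meas s0 (FA j)).
  have S0 : Ex (fun w => S w * (X w t - X w s)) = 0.
    under eq_fun do rewrite mulr_suml.
    rewrite Ex_sum; first by rewrite big1// => j _; exact: D0.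
    by move=> j; apply: integ_indic => //; exact: (Ft_meas s0 (FA j)).
  have -> : n%:R * `|Ex (fun w => G w * (X w t - X w s))| =
      `|Ex (fun w => (n%:R * G w - S w) * (X w t - X w s))|.
    under [X in _ = `|Ex X|]eq_fun do rewrite mulrBl -mulrA.
    rewrite ExB//; last exact: integZ.
    by rewrite ExZ// S0 subr0 normrM ger0_norm.
  have iGS : integ (fun w => (n%:R * G w - S w) * (X w t - X w s)).
    under eq_fun do rewrite mulrBl -mulrA.
    by apply: integB => //; exact: integZ.
  apply: (le_trans (Ex_norm_le iGS)); apply: Ex_le.
  - exact: integ_norm.
  - exact: integ_norm.
  - by move=> w; rewrite normrM ler_piMl.
(* By [step], [n] times the absolute value stays below a constant [c] independent of [n]; if the
   value were [e > 0], an index above [c / e] would contradict this. *)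
have E0 : Ex (fun w => G w * (X w t - X w s)) = 0.
  apply/eqP; rewrite -normr_eq0; apply/eqP/le_anti; rewrite normr_ge0 andbT.
  set e := `|_| in step *; set c := Ex _ in step.
  rewrite leNgt; apply/negP => e0.
  have := step (Num.trunc (c / e)).+1.
  by rewrite -ler_pdivlMr// leNgt truncnS_gt.
have := D0 setT (FtT F s0).
rewrite (_ : (fun w => _) = (fun w => X w t - X w s)); last first.
  by apply/funext => w; rewrite indicT mul1r.
move=> E1.
rewrite (_ : (fun w => _) = (fun w => G w * (X w t - X w s) - K * (X w t - X w s))).
  by rewrite ExB// ?ExZ// ?E0 ?E1 ?mulr0 ?subrr//; exact: integZ.
by apply/funext => w; rewrite /G; ring.
Qed.

Lemma cmart_wt X s t (H : Omega -> R) K : cmart X -> 0 <= s -> s <= t ->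
  measurable_wrt (F s) H -> (forall w, `|H w| <= K) ->
  Ex (fun w => H w * X w t) = Ex (fun w => H w * X w s).
Proof.
move=> mX s0 st mH HK; have := cmart_wt0 mX s0 st mH HK.
have [_ _ iX _] := mX; have mHm := wrt_meas s0 mH.
under eq_fun do rewrite mulrBr.
rewrite ExB.
- by move/eqP; rewrite subr_eq0 => /eqP.
- by apply: (integM_bd mHm HK); apply: iX; exact: le_trans st.
- by apply: (integM_bd mHm HK); exact: iX.
Qed.

Lemma cmart_wt_proc X (H : Omega -> R) K : cmart X ->
  measurable_wrt (F 0) H -> (forall w, `|H w| <= K) ->
  cmart (fun w t => H w * X w t).
Proof.
move=> mX mH HK; have [aX cX iX eX] := mX; have mHm := wrt_meas (lexx 0) mH; split.
- by move=> t t0; apply: wrtM; [exact: (wrt_mono (lexx 0) t0)|exact: aX].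
- by move=> w; exact: hcontZ.
- by move=> t t0; apply: (integM_bd mHm HK); exact: iX.
- move=> s t A s0 st FA; have mA := Ft_meas s0 FA.
  under eq_fun do rewrite mulrA; under [X in _ = Ex X]eq_fun do rewrite mulrA.
  apply: (cmart_wt (K := K)) => //.
    by apply: wrtM; [exact: wrt_indic|exact: (wrt_mono (lexx 0) s0)].
  move=> w; rewrite normrM (le_trans _ (HK w))// ler_piMl//.
  exact: norm_indic_le1.
Qed.

Lemma cmartD X Y : cmart X -> cmart Y -> cmart (fun w t => X w t + Y w t).
Proof.
move=> [aX cX iX eX] [aY cY iY eY]; split.
- by move=> t t0; apply: wrtD; [exact: aX|exact: aY].
- by move=> w; exact: hcontD.
- by move=> t t0; apply: integD; [exact: iX|exact: iY].
- move=> s t A s0 st FA; have mA := Ft_meas s0 FA; have t0 := le_trans s0 st.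
  under eq_fun do rewrite mulrDr; under [X in _ = Ex X]eq_fun do rewrite mulrDr.
  rewrite ExD; [|by apply: integ_indic => //; exact: iX|by apply: integ_indic => //; exact: iY].
  rewrite ExD; [|by apply: integ_indic => //; exact: iX|by apply: integ_indic => //; exact: iY].
  by rewrite (eX _ _ _ s0 st FA) (eY _ _ _ s0 st FA).
Qed.

Lemma cmartZ X (k : R) : cmart X -> cmart (fun w t => k * X w t).
Proof.
move=> mX; apply: (cmart_wt_proc (H := fun=> k) (K := `|k|)) => //.
exact: wrt_cst.
Qed.

Lemma cmartB X Y : cmart X -> cmart Y -> cmart (fun w t => X w t - Y w t).
Proof.
move=> mX /(@cmartZ _ (-1)) mY; have := cmartD mX mY.
by congr cmart; apply/funext => w; apply/funext => t; rewrite mulN1r.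
Qed.

Lemma cmart_sum (I : Type) (s : seq I) (X : I -> process (Omega := Omega) (R := R)) :
  (forall i, cmart (X i)) -> cmart (fun w t => \sum_(i <- s) X i w t).
Proof.
move=> mX; elim: s => [|i s ih]; last first.
  have := cmartD (mX i) ih.
  by congr cmart; apply/funext => w; apply/funext => t; rewrite big_cons.
under eq_fun do under eq_fun do rewrite big_nil.
split.
- by move=> t t0; exact: wrt_cst.
- by move=> w; exact: hcont_cst.
- by move=> t t0; exact: integ_cst.
- by [].
Qed.

Lemma cmart_F0 (H : Omega -> R) : measurable_wrt (F 0) H -> integ H ->
  cmart (fun w t => H w).
Proof.
move=> mH iH; split => //.
- by move=> t t0; exact: (wrt_mono (lexx 0) t0).
- by move=> w; exact: hcont_cst.
Qed.

(** Adaptedness of [Y] comes from the completeness of the filtration, through [wrt_ae]. *)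
Lemma cmart_ae X Y : usual_conditions P F -> cmart X -> (forall w, hcont (Y w)) ->
  indistinguishable P X Y -> cmart Y.
Proof.
move=> HF [aX cX iX eX] cY XY.
have XYt t : 0 <= t -> {ae P, forall w, X w t = Y w t}.
  by move=> t0; move: XY; apply: filterS => w; exact.
have YXt t : 0 <= t -> {ae P, forall w, Y w t = X w t}.
  by move=> t0; move: XY; apply: filterS => w h; rewrite h.
have aY : adapted F Y by move=> t t0; apply: (wrt_ae HF t0 (aX t t0)); exact: XYt.
have mY t : 0 <= t -> measurable_fun setT (Y ^~ t).
  by move=> t0; apply: (wrt_meas t0); exact: aY.
split => //.
- by move=> t t0; apply: (Ex_ae (mY t t0) (iX t t0) (YXt t t0)).1.
- move=> s t A s0 st FA; have mA := Ft_meas s0 FA; have t0 := le_trans s0 st.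
  have E u : 0 <= u -> Ex (fun w => \1_A w * Y w u) = Ex (fun w => \1_A w * X w u).
    move=> u0; apply: (Ex_ae _ _ _).2.
    - by apply: measurable_funM; [exact: measurable_indic|exact: mY].
    - by apply: integ_indic => //; exact: iX.
    - by move: (YXt u u0); apply: filterS => w ->.
  by rewrite (E t t0) (E s s0) (eX _ _ _ s0 st FA).
Qed.

End continuous_martingales.

(** * Uniform integrability *)

Section uniform_integrability.
Context {d : measure_display} {T : measurableType d} {R : realType}.
Variable P : probability T R.

(** The function [(|x| - K)^+]. It is convex, so it turns a martingale into a submartingale, and
    continuous, unlike the truncation by the event [|x| > K]; its expectation measures uniform
    integrability. The rest of [x] is its projection [clip K x] onto [[-K, K]]. *)
Definition excess (K x : R) : R := Num.max 0 (`|x| - K).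
Definition clip (K x : R) : R := Num.max (- K) (Num.min x K).

Lemma excess_ge0 K x : 0 <= excess K x.
Proof. by rewrite /excess le_max lexx. Qed.

Lemma excess_le_norm K x : 0 <= K -> excess K x <= `|x|.
Proof. by move=> K0; rewrite /excess ge_max normr_ge0/=; lra. Qed.

Lemma clip_norm K x : 0 <= K -> `|clip K x| <= K.
Proof.
move=> K0; rewrite ler_norml /clip /Num.max /Num.min.
by do ! case: ifPn; lra.
Qed.

Lemma sub_clip K x : 0 <= K -> `|x - clip K x| = excess K x.
Proof.
move=> K0; rewrite /excess /clip.
have [x0|x0] := lerP 0 x; rewrite ?(ger0_norm x0) ?(ltr0_norm x0).
  rewrite [Num.max (- K) _]max_r; last by rewrite le_min; lra.
  have [xK|Kx] := lerP x K; last by rewrite max_r ?ger0_norm; lra.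
  by rewrite subrr normr0 max_l; lra.
rewrite [Num.min _ _]min_l; last by lra.
have [xK|Kx] := lerP x (- K); last by rewrite subrr normr0 max_l; lra.
by rewrite max_r ?ler0_norm; lra.
Qed.

Lemma measurable_excess K (f : T -> R) : measurable_fun setT f ->
  measurable_fun setT (fun w => excess K (f w)).
Proof.
move=> mf; apply: measurable_maxr => //; apply: measurable_funB => //.
exact: measurableT_comp.
Qed.

Lemma measurable_clip K (f : T -> R) : measurable_fun setT f ->
  measurable_fun setT (fun w => clip K (f w)).
Proof. by move=> mf; apply: measurable_maxr => //; exact: measurable_minr. Qed.

Lemma clip_cvg K (u : nat -> R) l : u n @[n --> \oo] --> l ->
  clip K (u n) @[n --> \oo] --> clip K l.
Proof.
move=> ul; have cc : continuous (clip K).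
  move=> x.
  have c1 (k : R) : {for x, continuous (fun=> k : R^o)} by exact: cst_continuous.
  have c2 : {for x, continuous (fun y : R => y : R^o)} by exact: cvg_id.
  exact: (normed_module.continuous_max (c1 _) (normed_module.continuous_min c2 (c1 _))).
exact: (cvg_comp _ _ ul (cc l)).
Qed.

Lemma integ_excess K (f : T -> R) : 0 <= K -> integ P f ->
  integ P (fun w => excess K (f w)).
Proof.
move=> K0 fi; apply: (integ_le (g := fun w => `|f w|)).
- exact/measurable_excess/(integ_meas fi).
- by move=> w; rewrite ger0_norm ?excess_ge0// excess_le_norm.
- exact: integ_norm.
Qed.

Lemma excess_cvg0 (f : T -> R) : integ P f ->
  Ex P (fun w => excess k%:R (f w)) @[k --> \oo] --> 0.
Proof.
move=> fi; have mf := integ_meas fi; rewrite -[X in _ --> X](Ex_cst P).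
apply: (Ex_cvg (g := fun w => `|f w|) _ _ _ _ _).2.
- by move=> k; exact: measurable_excess.
- exact: measurable_cst.
- exact: integ_norm.
- by apply: aeW => w k; rewrite ger0_norm ?excess_ge0// excess_le_norm.
apply: aeW => w; apply: cvg_near_cst; near=> k.
rewrite /excess; apply/max_idPl; rewrite subr_le0.
apply/ltW; apply: lt_le_trans (truncnS_gt _) _; rewrite ler_nat.
by near: k; exact: nbhs_infty_ge.
Unshelve. all: by end_near. Qed.

(** Vitali's convergence theorem. Clipping at level [k] leaves a bounded part, treated by dominated
    convergence, and an excess of expectation at most [dl k] for every [n]; Fatou's lemma carries
    this bound over to the limit. *)
Lemma unif_integ_cvg (Z_ : nat -> T -> R) (Z : T -> R) (dl : nat -> R) :
  (forall n, integ P (Z_ n)) -> measurable_fun setT Z ->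
  {ae P, forall w, Z_ n w @[n --> \oo] --> Z w} ->
  (forall k n, Ex P (fun w => excess k%:R (Z_ n w)) <= dl k) ->
  dl k @[k --> \oo] --> 0 ->
  integ P Z /\ forall B, measurable B ->
    Ex P (fun w => \1_B w * Z_ n w) @[n --> \oo] --> Ex P (fun w => \1_B w * Z w).
Proof.
move=> iZ_ mZ ZZ Zdl dl0.
have mZ_ n : measurable_fun setT (Z_ n) := integ_meas (iZ_ n).
(* At level 0 the excess is the absolute value, so [dl 0] bounds all the first moments. *)
have [iZ0 _] : integ P (fun w => `|Z w|) /\ Ex P (fun w => `|Z w|) <= dl 0%N.
  apply: (Ex_fatou (f_ := fun n w => `|Z_ n w|)) => //.
  - by move=> n; exact: integ_norm.
  - exact: measurableT_comp.
  - by move: ZZ; apply: filterS => w; exact: cvg_norm.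
  - apply: nearW => n; apply: le_trans (Zdl 0%N n).
    by apply: Ex_le => [||w]; [exact: integ_norm|exact: integ_excess|rewrite /excess subr0 le_max lexx orbT].
have iZ : integ P Z by apply: (integ_le mZ _ iZ0) => w.
split=> // B mB.
have Zk k : Ex P (fun w => excess k%:R (Z w)) <= dl k.
  apply: (Ex_fatou (f_ := fun n w => excess k%:R (Z_ n w)) _ _ _ _ _ _).2.
  - by move=> n; apply: integ_excess.
  - exact: measurable_excess.
  - by move=> n w; exact: excess_ge0.
  - by move=> w; exact: excess_ge0.
  - move: ZZ; apply: filterS => w h.
    have := @clip_cvg k%:R _ _ h => h2.
    under eq_fun do rewrite -sub_clip//; rewrite -sub_clip//.
    by apply: cvg_norm; exact: cvgB.
  - by apply: nearW => n; exact: Zdl.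
have psi k : Ex P (fun w => `|clip k%:R (Z_ n w) - clip k%:R (Z w)|) @[n --> \oo] --> 0.
  rewrite -[X in _ --> X](Ex_cst P).
  apply: (Ex_cvg (g := fun w => 2 * k%:R) _ _ _ _ _).2.
  - move=> n; apply: measurableT_comp => //.
    by apply: measurable_funB; exact: measurable_clip.
  - exact: measurable_cst.
  - exact: integ_cst.
  - apply: aeW => w n; rewrite normr_id (le_trans (ler_normB _ _))//.
    by rewrite mulr_natl mulr2n lerD// clip_norm.
  - move: ZZ; apply: filterS => w h.
    rewrite -[X in _ --> X](@normr0 _ R) -[X in `|X|](subrr (clip k%:R (Z w))).
    by apply: cvg_norm; apply: cvgB; [exact: clip_cvg|exact: cvg_cst].
apply/cvgrPdist_lt => e e0.
have e3 : 0 < e / 3 by rewrite divr_gt0.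
have /cvgrPdist_lt/(_ _ e3)[k _ hk] := dl0.
have {hk} := hk k (leqnn k); rewrite sub0r normrN => dk.
have /cvgrPdist_lt/(_ _ e3)[m _ hm] := psi k.
exists m => // n /= mn; have {hm} := hm n mn; rewrite sub0r normrN => pn.
rewrite distrC -ExB; [|exact: integ_indic..].
have iC f : measurable_fun setT f -> integ P (fun w => clip k%:R (f w)).
  by move=> mf; apply: (@integ_bd _ _ _ _ _ k%:R); [exact: measurable_clip|move=> w; exact: clip_norm].
have i1 : integ P (fun w => `|clip k%:R (Z_ n w) - clip k%:R (Z w)|).
  by apply/integ_norm/integB; exact: iC.
have iB : integ P (fun w => \1_B w * Z_ n w - \1_B w * Z w).
  by apply: integB; exact: integ_indic.
apply: (le_lt_trans (Ex_norm_le iB)).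
apply: (@le_lt_trans _ _ (Ex P (fun w => (excess k%:R (Z_ n w) + excess k%:R (Z w)) +
   `|clip k%:R (Z_ n w) - clip k%:R (Z w)|))).
  apply: Ex_le.
  - exact: integ_norm.
  - by apply: integD => //; apply: integD; exact: integ_excess.
  move=> w; rewrite -mulrBr normrM.
  apply: (@le_trans _ _ `|Z_ n w - Z w|).
    by rewrite ler_piMl// norm_indic_le1.
  rewrite -!sub_clip//.
  set a := clip _ _; set b := clip _ _.
  rewrite (_ : Z_ n w - Z w = (Z_ n w - a) - (Z w - b) + (a - b)); last by ring.
  by rewrite (le_trans (ler_normD _ _))// lerD2r ler_normB.
rewrite ExD//; last by apply: integD; exact: integ_excess.
rewrite ExD; [|exact: integ_excess..].
have := Zdl k n; have := Zk k.
have := ler_norm (Ex P (fun w => `|clip k%:R (Z_ n w) - clip k%:R (Z w)|)).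
by have := ler_norm (dl k); lra.
Qed.

End uniform_integrability.

(** * Optional stopping *)

Section grid.
Context {R : realType}.
Implicit Types (u f : R -> R) (x : \bar R) (r s t : R).

(** There are [n.+1] steps, so that no step length divides by zero; the end [t] has index [n.+1]. *)
Definition grid s t (n i : nat) : R := s + i%:R * ((t - s) / n.+1%:R).

(* The index of the first of the [k] first grid points that is [>= x], and [k]
   if there is none. *)
Definition grid_index s t n x (k : nat) : nat :=
  (\sum_(i < k) ((grid s t n i)%:E < x)%E)%N.

Lemma grid0 s t n : grid s t n 0 = s.
Proof. by rewrite /grid mul0r addr0. Qed.

Lemma grid_last s t n : grid s t n n.+1 = t.
Proof. by rewrite /grid mulrC divfK ?pnatr_eq0// addrC subrK. Qed.

Lemma gridS s t n i : grid s t n i.+1 = grid s t n i + (t - s) / n.+1%:R.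
Proof. by rewrite /grid -natr1 mulrDl mul1r addrA. Qed.

Lemma grid_step_ge0 s t n : s <= t -> 0 <= (t - s) / n.+1%:R.
Proof. by move=> st; rewrite divr_ge0// subr_ge0. Qed.

Lemma grid_homo s t n : s <= t -> {homo grid s t n : i j / (i <= j)%N >-> i <= j}.
Proof.
move=> st i j ij; rewrite /grid lerD2l ler_wpM2r ?grid_step_ge0//.
by rewrite ler_nat.
Qed.

Lemma grid_ge s t n i : s <= t -> s <= grid s t n i.
Proof. by move=> st; rewrite -{1}(grid0 s t n); exact: grid_homo. Qed.

Lemma grid_le s t n i : s <= t -> (i <= n.+1)%N -> grid s t n i <= t.
Proof. by move=> st ni; rewrite -{2}(grid_last s t n); exact: grid_homo. Qed.

Lemma grid_indexS s t n x k : grid_index s t n x k.+1 =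
  (grid_index s t n x k + ((grid s t n k)%:E < x)%E)%N.
Proof. by rewrite /grid_index big_ord_recr. Qed.

Lemma grid_index_le s t n x k : (grid_index s t n x k <= k)%N.
Proof.
elim: k => [|k ih]; first by rewrite /grid_index big_ord0.
rewrite /grid_index big_ord_recr/=; rewrite -addn1 leq_add//.
by case: (_ < _)%E.
Qed.

Lemma grid_index_full s t n x k : s <= t -> ((grid s t n k)%:E < x)%E ->
  grid_index s t n x k = k.
Proof.
move=> st kx; rewrite /grid_index (eq_bigr (fun=> 1%N)); first by rewrite sum1_card card_ord.
move=> i _; rewrite (le_lt_trans _ kx)// lee_fin.
by apply: grid_homo => //; exact/ltnW/ltn_ord.
Qed.

(** Telescoping: the conditions [grid i < x] hold exactly for the steps before the index. Evaluation
    at a random grid time thus becomes a sum of increments, each weighted by an event known at the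
    left end of its step. *)
Lemma grid_index_sum s t n x k f : s <= t ->
  f (grid s t n (grid_index s t n x k)) = f s +
   \sum_(i < k) (if ((grid s t n i)%:E < x)%E
                 then f (grid s t n i.+1) - f (grid s t n i) else 0).
Proof.
move=> st; elim: k => [|k ih].
  by rewrite /grid_index !big_ord0 grid0 addr0.
rewrite big_ord_recr/= addrA -ih grid_indexS; case: ifPn => kx.
  by rewrite (grid_index_full st kx) addn1 addrC subrK.
by rewrite addn0 addr0.
Qed.

Lemma grid_index_bounds s t n x k : s <= t ->
  (grid_index s t n x k = k \/ (x <= (grid s t n (grid_index s t n x k))%:E)%E) /\
  (forall i, (i < grid_index s t n x k)%N -> ((grid s t n i)%:E < x)%E).
Proof.
move=> st; elim: k => [|k [ih1 ih2]].
  by rewrite /grid_index big_ord0; split; [left|].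
have [kx|xk] := ltP (grid s t n k)%:E x.
  rewrite grid_indexS kx (grid_index_full st kx) addn1; split; first by left.
  by move=> i ik; apply: le_lt_trans kx; rewrite lee_fin; apply: grid_homo.
have -> : grid_index s t n x k.+1 = grid_index s t n x k.
  by rewrite grid_indexS ltNge xk addn0.
split=> //; case: ih1 => [e|]; last by right.
by right; rewrite e.
Qed.

(* Only meaningful for [0 <= x]: at [x = -oo] it has the junk value [0]. *)
Definition stop_at t x : R := fine (Order.min t%:E x).

Lemma stop_at_fin t r : stop_at t r%:E = Num.min t r.
Proof. by rewrite /stop_at -EFin_min. Qed.

Lemma stop_at_y t : stop_at t +oo%E = t.
Proof. by rewrite /stop_at miney. Qed.

Lemma stop_at_le t x : (0 <= x)%E -> stop_at t x <= t.
Proof. by case: x => [r||]// _; rewrite ?stop_at_fin ?stop_at_y// ge_min lexx. Qed.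

Lemma stop_at_ge0 t x : (0 <= x)%E -> 0 <= t -> 0 <= stop_at t x.
Proof.
case: x => [r||]// x0 t0; rewrite ?stop_at_fin ?stop_at_y//.
by rewrite le_min t0/= -lee_fin.
Qed.

Lemma stop_at_lex t x : (0 <= x)%E -> ((stop_at t x)%:E <= x)%E.
Proof.
by case: x => [r||]// _; rewrite ?stop_at_fin ?leey// lee_fin ge_min lexx orbT.
Qed.

Lemma stop_at_id t x : (t%:E <= x)%E -> stop_at t x = t.
Proof.
case: x => [r||]// h; rewrite ?stop_at_fin ?stop_at_y//.
by rewrite min_l// -lee_fin.
Qed.

Lemma stop_at_r t r : r <= t -> stop_at t r%:E = r.
Proof. by move=> h; rewrite stop_at_fin min_r. Qed.

(** The grid starts at [s], so the value approached is the minimum of [t] and [x] raised to at least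
    [s]: for [x <= s] the index is 0. *)
Lemma grid_index_cvg s t n x : s <= t -> (0 <= x)%E ->
  `|grid s t n (grid_index s t n x n.+1) - Num.max s (stop_at t x)| <= (t - s) / n.+1%:R.
Proof.
move=> st x0; have h0 := grid_step_ge0 n st.
have [H1 H2] := grid_index_bounds n x n.+1 st.
have cle := grid_index_le s t n x n.+1.
move: H1 H2 cle; set c := grid_index _ _ _ _ _ => H1 H2 cle.
case: x x0 @c H1 H2 cle => [r||]// r0 c H1 H2 cle; last first.
  have -> : c = n.+1 by case: H1.
  by rewrite grid_last stop_at_y max_r// subrr normr0.
rewrite stop_at_fin.
have ct := grid_le st cle; have sc := grid_ge n c st.
have lo : c = 0%N \/ grid s t n c - (t - s) / n.+1%:R < r.
  case: (posnP c) => [->|cp]; first by left.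
  right; have := H2 c.-1; rewrite prednK// leqnn => /(_ isT).
  by rewrite lte_fin; rewrite -{2}(prednK cp) gridS addrK.
have hi : grid s t n c = t \/ r <= grid s t n c.
  by case: H1 => [->|]; [left; rewrite grid_last|rewrite lee_fin; right].
have lo' : grid s t n c = s \/ grid s t n c - (t - s) / n.+1%:R < r.
  by case: lo => [->|]; [left; rewrite grid0|right].
move: (grid s t n c) ((t - s) / n.+1%:R) h0 ct sc hi lo' => g h h0 ct sc hi lo'.
have [rt|tr] := lerP r t; last first.
  by rewrite (max_r st) ler_norml; apply/andP; split; case: hi => hi; case: lo' => lo''; lra.
by have [sr|rs] := lerP s r; rewrite ler_norml; apply/andP; split; case: hi => hi; case: lo' => lo''; lra.
Qed.

Lemma invS_cvg0 (k : R) : k / n.+1%:R @[n --> \oo] --> 0.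
Proof.
rewrite -[X in _ --> X](mulr0 k); apply: cvgM; first exact: cvg_cst.
exact: cvg_harmonic.
Qed.

Lemma grid_cvg s t x : s <= t -> (0 <= x)%E ->
  grid s t n (grid_index s t n x n.+1) @[n --> \oo] --> Num.max s (stop_at t x).
Proof.
move=> st x0; apply: cvg_sub0 (cvg_cst _).
apply/cvgr0Pnorm_le => e e0.
have /cvgr0Pnorm_le/(_ e e0) := invS_cvg0 (t - s).
apply: filterS => n /= h.
by rewrite (le_trans (grid_index_cvg n st x0))// (le_trans (ler_norm _)).
Qed.

End grid.

(** * Stopped martingales as limits over grids *)

Section stopping.
Context {d : measure_display} {Omega : measurableType d} {R : realType}.
Variables (P : probability Omega R) (F : filtration Omega R).
Implicit Types (X Y : process (Omega := Omega) (R := R)) (tau sigma : Omega -> \bar R).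
Local Notation Ex := (Ex P).
Local Notation integ := (integ P).

Lemma stoppedE tau X w t : stopped tau X w t = X w (stop_at t (tau w)).
Proof. by []. Qed.

Lemma stopping_gt tau s : stopping_time F tau -> 0 <= s -> F s [set w | (s%:E < tau w)%E].
Proof.
move=> [_ st] s0; rewrite (_ : [set _ | _] = ~` [set w | (tau w <= s%:E)%E]).
  by apply: FtC => //; exact: st.
by apply/seteqP; split => w /=; rewrite ltNge => /negP.
Qed.

Lemma stopped_hcont tau X w : (0 <= tau w)%E -> hcont (X w) -> hcont (stopped tau X w).
Proof.
move=> t0 cX; rewrite (_ : stopped tau X w = fun t => X w (stop_at t (tau w)))//.
case: (tau w) t0 => [r||]// r0; last first.
  by apply: eq_hcont cX => t _; rewrite stop_at_y.
apply: (eq_hcont (f := fun t => X w (Num.min t r))) => [t _|].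
  by rewrite stop_at_fin.
by apply: hcont_min => //; rewrite -lee_fin.
Qed.

(** The usual discretisation of a stopping time from above: [X] at the first grid time that is
    [>= tau], or at [t] if there is none. *)
Definition grid_stopped s t n tau X w : R :=
  X w (grid s t n (grid_index s t n (tau w) n.+1)).

Lemma grid_stoppedE s t n tau X w : s <= t -> grid_stopped s t n tau X w =
  X w s + \sum_(i < n.+1) \1_[set w' | ((grid s t n i)%:E < tau w')%E] w *
    (X w (grid s t n i.+1) - X w (grid s t n i)).
Proof.
move=> st; rewrite /grid_stopped (grid_index_sum _ _ _ (X w) st); congr (_ + _).
apply: eq_bigr => i _; rewrite indicE; case: ifPn => h.
  by rewrite mem_set// mul1r.
by rewrite memNset ?mul0r//; exact/negP.
Qed.

Lemma grid_stopped_funE s t n tau X : s <= t -> grid_stopped s t n tau X =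
  (fun w => X w s + \sum_(i < n.+1) \1_[set w' | ((grid s t n i)%:E < tau w')%E] w *
    (X w (grid s t n i.+1) - X w (grid s t n i))).
Proof. by move=> st; apply/funext => w; exact: grid_stoppedE. Qed.

Lemma indic_set (p : Omega -> bool) w : \1_[set w' | p w'] w = (if p w then 1 else 0) :> R.
Proof.
by rewrite indicE; case: ifPn => h; [rewrite mem_set|rewrite memNset//; exact/negP].
Qed.

Lemma grid_stopped_cvg s t tau X w : 0 <= s -> s <= t -> (0 <= tau w)%E -> hcont (X w) ->
  grid_stopped s t n tau X w @[n --> \oo] --> X w (Num.max s (stop_at t (tau w))).
Proof.
move=> s0 st t0 cX; apply: (hcont_cvg (u := fun n => grid s t n (grid_index s t n (tau w) n.+1))) => //.
- by move=> n; apply: (le_trans s0); exact: grid_ge.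
- by rewrite le_max s0.
- exact: grid_cvg.
Qed.

(** The value at time [t] is a limit of finite sums over grids of [[0, t]], whose terms are all
    known at time [t]. *)
Lemma stopped_adapted tau X : stopping_time F tau -> adapted F X ->
  (forall w, hcont (X w)) -> adapted F (stopped tau X).
Proof.
move=> st aX cX t t0.
apply: (wrt_cvg (f_ := fun n => grid_stopped 0 t n tau X)); last first.
  move=> w; have := grid_stopped_cvg (lexx 0) t0 (st.1 w) (cX w).
  by rewrite max_r//; apply: stop_at_ge0 => //; exact: st.1.
move=> n; rewrite grid_stopped_funE//.
have gw i : (i <= n.+1)%N -> measurable_wrt (F t) (fun w => X w (grid 0 t n i)).
  move=> ni; have g0 := grid_ge n i t0.
  by apply: (wrt_mono g0); [exact: grid_le|exact: aX].
apply: wrtD; first by rewrite -(grid0 0 t n); exact: gw.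
apply: wrt_sum => i; apply: wrtM; last first.
  by apply: wrtB; apply: gw => //; exact: ltnW.
have g0 := grid_ge n i t0.
apply: wrt_indic => //; apply: (filt_mono g0); last exact: stopping_gt.
by apply: grid_le => //; exact: ltnW.
Qed.

(** Conditional Jensen inequality by a supporting affine function: [g u] is affine in [X u], with
    coefficients fixed by the events [C] and [D] of [F s]. It equals the excess at time [s], lies
    below it at time [t], and has the same expectation at both times. *)
Lemma excess_submart X s t B (k : R) : cmart P F X -> 0 <= k -> 0 <= s -> s <= t -> F s B ->
  Ex (fun w => \1_B w * excess k (X w s)) <= Ex (fun w => \1_B w * excess k (X w t)).
Proof.
move=> [aX cX iX mX] k0 s0 st FB; have t0 := le_trans s0 st; have mB := Ft_meas s0 FB.
pose C := B `&` [set w | k < X w s]; pose D := B `&` [set w | k < - X w s].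
have FC : F s C by apply: FtI => //; apply: wrt_gt => //; exact: aX.
have FD : F s D.
  apply: FtI => //; rewrite (_ : [set _ | _] = [set w | k < -1 * X w s]).
    by apply: wrt_gt => //; apply: wrtZ; exact: aX.
  by apply/seteqP; split => w /=; rewrite mulN1r.
have mC := Ft_meas s0 FC; have mD := Ft_meas s0 FD.
pose g u w := (\1_C w * X w u - \1_D w * X w u) - k * (\1_C w + \1_D w) : R.
have i1 E : measurable E -> integ \1_E.
  move=> mE; apply: (@integ_bd _ _ _ _ _ 1); first exact: measurable_indic.
  exact: norm_indic_le1.
have iCD : integ (fun w => k * (\1_C w + \1_D w)) by apply: integZ; apply: integD; exact: i1.
have ig1 u : 0 <= u -> integ (fun w => \1_C w * X w u - \1_D w * X w u).
  by move=> u0; apply: integB; apply: integ_indic => //; exact: iX.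
have ig u : 0 <= u -> integ (g u).
  by move=> u0; apply: integB => //; exact: ig1.
have -> : (fun w => \1_B w * excess k (X w s)) = g s.
  apply/funext => w; rewrite /g /C /D !indicI /excess /= !indic_set.
  have [x0|x0] := lerP 0 (X w s); rewrite ?(ger0_norm x0) ?(ltr0_norm x0).
    rewrite [k < - _]ltNge (_ : - X w s <= k = true)/=; last by apply/idP; lra.
    have [xk|kx] := lerP (X w s) k; last by rewrite max_r; [ring|lra].
    by rewrite max_l; [ring|lra].
  rewrite [k < X w s]ltNge (_ : X w s <= k = true)/=; last by apply/idP; lra.
  have [xk|kx] := lerP (- X w s) k; last by rewrite max_r; [ring|lra].
  by rewrite max_l; [ring|lra].
have -> : Ex (g s) = Ex (g t).
  rewrite /g ExB//; last exact: ig1.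
  rewrite ExB; [|by apply: integ_indic => //; exact: iX..].
  rewrite -(mX s t C)// -(mX s t D)// -ExB; [|by apply: integ_indic => //; exact: iX..].
  by rewrite -ExB//; exact: ig1.
apply: Ex_le => [||w]; [exact: ig|by apply: integ_indic => //; apply: integ_excess => //; exact: iX|].
rewrite /g /C /D !indicI /excess /= !indic_set.
have B01 : \1_B w = 0 :> R \/ \1_B w = 1 :> R.
  by rewrite indicE; case: (_ \in _); [right|left].
have h0 : 0 <= Num.max 0 (`|X w t| - k) by rewrite le_max lexx.
have h1 : `|X w t| - k <= Num.max 0 (`|X w t| - k) by rewrite le_max lexx orbT.
have := ler_norm (X w t); have := ler_norm (- X w t); rewrite normrN => n1 n2.
move: (Num.max _ _) h0 h1 => m h0 h1.
case: B01 => ->; first by rewrite !mul0r !addr0 mulr0 subrr subr0.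
by rewrite !mul1r; case: ltrP => h; case: ltrP => h'; lra.
Qed.

(** Discrete optional stopping: [Y] at time [t] minus its stopped value is the sum of the increments
    over the events [tau <= grid i], each known at the left end of its step, so every term has
    nonnegative expectation. *)
Lemma grid_stopped_submart s t n tau Y : (forall u, 0 <= u -> integ (Y ^~ u)) ->
  (forall u v B, 0 <= u -> u <= v -> F u B ->
    Ex (fun w => \1_B w * Y w u) <= Ex (fun w => \1_B w * Y w v)) ->
  stopping_time F tau -> 0 <= s -> s <= t ->
  integ (grid_stopped s t n tau Y) /\
  Ex (grid_stopped s t n tau Y) <= Ex (Y ^~ t).
Proof.
move=> iY sY st s0 st'.
have g0 i : 0 <= grid s t n i by rewrite (le_trans s0)//; exact: grid_ge.
have FG i : F (grid s t n i) [set w' | ((grid s t n i)%:E < tau w')%E].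
  exact: stopping_gt.
have i1 : integ (grid_stopped s t n tau Y).
  rewrite grid_stopped_funE//.
  apply: integD; first exact: iY.
  apply: integ_sum => i; apply: integ_indic; first exact: (Ft_meas (g0 i) (FG i)).
  by apply: integB; exact: iY.
split=> //.
rewrite -subr_ge0 -ExB; [|exact: iY (le_trans s0 st')|by []].
have -> : (fun w => Y w t - grid_stopped s t n tau Y w) =
  (fun w => \sum_(i < n.+1) (\1_(~` [set w' | ((grid s t n i)%:E < tau w')%E]) w *
     Y w (grid s t n i.+1) - \1_(~` [set w' | ((grid s t n i)%:E < tau w')%E]) w * Y w (grid s t n i))).
  apply/funext => w.
  rewrite grid_stoppedE//.
  have -> : Y w t = Y w s + \sum_(i < n.+1) (Y w (grid s t n i.+1) - Y w (grid s t n i)).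
    rewrite -(big_mkord xpredT (fun i => Y w (grid s t n i.+1) - Y w (grid s t n i))).
    by rewrite telescope_sumr// grid_last grid0 addrC subrK.
  rewrite opprD addrACA subrr add0r -sumrB; apply: eq_bigr => i _.
  rewrite !indicE; case: (boolP (w \in [set _ | _])) => h.
    by rewrite (_ : (w \in ~` _) = false) ?mul1r ?mul0r ?subrr//; apply/negP; rewrite in_setC h.
  by rewrite (_ : (w \in ~` _) = true) ?mul1r ?mul0r ?subr0// in_setC h.
have iI i : integ (fun w => \1_(~` [set w' | ((grid s t n i)%:E < tau w')%E]) w * Y w (grid s t n i)) /\
   integ (fun w => \1_(~` [set w' | ((grid s t n i)%:E < tau w')%E]) w * Y w (grid s t n i.+1)).
  have mN : measurable (~` [set w' | ((grid s t n i)%:E < tau w')%E]).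
    by apply: measurableC; exact: (Ft_meas (g0 i) (FG i)).
  by split; apply: integ_indic => //; exact: iY.
rewrite Ex_sum; last by move=> i; apply: integB; [exact: (iI i).2|exact: (iI i).1].
apply: sumr_ge0 => i _; rewrite ExB; [|exact: (iI i).2|exact: (iI i).1].
rewrite subr_ge0; apply: sY => //; first by apply: grid_homo.
by apply: FtC => //; exact: FG.
Qed.

Lemma grid_stopped_excess s t n tau X (k : R) : cmart P F X -> stopping_time F tau ->
  0 <= k -> 0 <= s -> s <= t ->
  Ex (fun w => excess k (grid_stopped s t n tau X w)) <= Ex (fun w => excess k (X w t)).
Proof.
move=> mX st k0 s0 st'; have [aX cX iX eX] := mX.
apply: (@grid_stopped_submart s t n tau (fun w u => excess k (X w u)) _ _ st s0 st').2.
  by move=> u u0; apply: integ_excess => //; exact: iX.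
by move=> u v B u0 uv FB; exact: excess_submart.
Qed.

Lemma grid_stopped_E0 s t n tau X A : cmart P F X -> stopping_time F tau ->
  0 <= s -> s <= t -> F s A ->
  Ex (fun w => \1_A w * grid_stopped s t n tau X w) = Ex (fun w => \1_A w * X w s).
Proof.
move=> mX st s0 st' FA; have [aX cX iX eX] := mX; have mA := Ft_meas s0 FA.
have g0 i : 0 <= grid s t n i by rewrite (le_trans s0)//; exact: grid_ge.
have FG i : F (grid s t n i) (A `&` [set w' | ((grid s t n i)%:E < tau w')%E]).
  by apply: FtI => //; [apply: (filt_mono s0) FA; exact: grid_ge|exact: stopping_gt].
have -> : (fun w => \1_A w * grid_stopped s t n tau X w) = (fun w => \1_A w * X w s +
  \sum_(i < n.+1) (\1_(A `&` [set w' | ((grid s t n i)%:E < tau w')%E]) w * X w (grid s t n i.+1)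
   - \1_(A `&` [set w' | ((grid s t n i)%:E < tau w')%E]) w * X w (grid s t n i))).
  apply/funext => w; rewrite grid_stoppedE// mulrDr; congr (_ + _).
  by rewrite mulr_sumr; apply: eq_bigr => i _; rewrite indicI/=; ring.
have iI i j : integ (fun w => \1_(A `&` [set w' | ((grid s t n i)%:E < tau w')%E]) w * X w (grid s t n j)).
  by apply: integ_indic; [exact: (Ft_meas (g0 i) (FG i))|exact: iX].
rewrite ExD; last first.
- by apply: integ_sum => i; apply: integB; exact: iI.
- by apply: integ_indic => //; exact: iX.
rewrite Ex_sum; last by move=> i; apply: integB; exact: iI.
rewrite big1 ?addr0// => i _.
rewrite ExB//; apply/eqP; rewrite subr_eq0; apply/eqP; apply: eX => //.
exact: grid_homo.
Qed.

(* [X] at the discretised times [>= tau] is a sum of martingale increments over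
   sets of the filtration. As [excess k (X)] is a submartingale, these variables
   are uniformly integrable, so that no bound on [X] is needed for the limit. *)
Lemma stopped_cmart tau X : cmart P F X -> stopping_time F tau -> cmart P F (stopped tau X).
Proof.
move=> mX st; have [aX cX iX eX] := mX.
have aS : adapted F (stopped tau X) by exact: stopped_adapted.
have key s t : 0 <= s -> s <= t ->
   integ (fun w => X w (Num.max s (stop_at t (tau w)))) /\
   forall B, F s B -> Ex (fun w => \1_B w * X w (Num.max s (stop_at t (tau w)))) =
                      Ex (fun w => \1_B w * X w s).
  move=> s0 st'; have t0 := le_trans s0 st'.
  have mZ n : integ (grid_stopped s t n tau X).
    apply: (grid_stopped_submart n iX _ st s0 st').1 => u v B u0 uv FB.
    by rewrite (eX _ _ _ u0 uv FB).
  have cv w : grid_stopped s t n tau X w @[n --> \oo] --> X w (Num.max s (stop_at t (tau w))).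
    by apply: grid_stopped_cvg => //; exact: st.1.
  have [||||i1 c1] := @unif_integ_cvg _ _ _ P (fun n => grid_stopped s t n tau X)
    (fun w => X w (Num.max s (stop_at t (tau w)))) (fun k => Ex (fun w => excess k%:R (X w t))) mZ.
  - by apply: (measurable_fun_cvg (h := fun n => grid_stopped s t n tau X)) => [n|w _];
      [exact: (integ_meas (mZ n))|exact: cv].
  - by apply: aeW => w; exact: cv.
  - by move=> k n; exact: (grid_stopped_excess n mX st (ler0n _ k) s0 st').
  - by apply: excess_cvg0; exact: iX.
  split=> // B FB; have := c1 B (Ft_meas s0 FB).
  under eq_fun do rewrite (grid_stopped_E0 _ mX st s0 st' FB).
  by move=> /cvg_lim <-//; rewrite lim_cst.
have iS t : 0 <= t -> integ (stopped tau X ^~ t).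
  move=> t0; have [+ _] := key 0 t (lexx 0) t0.
  rewrite (_ : (fun w => _) = stopped tau X ^~ t)//.
  by apply/funext => w; rewrite max_r// stop_at_ge0//; exact: st.1.
split=> //; first by move=> w; apply: stopped_hcont => //; exact: st.1.
move=> s t A s0 st' FA; have t0 := le_trans s0 st'; have mA := Ft_meas s0 FA.
(* Where [tau <= s] the stopped process no longer moves between [s] and [t]; on [B] it is still at
   [X s] at time [s], so its increment is the one that [key] controls. *)
pose B := A `&` [set w | (s%:E < tau w)%E].
have FB : F s B by apply: FtI => //; exact: stopping_gt.
have mB := Ft_meas s0 FB.
have [ik /(_ B FB) ek] := key s t s0 st'.
apply/eqP; rewrite -subr_eq0 -ExB; [|by apply: integ_indic => //; exact: iS..].
rewrite (_ : (fun w => _) = (fun w => \1_B w * X w (Num.max s (stop_at t (tau w))) - \1_B w * X w s)).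
  by rewrite ExB ?ek ?subrr//; apply: integ_indic => //; exact: iX.
apply/funext => w; rewrite /B indicI/= indic_set.
rewrite !stoppedE; have [h|h] := ltP s%:E (tau w).
  rewrite mulr1 (stop_at_id (ltW h)) max_r//.
  have t1 := st.1 w; move: h t1; case: (tau w) => [r||]//; rewrite ?stop_at_y//.
  by rewrite lte_fin stop_at_fin le_min => h _; rewrite st' ltW.
have t1 := st.1 w; move: h t1; case: (tau w) => [r||]//.
by rewrite lee_fin => rs _; rewrite !stop_at_r ?(le_trans rs)//; ring.
Qed.

End stopping.

(** * Hitting times and localization *)

Section localization.
Context {d : measure_display} {Omega : measurableType d} {R : realType}.
Variables (P : probability Omega R) (F : filtration Omega R).
Implicit Types (X Y : process (Omega := Omega) (R := R)) (tau sigma : Omega -> \bar R).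
Local Notation Ex := (Ex P).
Local Notation integ := (integ P).

Lemma cvg_min_same (u v : nat -> \bar R) (l : \bar R) : u n @[n --> \oo] --> l ->
  v n @[n --> \oo] --> l -> (Order.min (u n) (v n) : \bar R) @[n --> \oo] --> l.
Proof.
move=> ul vl U Ul; have := ul U Ul; have := vl U Ul => h1 h2.
have h1' : \forall n \near \oo, U (v n) := h1.
have h2' : \forall n \near \oo, U (u n) := h2.
have : \forall n \near \oo, U (Order.min (u n) (v n)).
  by apply: filterS2 h1' h2' => n; rewrite /Order.min; case: ifP.
by [].
Qed.

Lemma stopping_min tau sigma : stopping_time F tau -> stopping_time F sigma ->
  stopping_time F (fun w => Order.min (tau w) (sigma w)).
Proof.
move=> [t0 tF] [s0 sF]; split=> [w|t t_ge0]; first by rewrite le_min t0 s0.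
rewrite (_ : [set _ | _] = [set w | (tau w <= t%:E)%E] `|` [set w | (sigma w <= t%:E)%E]).
  by apply: FtU => //; [exact: tF|exact: sF].
by apply/seteqP; split => w /=; rewrite ge_min => /orP.
Qed.

Lemma stopping_cst (r : R) : 0 <= r -> stopping_time F (fun=> r%:E).
Proof.
move=> r0; split=> [w|t t0]; first by rewrite lee_fin.
have [rt|tr] := leP r t.
  rewrite (_ : [set _ | _] = setT); first exact: FtT.
  by apply/seteqP; split => w //= _; rewrite lee_fin.
rewrite (_ : [set _ | _] = ~` setT); first by apply: FtC => //; exact: FtT.
rewrite setCT; apply/seteqP; split => w //=.
by rewrite lee_fin leNgt tr.
Qed.

Lemma localizing_min (tau sigma : nat -> Omega -> \bar R) : localizing_sequence F tau -> localizing_sequence F sigma ->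
  localizing_sequence F (fun n w => Order.min (tau n w) (sigma n w)).
Proof.
move=> [t1 t2 t3] [s1 s2 s3]; split.
- by move=> n; apply: stopping_min.
- by move=> w m n mn; apply: le_min2; [exact: t2|exact: s2].
- by move=> w; exact: cvg_min_same.
Qed.

Lemma localizing_nat : localizing_sequence F (fun n w => n%:R%:E).
Proof.
split.
- by move=> n; exact: stopping_cst.
- by move=> w m n mn; rewrite lee_fin ler_nat.
- by move=> w; apply/cvgeryP; exact: cvgr_idn.
Qed.

Definition hit Y (r : R) w : \bar R :=
  ereal_inf [set t%:E | t in [set t | 0 <= t /\ r <= Y w t]].

Lemma hit_ge0 Y r w : (0 <= hit Y r w)%E.
Proof. by apply: le_ereal_inf_tmp => _ /= [t [t0 _] <-]; rewrite lee_fin. Qed.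

Lemma lt_hit Y r w t : 0 <= t -> (t%:E < hit Y r w)%E -> Y w t < r.
Proof.
move=> t0 th; rewrite ltNge; apply/negP => rY.
have : (hit Y r w <= t%:E)%E by apply: ereal_inf_lbound; exists t.
by rewrite leNgt th.
Qed.

(** If [Y < r] on all of [[0, t]], right continuity at [t] prolongs this beyond [t], and the infimum
    exceeds [t]. *)
Lemma hit_le Y r w t : hcont (Y w) -> 0 <= t -> (hit Y r w <= t%:E)%E ->
  exists u, [/\ 0 <= u, u <= t & r <= Y w u].
Proof.
move=> cY t0 ht; apply: contrapT => /forallNP H.
have Hlt u : 0 <= u -> u <= t -> Y w u < r.
  by move=> u0 ut; rewrite ltNge; apply/negP => rY; apply: (H u).
have /cvgr_lt/(_ r (Hlt t t0 (lexx t))) := hcont_right cY t0.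
move=> [e /= e0 he].
have : ((t + e)%:E <= hit Y r w)%E.
  apply: le_ereal_inf_tmp => _ /= [u [u0 rY] <-]; rewrite lee_fin leNgt.
  apply/negP => ute; have [ut|tu] := leP u t.
    by have := Hlt u u0 ut; rewrite ltNge rY.
  have H1 : Y w u < r by apply: he => //=; rewrite ltr0_norm; lra.
  by move: H1; rewrite ltNge rY.
by move=> /le_trans/(_ ht); rewrite lee_fin; lra.
Qed.

(** A continuous path reaches [r] by time [t] exactly when, for each [m], it exceeds
    [r - 1 / (m + 1)] at some grid point: its maximum over [[0, t]] is then at least [r]. This
    writes the event with countably many events of [F t]. *)
Lemma hit_stopping Y r : adapted F Y -> (forall w, hcont (Y w)) ->
  stopping_time F (hit Y r).
Proof.
move=> aY cY; split=> [w|t t0]; first exact: hit_ge0.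
rewrite (_ : [set _ | _] = \bigcap_m \bigcup_j \bigcup_i
   (if (i <= j.+1)%N then [set w | r - m.+1%:R^-1 < Y w (grid 0 t j i)] else set0)).
  apply: Ft_bigcap => // m; apply: Ft_bigcup => // j; apply: Ft_bigcup => // i.
  case: ifPn => ij; last by rewrite -setCT; apply: FtC => //; exact: FtT.
  apply: wrt_gt => //; apply: (@wrt_mono _ _ _ _ (grid 0 t j i)).
  - exact: grid_ge.
  - exact: grid_le.
  - by apply: aY; exact: grid_ge.
apply/seteqP; split => w /=.
- move=> /(hit_le (cY w) t0)[u [u0 ut rY]] m _.
  have := grid_stopped_cvg (tau := fun=> u%:E) (w := w) (X := Y) (lexx 0) t0.
  rewrite lee_fin stop_at_r// max_r// => /(_ u0 (cY w)).
  have rm : r - m.+1%:R^-1 < Y w u.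
    by rewrite (lt_le_trans _ rY)// ltrBlDr ltrDl.
  move=> /cvgr_gt/(_ _ rm)[j _ /(_ j (leqnn j)) hj].
  exists j => //; exists (grid_index 0 t j u%:E j.+1) => //.
  by rewrite grid_index_le.
- move=> H.
  have [c] := EVT_max t0 (hcont_seg (b := t) (cY w) (lexx 0)).
  rewrite in_itv/= => /andP[c0 ct] hc.
  apply: (@le_trans _ _ c%:E); last by rewrite lee_fin.
  apply: ereal_inf_lbound; exists c => //; split => //=.
  apply/ler_addgt0Pr => e e0.
  have [m hm] : exists m : nat, m.+1%:R^-1 < e.
    exists (Num.trunc e^-1); rewrite -[ltRHS]invrK ltf_pV2 ?posrE ?invr_gt0//.
    exact: truncnS_gt.
  have [j _ [i _]] := H m I; case: ifPn => // ij /= hY.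
  have := hc (grid 0 t j i); rewrite in_itv/= grid_ge//= grid_le// => /(_ isT) h3.
  move: hm hY h3 => /= hm hY h3. by rewrite (le_trans _ (lerD h3 (ltW hm)))// ltW// -ltrBlDr.
Qed.

(** A continuous path does not overshoot: just before [u] it is still below [r]. At [u = 0] there is
    nothing before, whence the condition on [Y w 0]. *)
Lemma hit_reached Y r w u : hcont (Y w) -> Y w 0 < r -> 0 <= u -> (u%:E <= hit Y r w)%E ->
  Y w u <= r.
Proof.
move=> cY Y0 u0 uh; have [->|un0] := eqVneq u 0; first exact: ltW.
have up : 0 < u by rewrite lt_neqAle eq_sym un0.
rewrite leNgt; apply/negP => rY.
have /cvgr_gt/(_ r rY) h := hcont_left cY up.
have : \forall s \near u^'-, False.
  near=> s.
  have s0 : 0 < s by near: s; exact: nbhs_left_gt.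
  have su : s < u by near: s; exact: nbhs_left_lt.
  have : r < Y w s by near: s; exact: h.
  have /lt_hit : (s%:E < hit Y r w)%E by apply: lt_le_trans uh; rewrite lte_fin.
  by move=> /(_ (ltW s0)); lra.
by move=> /filter_ex[].
Unshelve. all: by end_near. Qed.

Lemma localizing_hit Y : adapted F Y -> (forall w, hcont (Y w)) ->
  localizing_sequence F (fun n => hit Y n%:R).
Proof.
move=> aY cY; split.
- by move=> n; exact: hit_stopping.
- move=> w m n mn; apply: ereal_inf_le_tmp => _ /= [t [t0 rY] <-].
  by exists t => //; split => //; rewrite (le_trans _ rY)// ler_nat.
- move=> w; apply/cvgeyPge => A.
  have A0 : 0 <= Num.max 0 A by rewrite le_max lexx.
  have [K hK] := hcont_bounded (cY w) A0.
  near=> n; apply: (@le_trans _ _ (Num.max 0 A)%:E).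
    by rewrite lee_fin le_max lexx orbT.
  rewrite leNgt; apply/negP => /ltW/(hit_le (cY w) A0)[u [u0 uA nY]].
  have := hK u u0 uA; have := ler_norm (Y w u).
  have : K < n%:R.
    apply: lt_le_trans (truncnS_gt _) _; rewrite ler_nat.
    by near: n; exact: nbhs_infty_ge.
  lra.
Unshelve. all: by end_near. Qed.

Lemma stop_at_stop_at t (x y : \bar R) : (0 <= x)%E -> (0 <= y)%E ->
  stop_at (stop_at t x) y = stop_at t (Order.min x y).
Proof.
case: x => [r||]// r0; case: y => [s||]// s0; rewrite -?EFin_min ?stop_at_fin ?minye ?miney ?stop_at_y ?stop_at_fin//.
by rewrite minA.
Qed.

Lemma localized_adapted D X : (forall w, hcont (X w)) -> (forall Y, D Y -> adapted F Y) ->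
  localized F D X -> adapted F X.
Proof.
move=> cX aD [mX0 [tau [[st _ lt] Dt]]] t t0.
apply: (wrt_cvg (f_ := fun n w => (stopped (tau n) X w t - X w 0) + X w 0)).
  move=> n; apply: wrtD; first exact: (aD _ (Dt n)).
  exact: (wrt_mono (lexx 0) t0).
move=> w; apply: cvg_near_cst.
have /cvgeyPge/(_ t) := lt w; apply: filterS => n h.
by rewrite subrK stoppedE stop_at_id.
Qed.

Lemma Mcloc_adapted X : Mcloc P F X -> adapted F X.
Proof. by move=> [lX cX]; apply: (localized_adapted cX _ lX) => Y []. Qed.

(** Every stopping time below [tau n] reduces [X] as well, so that several localizing sequences can
    be replaced by their minimum. *)
Lemma Mcloc_stopped X : Mcloc P F X -> exists2 tau, localizing_sequence F tau &
  forall n sigma, stopping_time F sigma -> (forall w, (sigma w <= tau n w)%E) ->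
    cmart P F (fun w t => stopped sigma X w t - X w 0).
Proof.
move=> [[mX0 [tau [lt Dt]]] cX]; exists tau => // n sigma ss st.
have [st_ _ _] := lt.
have mt : cmart P F (fun w t => stopped (tau n) X w t - X w 0).
  apply: martingale_cmart => // w; apply: hcontB; last exact: hcont_cst.
  by apply: stopped_hcont; [exact: (st_ n).1|exact: cX].
have := stopped_cmart mt ss; congr cmart.
apply/funext => w; apply/funext => t; rewrite [LHS]stoppedE; congr (_ - _).
rewrite !stoppedE stop_at_stop_at; [|exact: ss.1|exact: (st_ n).1].
by rewrite min_l.
Qed.

End localization.

(** * Continuous martingales of finite variation *)

Section variation_sums.
Context {R : realType}.
Implicit Types (f g : R -> R) (v : nat -> R).

Lemma variation_sum_le f v (m : nat) : {homo v : i j / (i <= j)%N >-> i <= j} ->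
  ((\sum_(i < m) `|f (v i.+1) - f (v i)|)%:E <= total_variation (v 0%N) (v m) f)%E.
Proof.
move=> vh; elim: m => [|m ih]; first by rewrite big_ord0 total_variation_ge0.
rewrite big_ord_recr/= (total_variationD f (vh 0%N m (leq0n m)) (vh m m.+1 (leqnSn m))).
by rewrite EFinD leeD// total_variation_ge// vh.
Qed.

Lemma hcont_eq_ext f g (c : R) : hcont f -> hcont g -> 0 < c ->
  (forall t, 0 <= t -> t < c -> f t = g t) -> f c = g c.
Proof.
move=> cf cg c0 fg; apply/eqP; rewrite -subr_eq0; apply/eqP.
have h : hcont (fun t => f t - g t) by exact: hcontB.
have := hcont_left h c0; have : (f s - g s) @[s --> c^'-] --> (0 : R).
  apply: cvg_near_cst; near=> s.
  have s0 : 0 < s by near: s; exact: nbhs_left_gt.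
  have sc : s < c by near: s; exact: nbhs_left_lt.
  by rewrite fg ?subrr// ltW.
by move=> h1 h2; apply: (cvg_unique _ h2 h1); exact: norm_hausdorff.
Unshelve. all: by end_near. Qed.

(** Rational times determine a continuous path; this is how an almost sure equality at each fixed
    time becomes one at all times together. *)
Lemma hcont_eq_dense f g : hcont f -> hcont g ->
  (forall k m : nat, f (k%:R / m.+1%:R) = g (k%:R / m.+1%:R)) ->
  forall t, 0 <= t -> f t = g t.
Proof.
move=> cf cg fg t t0.
pose u (m : nat) : R := (Num.trunc (t * m.+1%:R))%:R / m.+1%:R.
have u0 m : 0 <= u m by rewrite divr_ge0.
have ut : u m @[m --> \oo] --> t.
  apply: cvg_sub0 (cvg_cst _); apply/cvgr0Pnorm_le => e e0.
  have /cvgr0Pnorm_le/(_ e e0) := invS_cvg0 (1 : R).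
  apply: filterS => m /= h; apply: le_trans h; apply: le_trans (ler_norm _).
  have m0 : 0 < m.+1%:R :> R by [].
  have tm : 0 <= t * m.+1%:R by rewrite mulr_ge0.
  have lo : (Num.trunc (t * m.+1%:R))%:R <= t * m.+1%:R by rewrite truncn_le.
  have hi := truncnS_gt (t * m.+1%:R).
  suff : `|u m - t| <= 1 / m.+1%:R by [].
  have -> : u m - t = ((Num.trunc (t * m.+1%:R))%:R - t * m.+1%:R) / m.+1%:R.
    by rewrite mulrBl mulfK ?gt_eqF.
  rewrite normrM [X in _ * X]ger0_norm ?invr_ge0// ler_wpM2r ?invr_ge0//.
  move: (t * _) lo hi => x; rewrite -natr1 => lo hi.
  by rewrite ler0_norm; lra.
have h1 := hcont_cvg cf u0 t0 ut; have h2 := hcont_cvg cg u0 t0 ut.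
have E : (fun n => f (u n)) = (fun n => g (u n)) by apply/funext => n; exact: fg.
by rewrite E in h1; apply: (cvg_unique _ h1 h2); exact: norm_hausdorff.
Qed.

End variation_sums.

(** * Bounded continuous martingales with dominated variation sums *)

Section continuous_martingale_finite_variation.
Context {d : measure_display} {Omega : measurableType d} {R : realType}.
Variables (P : probability Omega R) (F : filtration Omega R).
Implicit Types (X Y L A : process (Omega := Omega) (R := R)).
Local Notation Ex := (Ex P).
Local Notation integ := (integ P).

(* No measurability is needed, the integral of a nonnegative function being a
   lower integral: [g] will be the variation of the paths. *)
Lemma integral_mono (f g : Omega -> \bar R) : (forall w, (0 <= f w)%E) ->
  (forall w, (f w <= g w)%E) -> (\int[P]_w f w <= \int[P]_w g w)%E.
Proof.
move=> f0 fg; rewrite ge0_integralTE// ge0_integralTE; last first.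
  by move=> w; exact: le_trans (fg w).
apply: ge_ereal_sup => _ [h hf <-]; apply: ereal_sup_ubound; exists h => // w.
exact: le_trans (hf w) (fg w).
Qed.

Lemma Ex_eq0 (f : Omega -> R) : integ f -> (forall w, 0 <= f w) -> Ex f = 0 ->
  {ae P, forall w, f w = 0}.
Proof.
move=> fi f0 E0.
have : (\int[P]_w `|(f w)%:E| = 0)%E.
  under eq_integral do rewrite /= ger0_norm//.
  by rewrite Ex_EFin// E0.
have mf : measurable_fun setT (EFin \o f) by apply/measurable_EFinP; exact: (integ_meas fi).
move/(ae_eq_integral_abs P measurableT mf).
by apply: filterS => w /= /(_ I) [].
Qed.

Lemma cmart_incr_sq X s t K : cmart P F X -> (forall w t, 0 <= t -> `|X w t| <= K) ->
  0 <= s -> s <= t ->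
  Ex (fun w => (X w t - X w s) ^+ 2) = Ex (fun w => X w t ^+ 2) - Ex (fun w => X w s ^+ 2).
Proof.
move=> mX XK s0 st; have [aX cX iX eX] := mX; have t0 := le_trans s0 st.
have mXt u : 0 <= u -> measurable_fun setT (X ^~ u) by move=> u0; exact: (integ_meas (iX u u0)).
have iXX u v : 0 <= u -> 0 <= v -> integ (fun w => X w u * X w v).
  move=> u0 v0; apply: (integM_bd (mXt u u0) (K := K)); last exact: iX.
  by move=> w; exact: XK.
have E0 := cmart_wt mX s0 st (aX s s0) (fun w => XK w s s0).
have -> : (fun w => (X w t - X w s) ^+ 2) =
    (fun w => (X w t * X w t - 2 * (X w s * X w t)) + X w s * X w s).
  by apply/funext => w; ring.
rewrite ExD; [|by apply: integB; [exact: iXX|apply: integZ; exact: iXX]|exact: iXX].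
rewrite ExB; [|exact: iXX|by apply: integZ; exact: iXX].
rewrite ExZ; last exact: iXX.
rewrite E0.
have -> : (fun w => X w t ^+ 2) = (fun w => X w t * X w t) by apply/funext => w; rewrite expr2.
have -> : (fun w => X w s ^+ 2) = (fun w => X w s * X w s) by apply/funext => w; rewrite expr2.
ring.
Qed.

(* [E (L t ^ 2)] is the expectation of the sum of the squared increments of [L],
   which is at most the largest increment times the variation. *)
Lemma bounded_cmart_fv_eq0 L (g : Omega -> R) K t : cmart P F L ->
  (forall w t, 0 <= t -> `|L w t| <= K) -> (forall w, L w 0 = 0) -> 0 <= t ->
  integ g ->
  {ae P, forall w (m : nat), \sum_(i < m.+1) `|L w (grid 0 t m i.+1) - L w (grid 0 t m i)| <= g w} ->
  {ae P, forall w, L w t = 0}.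
Proof.
move=> mL LK L0 t0 ig Lg; have [aL cL iL eL] := mL.
have g0 m i : 0 <= grid 0 t m i by exact: grid_ge.
have mLt u : 0 <= u -> measurable_fun setT (L ^~ u) by move=> u0; exact: (integ_meas (iL u u0)).
pose f_ (m : nat) w := \sum_(i < m.+1) (L w (grid 0 t m i.+1) - L w (grid 0 t m i)) ^+ 2.
have iLL u : 0 <= u -> integ (fun w => L w u ^+ 2).
  move=> u0; under eq_fun do rewrite expr2.
  by apply: (integM_bd (mLt u u0) (K := K)); [move=> w; exact: LK|exact: iL].
have iD m i : integ (fun w => (L w (grid 0 t m i.+1) - L w (grid 0 t m i)) ^+ 2).
  under eq_fun do rewrite expr2.
  apply: (@integM_bd _ _ _ _ _ _ (K + K)).
  - by apply: measurable_funB; exact: mLt.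
  - by move=> w; rewrite (le_trans (ler_normB _ _))// lerD// LK.
  - by apply: integB; exact: iL.
have if_ m : integ (f_ m) by apply: integ_sum => i; exact: iD.
have Ef m : Ex (f_ m) = Ex (fun w => L w t ^+ 2).
  rewrite Ex_sum// (eq_bigr (fun i : 'I_m.+1 =>
     Ex (fun w => L w (grid 0 t m i.+1) ^+ 2) - Ex (fun w => L w (grid 0 t m i) ^+ 2))); last first.
    by move=> i _; apply: (cmart_incr_sq (K := K)) => //; exact: grid_homo.
  rewrite -(big_mkord xpredT (fun i : nat => Ex (fun w => L w (grid 0 t m i.+1) ^+ 2) -
     Ex (fun w => L w (grid 0 t m i) ^+ 2))) telescope_sumr//.
  rewrite grid_last grid0 (_ : (fun w => L w 0 ^+ 2) = fun=> 0) ?Ex_cst ?subr0//.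
  by apply/funext => w; rewrite L0 expr0n.
have cv : Ex (f_ m) @[m --> \oo] --> Ex (fun=> 0 : R).
  apply: (Ex_cvg (g := fun w => 2 * K * g w) _ _ _ _ _).2.
  - by move=> m; exact: (integ_meas (if_ m)).
  - exact: measurable_cst.
  - exact: integZ.
  - move: Lg; apply: filterS => w Lg m.
    rewrite ger0_norm; last by apply: sumr_ge0 => i _; exact: sqr_ge0.
    have K0 : 0 <= K by rewrite (le_trans _ (LK w 0 (lexx 0))).
    apply: (@le_trans _ _ (2 * K * \sum_(i < m.+1) `|L w (grid 0 t m i.+1) - L w (grid 0 t m i)|)).
      rewrite mulr_sumr; apply: ler_sum => i _.
      rewrite -real_normK ?num_real// expr2 ler_wpM2r//.
      by rewrite mulr_natl mulr2n (le_trans (ler_normB _ _))// lerD// LK.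
    by rewrite ler_wpM2l// mulr_ge0.
  - move: Lg; apply: filterS => w Lg; apply/cvgr0Pnorm_le => e e0.
    have g00 : 0 <= g w by apply: le_trans (Lg 0%N); apply: sumr_ge0.
    (* The divisor is [g w + 1] because [g w] may vanish. *)
    have e1 : 0 < e / (g w + 1) by rewrite divr_gt0// ltr_wpDl.
    have [del del0 hdel] := hcont_unif t (cL w) e1.
    have /cvgr0Pnorm_lt/(_ _ del0) := invS_cvg0 (t - 0).
    apply: filterS => m hm.
    rewrite ger0_norm; last by apply: sumr_ge0 => i _; exact: sqr_ge0.
    apply: (@le_trans _ _ (e / (g w + 1) * \sum_(i < m.+1) `|L w (grid 0 t m i.+1) - L w (grid 0 t m i)|)).
      rewrite mulr_sumr; apply: ler_sum => i _.
      rewrite -real_normK ?num_real// expr2 ler_wpM2r//; apply/ltW/hdel => //.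
        exact: grid_le.
      by rewrite gridS addrC addKr.
    apply: (@le_trans _ _ (e / (g w + 1) * (g w + 1))).
      by rewrite ler_wpM2l ?(ltW e1)// (le_trans (Lg m))// lerDl.
    by rewrite divfK// gt_eqF// ltr_wpDl.
have E0 : Ex (fun w => L w t ^+ 2) = 0.
  move: cv; under eq_fun do rewrite Ef.
  by rewrite Ex_cst => /cvg_lim <-//; rewrite lim_cst.
have := Ex_eq0 (iLL t t0) (fun w => sqr_ge0 _) E0.
by apply: filterS => w /eqP; rewrite sqrf_eq0 => /eqP.
Qed.

(** The dominating variable is the supremum of the sums over the countably many grids: it is
    measurable, and stays below the variation of the path. *)
Lemma integrable_variation_dominates X (theta : Omega -> \bar R) t :
  integrable_variation P F X -> (forall w, hcont (X w)) -> stopping_time F theta -> 0 <= t ->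
  exists2 g : Omega -> R, integ g &
    forall w (m : nat), \sum_(i < m.+1) `|stopped theta X w (grid 0 t m i.+1) -
       stopped theta X w (grid 0 t m i)| <= g w.
Proof.
move=> [aX _ bX vX] cX st t0.
pose S m w := \sum_(i < m.+1) `|stopped theta X w (grid 0 t m i.+1) - stopped theta X w (grid 0 t m i)|.
have STV w m : ((S m w)%:E <= total_variation 0 t (X w))%E.
  pose v i := stop_at (grid 0 t m i) (theta w).
  have vh : {homo v : i j / (i <= j)%N >-> i <= j}.
    move=> i j /(grid_homo m t0) ij; rewrite /v.
    case: (theta w) (st.1 w) => [r||]// _; rewrite ?stop_at_y// !stop_at_fin.
    exact: le_min2.
  have := variation_sum_le (X w) m.+1 vh.
  have v0 : v 0%N = 0 by rewrite /v grid0 stop_at_id//; exact: st.1.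
  have vm : v m.+1 <= t by rewrite /v grid_last stop_at_le//; exact: st.1.
  have vm0 : 0 <= v m.+1 by rewrite stop_at_ge0//; [exact: st.1|exact: grid_ge].
  rewrite v0 => /le_trans; apply.
  by rewrite (total_variationD (X w) vm0 vm) leeDl// total_variation_ge0.
have fTV w : total_variation 0 t (X w) \is a fin_num by apply/bounded_variationP => //; exact: bX.
have SK w m : S m w <= fine (total_variation 0 t (X w)) by rewrite -lee_fin fineK.
have ub w : has_ubound (range (S ^~ w)).
  by exists (fine (total_variation 0 t (X w))) => _ [m _ <-].
have g0 m i : 0 <= grid 0 t m i by exact: grid_ge.
have mS m : measurable_fun setT (S m).
  have mst u : 0 <= u -> measurable_fun setT (stopped theta X ^~ u).
    by move=> u0; apply: (wrt_meas u0); exact: (stopped_adapted st aX cX).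
  apply: (@measurable_sum _ _ _ setT) => i; apply: measurableT_comp => //.
  by apply: measurable_funB; apply: mst.
pose g w := sups (S ^~ w) 0.
have Sg w m : S m w <= g w.
  apply: ub_le_sup; last by exists m.
  by exists (fine (total_variation 0 t (X w))) => _ [k _ <-].
have g_ge0 w : 0 <= g w by apply: le_trans (Sg w 0%N); apply: sumr_ge0.
have mg : measurable_fun setT g by apply: measurable_fun_sups.
exists g; last exact: Sg.
apply/integrableP; split; first exact/measurable_EFinP.
apply: le_lt_trans vX; under eq_integral do rewrite /= ger0_norm//.
apply: integral_mono => w; first by rewrite lee_fin.
rewrite /path_variation.
apply: (@le_trans _ _ (ereal_sup [set total_variation 0 t (X w) | t in [set t : R | 0 <= t]])); last first.
  by rewrite leeDr.
apply: (@le_trans _ _ (total_variation 0 t (X w))); last by apply: ereal_sup_ubound; exists t.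
rewrite -(fineK (fTV w)) lee_fin; apply: ge_sup; first by exists (S 0%N w); exists 0%N.
by move=> _ [m _ <-].
Qed.

End continuous_martingale_finite_variation.

(** * Uniqueness of the finite variation part *)

Section uniqueness.
Context {d : measure_display} {Omega : measurableType d} {R : realType}.
Variables (P : probability Omega R) (F : filtration Omega R).
Implicit Types (X Y L A : process (Omega := Omega) (R := R)).

Lemma ae_nat (Q : nat -> Omega -> Prop) : (forall n, {ae P, forall w, Q n w}) ->
  {ae P, forall w, forall n, Q n w}.
Proof. by move=> H; apply/ae_foralln. Qed.

Lemma integrable_variation_stopped A : Aloc P F A -> (forall w, hcont (A w)) ->
  exists2 sigma, localizing_sequence F sigma & forall n pi t, stopping_time F pi ->
    (forall w, (pi w <= sigma n w)%E) -> 0 <= t ->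
  exists2 g : Omega -> R, integ P g &
    forall w (m : nat), \sum_(i < m.+1) `|stopped pi A w (grid 0 t m i.+1) -
       stopped pi A w (grid 0 t m i)| <= g w.
Proof.
move=> [_ [sigma [ls vs]]] cA; exists sigma => // n pi t st le t0.
have [ss _ _] := ls.
have cX w : hcont (fun t => stopped (sigma n) A w t - A w 0).
  by apply: hcontB; [apply: stopped_hcont => //; exact: (ss n).1|exact: hcont_cst].
have [g ig hg] := integrable_variation_dominates (vs n) cX st t0.
exists g => // w m; apply: le_trans (hg w m); apply: ler_sum => i _.
have E u : stopped pi (fun w t => stopped (sigma n) A w t - A w 0) w u = stopped pi A w u - A w 0.
  rewrite stoppedE [X in X - _]stoppedE stop_at_stop_at; [|exact: st.1|exact: (ss n).1].
  by rewrite min_l.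
by rewrite !E (_ : _ - _ - (_ - _) = stopped pi A w (grid 0 t m i.+1) - stopped pi A w (grid 0 t m i))//; ring.
Qed.

(** The hypothesis is asked only strictly before [rho], since for processes on [B] the time [rho]
    itself may lie outside [B]; left continuity recovers it at [rho]. Only the increments of [A1]
    and [A2] matter, so their initial values may differ. *)
Lemma fv_part_unique L1 L2 A1 A2 (rho : Omega -> \bar R) :
  Mcloc0 P F L1 -> Mcloc0 P F L2 ->
  Aloc P F A1 -> (forall w, hcont (A1 w)) -> Aloc P F A2 -> (forall w, hcont (A2 w)) ->
  stopping_time F rho ->
  {ae P, forall w t, 0 <= t -> (t%:E < rho w)%E ->
     L1 w t - L2 w t = (A1 w t - A1 w 0) - (A2 w t - A2 w 0)} ->
  {ae P, forall w t, 0 <= t -> (t%:E <= rho w)%E ->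
     A1 w t - A1 w 0 = A2 w t - A2 w 0}.
Proof.
move=> [mL1 L10] [mL2 L20] vA1 cA1 vA2 cA2 sr H.
have cL1 : forall w, hcont (L1 w) := mL1.2.
have cL2 : forall w, hcont (L2 w) := mL2.2.
have aL1 := Mcloc_adapted mL1; have aL2 := Mcloc_adapted mL2.
have [tau1 lt1 mt1] := Mcloc_stopped mL1.
have [tau2 lt2 mt2] := Mcloc_stopped mL2.
have [sg1 ls1 vs1] := integrable_variation_stopped vA1 cA1.
have [sg2 ls2 vs2] := integrable_variation_stopped vA2 cA2.
pose Y : process (Omega := Omega) (R := R) := fun w t => `|L1 w t| + `|L2 w t|.
have cY w : hcont (Y w) by apply: hcontD; exact: hcont_norm.
have aY : adapted F Y.
  by move=> t t0; apply: wrtD; apply: wrt_norm; [exact: aL1|exact: aL2].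
have lh := localizing_hit aY cY.
have lth := localizing_min (localizing_min lt1 lt2) (localizing_min (localizing_min ls1 ls2) lh).
set theta := (fun n w => _) in lth.
pose pi n w := Order.min (theta n w) (rho w).
have sp n : stopping_time F (pi n) by apply: stopping_min => //; case: lth.
have pt1 n w : (pi n w <= tau1 n w)%E by rewrite /pi /theta !ge_min lexx.
have pt2 n w : (pi n w <= tau2 n w)%E by rewrite /pi /theta !ge_min lexx !orbT.
have ps1 n w : (pi n w <= sg1 n w)%E by rewrite /pi /theta !ge_min lexx !orbT.
have ps2 n w : (pi n w <= sg2 n w)%E by rewrite /pi /theta !ge_min lexx !orbT.
have ph n w : (pi n w <= hit Y n%:R w)%E by rewrite /pi /theta !ge_min lexx !orbT.
have pr n w : (pi n w <= rho w)%E by rewrite /pi ge_min lexx orbT.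
have p0 n w : (0 <= pi n w)%E by exact: (sp n).1.
pose L n : process (Omega := Omega) (R := R) := fun w t =>
  stopped (pi n) L1 w t - stopped (pi n) L2 w t.
have H' : {ae P, forall w t, 0 <= t -> (t%:E <= rho w)%E ->
     L1 w t - L2 w t = (A1 w t - A1 w 0) - (A2 w t - A2 w 0)}.
  move: H; apply: filterS => w Hw t t0 tr.
  have [->|tn0] := eqVneq t 0; first by rewrite L10 L20 !subrr.
  have tp : 0 < t by rewrite lt_neqAle eq_sym tn0.
  apply: (hcont_eq_ext (f := fun t => L1 w t - L2 w t)
    (g := fun t => (A1 w t - A1 w 0) - (A2 w t - A2 w 0))) => //.
  - exact: hcontB.
  - by apply: hcontB; apply: hcontB => //; exact: hcont_cst.
  - move=> s s0 st; apply: Hw => //; apply: lt_le_trans tr.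
    by rewrite lte_fin.
(* After localization [L1 - L2] is bounded and agrees almost surely with a process
   of integrable variation. *)
have Lt0 n t : 0 <= t -> {ae P, forall w, L n.+1 w t = 0}.
  move=> t0.
  have mL : cmart P F (L n.+1).
    have := cmartB (mt1 n.+1 _ (sp n.+1) (pt1 n.+1)) (mt2 n.+1 _ (sp n.+1) (pt2 n.+1)).
    congr cmart; apply/funext => w; apply/funext => s.
    by rewrite L10 L20 !subr0.
  have [g1 ig1 hg1] := vs1 n.+1 (pi n.+1) t (sp _) (ps1 _) t0.
  have [g2 ig2 hg2] := vs2 n.+1 (pi n.+1) t (sp _) (ps2 _) t0.
  apply: (bounded_cmart_fv_eq0 (K := n.+1%:R) (g := fun w => g1 w + g2 w) mL) => //.
  - move=> w s s0; rewrite /L !stoppedE; set u := stop_at _ _.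
    have u0 : 0 <= u by exact: stop_at_ge0.
    have uh : (u%:E <= hit Y n.+1%:R w)%E by apply: le_trans (ph _ _); exact: stop_at_lex.
    (* This is the reason for the level [n.+1]: level 0 is not strictly above [Y w 0], which is
       0. *)
    have Y0 : Y w 0 < n.+1%:R by rewrite /Y L10 L20 normr0 addr0.
    by apply: le_trans (hit_reached (cY w) Y0 u0 uh); exact: ler_normB.
  - by move=> w; rewrite /L !stoppedE stop_at_id// L10 L20 subrr.
  - exact: integD.
  - move: H'; apply: filterS => w Hw m.
    have E s : 0 <= s -> L n.+1 w s = (stopped (pi n.+1) A1 w s - stopped (pi n.+1) A2 w s) - (A1 w 0 - A2 w 0).
      move=> s0; rewrite /L !stoppedE Hw.
      - by ring.
      - exact: stop_at_ge0.
      - by apply: le_trans (pr _ _); exact: stop_at_lex.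
    apply: le_trans (lerD (hg1 w m) (hg2 w m)); rewrite -big_split/=; apply: ler_sum => i _.
    rewrite !E; [|exact: grid_ge..].
    set a := stopped _ _ _ _; set b := stopped _ _ _ _; set a' := stopped _ _ _ _; set b' := stopped _ _ _ _.
    rewrite (_ : _ - _ = (a - a') - (b - b')); last by ring.
    exact: ler_normB.
have Lall : {ae P, forall w n k m, L n.+1 w (k%:R / m.+1%:R) = 0}.
  by apply: ae_nat => n; apply: ae_nat => k; apply: ae_nat => m; apply: Lt0; rewrite divr_ge0.
move: H' Lall; apply: filterS2 => w Hw Lw t t0 tr.
have [_ _ /(_ w)/cvgeyPge/(_ t)[N _ /(_ N.+1 (leqnSn N)) tth]] := lth.
have tp : (t%:E <= pi N.+1 w)%E by rewrite /pi le_min tr andbT.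
have cL : hcont (L N.+1 w) by apply: hcontB; apply: stopped_hcont.
have := hcont_eq_dense (g := fun=> 0) cL (@hcont_cst R 0) (Lw N) t0.
rewrite /L !stoppedE stop_at_id// Hw// => /eqP.
by rewrite subr_eq0 => /eqP.
Qed.

End uniqueness.

(** * Simple integrals and the maximal inequality *)

Section bounded_martingales.
Context {d : measure_display} {Omega : measurableType d} {R : realType}.
Variables (P : probability Omega R) (F : filtration Omega R).
Implicit Types (X Y Z : process (Omega := Omega) (R := R)).
Local Notation Ex := (Ex P).
Local Notation integ := (integ P).

Lemma cmart_meas X t : cmart P F X -> 0 <= t -> measurable_fun setT (X ^~ t).
Proof. by move=> [_ _ iX _] t0; exact: (integ_meas (iX t t0)). Qed.

Lemma sq_submart Z K u v B : cmart P F Z -> (forall w t, 0 <= t -> `|Z w t| <= K) ->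
  0 <= u -> u <= v -> F u B ->
  Ex (fun w => \1_B w * Z w u ^+ 2) <= Ex (fun w => \1_B w * Z w v ^+ 2).
Proof.
move=> mZ ZK u0 uv FB; have [aZ cZ iZ eZ] := mZ; have v0 := le_trans u0 uv.
have mB := Ft_meas u0 FB.
have iZZ s t : 0 <= s -> 0 <= t -> integ (fun w => \1_B w * (Z w s * Z w t)).
  move=> s0 t0; apply: integ_indic => //.
  by apply: (integM_bd (cmart_meas mZ s0) (K := K)); [move=> w; exact: ZK|exact: iZ].
have E0 : Ex (fun w => \1_B w * (Z w u * Z w v)) = Ex (fun w => \1_B w * (Z w u * Z w u)).
  under eq_fun do rewrite mulrA; under [X in _ = Ex X]eq_fun do rewrite mulrA.
  apply: (cmart_wt (K := K) mZ u0 uv).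
    by apply: wrtM; [exact: wrt_indic|exact: aZ].
  move=> w; rewrite normrM (le_trans _ (ZK w u u0))// ler_piMl//.
  exact: norm_indic_le1.
rewrite -subr_ge0.
have -> : Ex (fun w => \1_B w * Z w v ^+ 2) - Ex (fun w => \1_B w * Z w u ^+ 2) =
   Ex (fun w => \1_B w * (Z w v - Z w u) ^+ 2).
  have -> : (fun w => \1_B w * (Z w v - Z w u) ^+ 2) = (fun w => \1_B w * (Z w v * Z w v)
     - 2 * (\1_B w * (Z w u * Z w v)) + \1_B w * (Z w u * Z w u)).
    by apply/funext => w; ring.
  rewrite ExD; [|by apply: integB; [exact: iZZ|apply: integZ; exact: iZZ]|exact: iZZ].
  rewrite ExB; [|exact: iZZ|by apply: integZ; exact: iZZ].
  rewrite ExZ; last exact: iZZ.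
  rewrite E0.
  have -> : (fun w => \1_B w * Z w v ^+ 2) = (fun w => \1_B w * (Z w v * Z w v)).
    by apply/funext => w; rewrite expr2.
  have -> : (fun w => \1_B w * Z w u ^+ 2) = (fun w => \1_B w * (Z w u * Z w u)).
    by apply/funext => w; rewrite expr2.
  ring.
by apply: Ex_ge0 => w; rewrite mulr_ge0 ?sqr_ge0.
Qed.

(* Doob's weak type inequality, the event that the supremum of [|Z|] over [0, T]
   reaches [lam] being written as [hit |Z| lam <= T]. *)
Lemma doob_hit Z (K T lam : R) : cmart P F Z -> (forall w t, 0 <= t -> `|Z w t| <= K) ->
  0 <= T -> 0 < lam ->
  lam ^+ 2 * Ex (\1_[set w | (hit (fun w t => `|Z w t|%R) lam w <= T%:E)%E] : Omega -> R) <=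
  Ex (fun w => Z w T ^+ 2).
Proof.
move=> mZ ZK T0 lam0; have [aZ cZ iZ eZ] := mZ.
set Y : process (Omega := Omega) (R := R) := fun w t => `|Z w t|.
set tau := hit Y lam.
have cY w : hcont (Y w) by exact: hcont_norm.
have aY : adapted F Y by move=> t t0; apply: wrt_norm; exact: aZ.
have st : stopping_time F tau by exact: hit_stopping.
pose ZZ : process (Omega := Omega) (R := R) := fun w t => Z w t ^+ 2.
have cZZ w : hcont (ZZ w).
  by rewrite /ZZ; under eq_fun do rewrite expr2; exact: hcontM.
have iZZ u : 0 <= u -> integ (ZZ ^~ u).
  move=> u0; rewrite /ZZ; under eq_fun do rewrite expr2.
  by apply: (integM_bd (cmart_meas mZ u0) (K := K)); [move=> w; exact: ZK|exact: iZ].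
have K0 : 0 <= K by have := ZK point 0 (lexx 0); exact: le_trans.
have key : integ (fun w => ZZ w (stop_at T (tau w))) /\
    Ex (fun w => ZZ w (stop_at T (tau w))) <= Ex (ZZ ^~ T).
  have G n := grid_stopped_submart n iZZ
    (fun u v B (u0 : 0 <= u) (uv : u <= v) (FB : F u B) => sq_submart mZ ZK u0 uv FB) st (lexx 0) T0.
  have cv w : grid_stopped 0 T n tau ZZ w @[n --> \oo] --> ZZ w (stop_at T (tau w)).
    have := grid_stopped_cvg (lexx 0) T0 (st.1 w) (cZZ w).
    by rewrite max_r//; apply: stop_at_ge0 => //; exact: st.1.
  apply: (Ex_fatou (f_ := fun n => grid_stopped 0 T n tau ZZ)).
  - by move=> n; exact: (G n).1.
  - apply: (measurable_fun_cvg (h := fun n => grid_stopped 0 T n tau ZZ)) => [n|w _];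
      [exact: (integ_meas (G n).1)|exact: cv].
  - by move=> n w; exact: sqr_ge0.
  - by move=> w; exact: sqr_ge0.
  - by apply: aeW => w; exact: cv.
  - by apply: nearW => n; exact: (G n).2.
apply: le_trans key.2.
have mE : measurable [set w | (tau w <= T%:E)%E] by exact: (Ft_meas T0 (st.2 T T0)).
have i1 : integ (\1_[set w | (tau w <= T%:E)%E] : Omega -> R).
  by apply: (@integ_bd _ _ _ _ _ 1); [exact: measurable_indic|exact: norm_indic_le1].
rewrite -ExZ//; apply: Ex_le => [||w]; [exact: integZ|exact: key.1|].
rewrite indic_set; case: ifPn => h; last by rewrite mulr0 sqr_ge0.
rewrite mulr1 /ZZ -[leRHS]real_normK ?num_real//.
rewrite lerXn2r ?nnegrE ?(ltW lam0)//.
have t1 := st.1 w; move: h; rewrite /tau.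
case E : (hit Y lam w) => [r||]//=.
- rewrite lee_fin => rT; rewrite stop_at_r//.
  have r0 : 0 <= r by rewrite -lee_fin -E.
  (* The infimum is attained, so [|Z|] is at least [lam] at the hitting time itself. *)
  have hr : (hit Y lam w <= r%:E)%E by rewrite E.
  have [u [u0 ur lY]] := hit_le (cY w) r0 hr.
  suff : u = r by move=> <-.
  apply/eqP; rewrite eq_le ur/= -lee_fin -E.
  by apply: ereal_inf_lbound; exists u.
- by move: t1; rewrite /tau E.
Qed.

(** The integral of [H] on []u, v]] against [X]: zero up to [u], constant after [v], and in between
    an increment weighted by a variable known at [u]. The cases are the positions of [s] with
    respect to [u] and [v]. *)
Lemma simple_term_cmart X (H : Omega -> R) K h u v : cmart P F X ->
  (forall w t, 0 <= t -> `|X w t| <= K) -> 0 <= u -> u <= v ->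
  measurable_wrt (F u) H -> (forall w, `|H w| <= h) ->
  cmart P F (fun w t => H w * (X w (Num.min t v) - X w (Num.min t u))).
Proof.
move=> mX XK u0 uv mH Hh; have [aX cX iX eX] := mX; have v0 := le_trans u0 uv.
have min0 (t a : R) : 0 <= t -> 0 <= a -> 0 <= Num.min t a by move=> t0 a0; rewrite le_min t0.
have mHm := wrt_meas u0 mH.
have i1 t : 0 <= t -> integ (fun w => H w * (X w (Num.min t v) - X w (Num.min t u))).
  move=> t0; apply: (integM_bd mHm Hh); apply: integB; apply: iX; exact: min0.
split=> //.
- move=> t t0; have [tu|ut] := leP t u.
    rewrite (min_l (le_trans tu uv)); under eq_fun do rewrite subrr mulr0.
    exact: wrt_cst.
  apply: wrtM; first exact: (wrt_mono u0 (ltW ut)).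
  have tv0 := min0 t v t0 v0.
  apply: wrtB; first by apply: (wrt_mono tv0); [rewrite ge_min lexx|exact: aX].
  by apply: (wrt_mono u0 (ltW ut)); exact: aX.
- by move=> w; apply: hcontZ; apply: hcontB; exact: hcont_min.
- move=> s t A s0 st FA; have t0 := le_trans s0 st; have mA := Ft_meas s0 FA.
  have wbd w : `|\1_A w * H w| <= h.
    by rewrite normrM (le_trans _ (Hh w))// ler_piMl// norm_indic_le1.
  have [su|us] := leP s u.
    have -> : (fun w => \1_A w * (H w * (X w (Num.min s v) - X w s))) = fun=> 0.
      by apply/funext => w; rewrite (min_l (le_trans su uv)) subrr !mulr0.
    rewrite Ex_cst; have [tu|ut] := leP t u.
      rewrite (min_l (le_trans tu uv)).
      by rewrite (_ : (fun w => _) = fun=> 0) ?Ex_cst//; apply/funext => w; rewrite subrr !mulr0.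
    under eq_fun do rewrite mulrA.
    apply: (cmart_wt0 (K := h) mX u0) => //; first by rewrite le_min (ltW ut).
    by apply: wrtM => //; apply: wrt_indic => //; exact: (filt_mono s0 su).
  have ut := lt_le_trans us st.
  rewrite (min_r (ltW ut)).
  have [vs|sv] := leP v s.
    by rewrite (min_r (le_trans vs st)).
  have st' : s <= Num.min t v by rewrite le_min st ltW.
  have mHs := wrt_mono u0 (ltW us) mH.
  have mAH : measurable_wrt (F s) (fun w => \1_A w * H w) by apply: wrtM => //; exact: wrt_indic.
  have E := cmart_wt mX s0 st' mAH wbd.
  under eq_fun do rewrite mulrA mulrBr; under [X in _ = Ex X]eq_fun do rewrite mulrA mulrBr.
  have iAH a : 0 <= a -> integ (fun w => \1_A w * H w * X w a).
    by move=> a0; apply: (integM_bd (wrt_meas s0 mAH) wbd); exact: iX.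
  rewrite ExB; [|exact: iAH (min0 t v t0 v0)|exact: iAH].
  by rewrite ExB; [|exact: iAH|exact: iAH]; rewrite E.
Qed.

Definition simple_int X (H : nat -> Omega -> R) (u : nat -> R) (m : nat) :
    process (Omega := Omega) (R := R) :=
  fun w t => \sum_(i < m) H i w * (X w (Num.min t (u i.+1)) - X w (Num.min t (u i))).

Section simple_integral.
Variables (X : process (Omega := Omega) (R := R)) (K h : R).
Variables (H : nat -> Omega -> R) (u : nat -> R).
Hypothesis mX : cmart P F X.
Hypothesis XK : forall w t, 0 <= t -> `|X w t| <= K.
Hypothesis u_ge0 : forall i, 0 <= u i.
Hypothesis u_homo : {homo u : i j / (i <= j)%N >-> i <= j}.
Hypothesis mH : forall i, measurable_wrt (F (u i)) (H i).
Hypothesis Hh : forall i w, `|H i w| <= h.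

Lemma simple_int_cmart m : cmart P F (simple_int X H u m).
Proof.
apply: (@cmart_sum _ _ _ P F _ _ (fun (i : 'I_m) w t => H i w * (X w (Num.min t (u i.+1)) - X w (Num.min t (u i))))).
by move=> i; apply: (simple_term_cmart (K := K) (h := h)) => //; exact: u_homo.
Qed.

Lemma simple_int_bound m w t : 0 <= t -> `|simple_int X H u m w t| <= m%:R * (h * (2 * K)).
Proof.
move=> t0; apply: (le_trans (ler_norm_sum _ _ _)).
apply: (@le_trans _ _ (\sum_(i < m) h * (2 * K))); last first.
  by rewrite sumr_const card_ord [leRHS]mulr_natl lexx.
apply: ler_sum => i _.
rewrite normrM; apply: ler_pM => //.
have b a : 0 <= a -> `|X w (Num.min t a)| <= K.
  by move=> a0; apply: XK; rewrite le_min t0.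
by rewrite mulr_natl mulr2n (le_trans (ler_normB _ _))// lerD// b.
Qed.

Lemma simple_int_end m t : u m <= t -> forall w, simple_int X H u m w t =
  \sum_(i < m) H i w * (X w (u i.+1) - X w (u i)).
Proof.
move=> ut w; apply: eq_bigr => i _.
have h1 : u i.+1 <= t by apply: le_trans ut; apply: u_homo; exact: ltn_ord.
have h2 : u i <= t by apply: le_trans ut; apply: u_homo; exact/ltnW/ltn_ord.
by rewrite (min_r h1) (min_r h2).
Qed.

Lemma integ_sq_term i : integ (fun w => H i w ^+ 2 * (X w (u i.+1) - X w (u i)) ^+ 2).
Proof.
have [aX cX iX eX] := mX.
have mD : measurable_fun setT (fun w => X w (u i.+1) - X w (u i)).
  by apply: measurable_funB; apply: (cmart_meas mX).
have mHi : measurable_fun setT (H i) by exact: (wrt_meas (u_ge0 i) (@mH i)).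
apply: (@integ_bd _ _ _ _ _ (h ^+ 2 * (2 * K) ^+ 2)).
  by apply: measurable_funM; apply: measurable_funX.
move=> w; rewrite normrM !normrX; apply: ler_pM; rewrite ?exprn_ge0//.
  by rewrite lerXn2r ?nnegrE// (le_trans _ (Hh i w)).
have DK : `|X w (u i.+1) - X w (u i)| <= 2 * K.
  by rewrite mulr_natl mulr2n (le_trans (ler_normB _ _))// lerD// XK.
by rewrite lerXn2r ?nnegrE// (le_trans _ DK).
Qed.

(** Discrete Ito isometry: the sum so far times the next weight is known at [u m], so its product
    with the next increment has expectation 0. *)
Lemma simple_int_isometry m t : u m <= t ->
  Ex (fun w => simple_int X H u m w t ^+ 2) =
  Ex (fun w => \sum_(i < m) H i w ^+ 2 * (X w (u i.+1) - X w (u i)) ^+ 2).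
Proof.
move=> ut.
have -> : (fun w => simple_int X H u m w t ^+ 2) =
   (fun w => (\sum_(i < m) H i w * (X w (u i.+1) - X w (u i))) ^+ 2).
  by apply/funext => w; rewrite simple_int_end.
have [aX cX iX eX] := mX.
elim: m {ut} => [|m ih].
  under eq_fun do rewrite big_ord0 expr0n/=.
  by under [X in _ = Ex X]eq_fun do rewrite big_ord0.
pose S w := \sum_(i < m) H i w * (X w (u i.+1) - X w (u i)).
pose D w := X w (u m.+1) - X w (u m).
have SE w : S w = simple_int X H u m w (u m) by rewrite simple_int_end.
have mS : measurable_wrt (F (u m)) S.
  rewrite (_ : S = simple_int X H u m ^~ (u m)); last exact/funext.
  by have [aS _ _ _] := simple_int_cmart m; exact: aS.
have SK w : `|S w| <= m%:R * (h * (2 * K)) by rewrite SE simple_int_bound.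
have mD : measurable_fun setT D by apply: measurable_funB; apply: (cmart_meas mX).
have h0 : 0 <= h := le_trans (normr_ge0 _) (Hh 0%N point).
have K0 : 0 <= K := le_trans (normr_ge0 _) (XK point (lexx 0)).
have DK w : `|D w| <= 2 * K.
  by rewrite mulr_natl mulr2n (le_trans (ler_normB _ _))// lerD// XK.
have mHm := wrt_meas (u_ge0 m) (@mH m); have mSm := wrt_meas (u_ge0 m) mS.
have iD : integ D := @integ_bd _ _ _ P D (2 * K) mD DK.
have iSS : integ (fun w => S w ^+ 2).
  by under eq_fun do rewrite expr2; apply: (integM_bd mSm SK); exact: (@integ_bd _ _ _ P S _ mSm SK).
have SHK w : `|S w * H m w| <= m%:R * (h * (2 * K)) * h by rewrite normrM; exact: ler_pM.
have mSH : measurable_wrt (F (u m)) (fun w => S w * H m w) by exact: wrtM.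
have iSHD : integ (fun w => S w * H m w * D w).
  by apply: (integM_bd (wrt_meas (u_ge0 m) mSH) SHK).
have E0 : Ex (fun w => S w * H m w * D w) = 0.
  by apply: (cmart_wt0 (K := m%:R * (h * (2 * K)) * h) mX) => //; exact: u_homo.
have -> : (fun w => (\sum_(i < m.+1) H i w * (X w (u i.+1) - X w (u i))) ^+ 2) =
   (fun w => (S w ^+ 2 + 2 * (S w * H m w * D w)) + H m w ^+ 2 * D w ^+ 2).
  by apply/funext => w; rewrite big_ord_recr/= -/(S w) -/(D w); ring.
rewrite ExD; [|by apply: integD => //; exact: integZ|exact: integ_sq_term].
rewrite ExD//; last exact: integZ.
rewrite ExZ// E0 mulr0 addr0 ih.
under [X in _ = Ex X]eq_fun do rewrite big_ord_recr/=.
rewrite ExD//; last exact: integ_sq_term.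
by apply: integ_sum => i; exact: integ_sq_term.
Qed.

End simple_integral.

End bounded_martingales.

(** * Dyadic Riemann sums of the integral of X against X *)

Section finite_max.
Context {R : realType}.

(** The value 0 for the empty range also bounds every maximum from below, which is harmless as
    [fmax] is only applied to absolute values. *)
Fixpoint fmax (f : nat -> R) (n : nat) : R :=
  if n is m.+1 then Num.max (fmax f m) (f m) else 0.

Lemma fmax_ge (f : nat -> R) n i : (i < n)%N -> f i <= fmax f n.
Proof.
elim: n => //= n ih; rewrite ltnS leq_eqVlt => /orP[/eqP ->|/ih h].
  by rewrite le_max lexx orbT.
by rewrite le_max h.
Qed.

Lemma fmax_ge0 (f : nat -> R) n : 0 <= fmax f n.
Proof. by elim: n => //= n ih; rewrite le_max ih. Qed.

Lemma fmax_le (f : nat -> R) n c : 0 <= c -> (forall i, (i < n)%N -> f i <= c) ->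
  fmax f n <= c.
Proof.
move=> c0; elim: n => //= n ih H; rewrite ge_max H// ih// => i ni.
by apply: H; exact: ltnW.
Qed.

Lemma measurable_fmax (d : measure_display) (T : measurableType d) (f : nat -> T -> R) n :
  (forall i, measurable_fun setT (f i)) ->
  measurable_fun setT (fun w => fmax (f ^~ w) n).
Proof. by move=> mf; elim: n => //= n ih; exact: measurable_maxr. Qed.

Lemma sum_blocks (V : zmodType) (f : nat -> V) (a b : nat) :
  \sum_(j < a * b) f j = \sum_(i < a) \sum_(l < b) f (i * b + l)%N.
Proof.
elim: a => [|a ih]; first by rewrite mul0n !big_ord0.
by rewrite big_ord_recr/= -ih mulSnr big_split_ord.
Qed.

End finite_max.

Section dyadic.
Context {R : realType}.
Variable T : R.
Hypothesis T0 : 0 <= T.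

(** Unlike the grids [grid], the dyadic ones are nested, so that a coarse Riemann sum can be
    rewritten on a finer grid. *)
Definition dy (n i : nat) : R := i%:R * (T / (2 ^ n)%:R).

Lemma dy0 n : dy n 0 = 0.
Proof. by rewrite /dy mul0r. Qed.

Lemma exp2_gt0 n : 0 < (2 ^ n)%:R :> R.
Proof. by rewrite ltr0n expn_gt0. Qed.

Lemma dy_step_ge0 n : 0 <= T / (2 ^ n)%:R.
Proof. by rewrite divr_ge0. Qed.

Lemma dy_end n : dy n (2 ^ n) = T.
Proof. by rewrite /dy mulrC divfK// gt_eqF// exp2_gt0. Qed.

Lemma dy_homo n : {homo dy n : i j / (i <= j)%N >-> i <= j}.
Proof. by move=> i j ij; rewrite /dy ler_wpM2r ?dy_step_ge0// ler_nat. Qed.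

Lemma dy_ge0 n i : 0 <= dy n i.
Proof. by rewrite /dy mulr_ge0// dy_step_ge0. Qed.

Lemma dy_refine m n i : (m <= n)%N -> dy n (i * 2 ^ (n - m)) = dy m i.
Proof.
move=> mn; rewrite /dy -{2}(subnK mn) expnD !natrM.
by field; rewrite ?gt_eqF ?exp2_gt0//= -natrX gt_eqF// exp2_gt0.
Qed.

(** The quotient [j %/ 2 ^ (n - m)] is the index of the last coarse point at or before [dy n j]. *)
Lemma dy_floor m n j : (m <= n)%N -> dy m (j %/ 2 ^ (n - m)) <= dy n j /\
  `|dy n j - dy m (j %/ 2 ^ (n - m))| <= T / (2 ^ m)%:R.
Proof.
move=> mn; rewrite -(dy_refine _ mn); set b := (2 ^ (n - m))%N.
have b0 : (0 < b)%N by rewrite expn_gt0.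
have h1 : dy n (j %/ b * b) <= dy n j by apply: dy_homo; exact: leq_divM.
split=> //; rewrite ger0_norm ?subr_ge0//.
have h2 : dy n j <= dy n ((j %/ b).+1 * b) by apply: dy_homo; exact/ltnW/ltn_ceil.
apply: (le_trans (lerB h2 (lexx _))).
by rewrite mulSn /dy natrD mulrDl addrK -/(dy n b) -[b]mul1n dy_refine// /dy mul1r.
Qed.

End dyadic.

(** * Moment estimates for the Riemann sums *)

Section dyadic_sums.
Context {d : measure_display} {Omega : measurableType d} {R : realType}.
Variables (P : probability Omega R) (F : filtration Omega R).
Local Notation Ex := (Ex P).
Local Notation integ := (integ P).
Variables (X : process (Omega := Omega) (R := R)) (K T : R).
Hypothesis mX : cmart P F X.
Hypothesis XK : forall w t, 0 <= t -> `|X w t| <= K.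
Hypothesis T0 : 0 <= T.
Local Notation dy := (dy T).

Lemma bound_ge0 : 0 <= K.
Proof. exact: le_trans (normr_ge0 _) (XK point (lexx 0)). Qed.

Lemma simple_int_at (H : nat -> Omega -> R) (u : nat -> R) m j w :
  {homo u : i j / (i <= j)%N >-> i <= j} -> (j <= m)%N ->
  simple_int X H u m w (u j) = \sum_(i < j) H i w * (X w (u i.+1) - X w (u i)).
Proof.
move=> uh; elim: m => [|m ih].
  by rewrite leqn0 => /eqP ->; rewrite /simple_int !big_ord0.
rewrite leq_eqVlt => /orP[/eqP ->|]; first by rewrite simple_int_end.
rewrite ltnS => jm; rewrite /simple_int big_ord_recr/= -/(simple_int X H u m w (u j)) ih//.
by rewrite !min_l ?uh ?subrr ?mulr0 ?addr0// ltnW.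
Qed.

Definition dint n := simple_int X (fun i w => X w (dy n i)) (dy n) (2 ^ n).
Definition dqv n w := \sum_(i < 2 ^ n) (X w (dy n i.+1) - X w (dy n i)) ^+ 2.

Lemma dint_cmart n : cmart P F (dint n).
Proof.
have [aX cX iX eX] := mX.
apply: (simple_int_cmart (K := K) (h := K)) => //.
- by move=> i; exact: dy_ge0.
- exact: dy_homo.
- by move=> i; apply: aX; exact: dy_ge0.
- by move=> i w; apply: XK; exact: dy_ge0.
Qed.

Lemma dint_bound n w t : 0 <= t -> `|dint n w t| <= (2 ^ n)%:R * (K * (2 * K)).
Proof.
move=> t0; apply: simple_int_bound => //.
- by move=> i; exact: dy_ge0.
- by move=> i v; apply: XK; exact: dy_ge0.
Qed.

Lemma dint_after n w t : T <= t -> dint n w t = dint n w T.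
Proof.
move=> Tt; rewrite /dint !simple_int_end//; by [exact: dy_homo|rewrite dy_end].
Qed.

Lemma dint0 n w : dint n w 0 = 0.
Proof.
have := simple_int_at (fun i w => X w (dy n i)) w (dy_homo T0 n) (leq0n (2 ^ n)).
by rewrite big_ord0 dy0.
Qed.

(** Summation of the identity [b ^ 2 - a ^ 2 - 2 a (b - a) = (b - a) ^ 2] over the steps of the
    grid. *)
Lemma dqv_at n j w : (j <= 2 ^ n)%N ->
  X w (dy n j) ^+ 2 - X w 0 ^+ 2 - 2 * dint n w (dy n j) =
  \sum_(i < j) (X w (dy n i.+1) - X w (dy n i)) ^+ 2.
Proof.
move=> jn; rewrite /dint simple_int_at//; last exact: dy_homo.
have -> : X w (dy n j) ^+ 2 - X w 0 ^+ 2 =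
    \sum_(i < j) (X w (dy n i.+1) ^+ 2 - X w (dy n i) ^+ 2).
  by rewrite -(big_mkord xpredT (fun i => X w (dy n i.+1) ^+ 2 - X w (dy n i) ^+ 2))
    telescope_sumr// dy0.
rewrite mulr_sumr -sumrB; apply: eq_bigr => i _; ring.
Qed.

Lemma integ_sq u : 0 <= u -> integ (fun w => X w u ^+ 2).
Proof.
move=> u0; under eq_fun do rewrite expr2; have [_ _ iX _] := mX.
by apply: (integM_bd (cmart_meas mX u0) (K := K)); [move=> w; exact: XK|exact: iX].
Qed.

Lemma integ_sq_incr u v : 0 <= u -> 0 <= v -> integ (fun w => (X w u - X w v) ^+ 2).
Proof.
move=> u0 v0; under eq_fun do rewrite expr2; have [_ _ iX _] := mX.
apply: (@integM_bd _ _ _ _ _ _ (K + K)).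
- by apply: measurable_funB; exact: (cmart_meas mX).
- by move=> w; rewrite (le_trans (ler_normB _ _))// lerD// XK.
- by apply: integB; exact: iX.
Qed.

Lemma sq_le_bound w u : 0 <= u -> X w u ^+ 2 <= K ^+ 2.
Proof.
by move=> u0; rewrite -real_normK ?num_real// lerXn2r ?nnegrE ?bound_ge0// XK.
Qed.

Lemma Ex_dqv n : Ex (dqv n) <= K ^+ 2.
Proof.
rewrite /dqv Ex_sum; last by move=> i; apply: integ_sq_incr; exact: dy_ge0.
rewrite (eq_bigr (fun i : 'I_(2 ^ n) =>
   Ex (fun w => X w (dy n i.+1) ^+ 2) - Ex (fun w => X w (dy n i) ^+ 2))); last first.
  by move=> i _; apply: (cmart_incr_sq (K := K) mX) => //; [exact: dy_ge0|exact: dy_homo].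
rewrite -(big_mkord xpredT (fun i : nat => Ex (fun w => X w (dy n i.+1) ^+ 2) -
     Ex (fun w => X w (dy n i) ^+ 2))) telescope_sumr//.
have h1 : 0 <= Ex (fun w => X w (dy n 0) ^+ 2) by apply: Ex_ge0 => w; exact: sqr_ge0.
have h2 : Ex (fun w => X w (dy n (2 ^ n)) ^+ 2) <= K ^+ 2.
  rewrite -[leRHS](Ex_cst P); apply: Ex_le => [||w].
  - by apply: integ_sq; exact: dy_ge0.
  - exact: integ_cst.
  - by apply: sq_le_bound; exact: dy_ge0.
lra.
Qed.

Lemma integ_dqv n : integ (dqv n).
Proof. by apply: integ_sum => i; apply: integ_sq_incr; exact: dy_ge0. Qed.

(** Unlike [dint_bound], this bound is uniform in [n]: it yields the uniform integrability of the
    Riemann sums. *)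
Lemma Ex_dint_sq n : Ex (fun w => dint n w T ^+ 2) <= K ^+ 4.
Proof.
have [aX cX iX eX] := mX.
rewrite /dint (simple_int_isometry (h := K) mX XK (dy_ge0 T0 n) (dy_homo T0 n)); last first.
- by rewrite dy_end.
- by move=> i w; apply: XK; exact: dy_ge0.
- by move=> i; apply: aX; exact: dy_ge0.
apply: (@le_trans _ _ (Ex (fun w => K ^+ 2 * dqv n w))).
  apply: Ex_le => [||w].
  - apply: integ_sum => i; apply: (integ_sq_term (h := K) (u := dy n) (H := fun i w => X w (dy n i)) mX XK).
    + by move=> j; exact: dy_ge0.
    + by move=> j; apply: aX; exact: dy_ge0.
    + by move=> j w; apply: XK; exact: dy_ge0.
  - by apply: integZ; exact: integ_dqv.
  - rewrite /dqv mulr_sumr; apply: ler_sum => i _.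
    by rewrite ler_wpM2r ?sqr_ge0// sq_le_bound//; exact: dy_ge0.
rewrite ExZ; last exact: integ_dqv.
rewrite (_ : K ^+ 4 = K ^+ 2 * K ^+ 2); last by rewrite -exprD.
by rewrite ler_wpM2l ?sqr_ge0// Ex_dqv.
Qed.

Lemma integ_dint_sq n t : 0 <= t -> integ (fun w => dint n w t ^+ 2).
Proof.
move=> t0; under eq_fun do rewrite expr2; have [_ _ iN _] := dint_cmart n.
apply: (integM_bd (cmart_meas (dint_cmart n) t0) (K := (2 ^ n)%:R * (K * (2 * K)))).
  by move=> w; exact: dint_bound.
exact: iN.
Qed.

(* The bound comes for free from the isometry, because the sum of squares is
   [X_T ^ 2 - X_0 ^ 2 - 2 * dint]. *)
Lemma Ex_dqv_sq n : integ (fun w => dqv n w ^+ 2) /\ Ex (fun w => dqv n w ^+ 2) <= 10 * K ^+ 4.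
Proof.
have E w : dqv n w = X w T ^+ 2 - X w 0 ^+ 2 - 2 * dint n w T.
  by rewrite /dqv -dqv_at// dy_end.
(* From [(x - 2 c) ^ 2 <= 2 x ^ 2 + 8 c ^ 2] with [|x| <= K ^ 2]; bounding the second moment of
   [dint] by [K ^ 4] then gives the constant [2 + 8 = 10]. *)
have B w : dqv n w ^+ 2 <= 2 * K ^+ 4 + 8 * dint n w T ^+ 2.
  rewrite E; have h1 := sq_le_bound w T0; have h2 := sq_le_bound w (lexx 0).
  have h3 := sqr_ge0 (X w T); have h4 := sqr_ge0 (X w 0).
  move: (X w T ^+ 2) (X w 0 ^+ 2) (dint n w T) h1 h2 h3 h4 => a b c h1 h2 h3 h4.
  have h5 : (a - b) ^+ 2 <= K ^+ 4.
    rewrite (_ : K ^+ 4 = (K ^+ 2) ^+ 2); last by rewrite -exprM.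
    rewrite -[leLHS]real_normK ?num_real// lerXn2r ?nnegrE ?sqr_ge0//.
    by rewrite ler_norml; apply/andP; split; lra.
  have h6 := sqr_ge0 ((a - b) + 2 * c).
  have -> : (a - b - 2 * c) ^+ 2 = 2 * (a - b) ^+ 2 + 8 * c ^+ 2 - ((a - b) + 2 * c) ^+ 2 by ring.
  lra.
have iR : integ (fun w => 2 * K ^+ 4 + 8 * dint n w T ^+ 2).
  by apply: integD; [exact: integ_cst|apply: integZ; exact: integ_dint_sq].
have iL : integ (fun w => dqv n w ^+ 2).
  apply: (integ_le _ _ iR) => [|w]; last by rewrite ger0_norm ?sqr_ge0.
  by apply: measurable_funX; exact: (integ_meas (integ_dqv n)).
split=> //; apply: (le_trans (Ex_le iL iR B)).
rewrite ExD; [|exact: integ_cst|by apply: integZ; exact: integ_dint_sq].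
rewrite Ex_cst ExZ; last exact: integ_dint_sq.
have := Ex_dint_sq n; lra.
Qed.

(** Within a coarse step the weight is constant and the fine increments telescope. Once both sums
    live on the same grid, their difference is again a simple integral. *)
Lemma dint_refine m n w t : (m <= n)%N -> dint m w t =
  simple_int X (fun j w => X w (dy m (j %/ 2 ^ (n - m)))) (dy n) (2 ^ n) w t.
Proof.
move=> mn; rewrite /dint /simple_int; set b := (2 ^ (n - m))%N.
have b0 : (0 < b)%N by rewrite expn_gt0.
have E : (2 ^ n = 2 ^ m * b)%N by rewrite -expnD subnKC.
pose f j := X w (dy m (j %/ b)) * (X w (Num.min t (dy n j.+1)) - X w (Num.min t (dy n j))).
rewrite -[RHS]/(\sum_(j < 2 ^ n) f j) E sum_blocks; apply: eq_bigr => i _.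
pose g l := X w (Num.min t (dy n (i * b + l))).
rewrite (eq_bigr (fun l : 'I_b => X w (dy m i) * (g l.+1 - g l))); last first.
  move=> l _; rewrite /f /g addnS divnMDl// (divn_small (ltn_ord l)) addn0.
  by [].
rewrite -mulr_sumr -(big_mkord xpredT (fun l => g l.+1 - g l)) telescope_sumr//.
by rewrite /g addn0 -mulSnr !dy_refine.
Qed.

(** The largest gap between the integrands of [dint n] and [dint m] on the finer grid. *)
Definition dosc m n w := fmax (fun j => `|X w (dy n j) - X w (dy m (j %/ 2 ^ (n - m)))|) (2 ^ n).

Lemma dosc_bound m n w : dosc m n w <= 2 * K.
Proof.
apply: fmax_le => [|i _]; first by rewrite mulr_ge0// bound_ge0.
by rewrite mulr_natl mulr2n (le_trans (ler_normB _ _))// lerD// XK// dy_ge0.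
Qed.

Lemma integ_dosc m n : integ (fun w => dosc m n w ^+ 4).
Proof.
apply: (@integ_bd _ _ _ _ _ ((2 * K) ^+ 4)).
  apply: measurable_funX; apply: (measurable_fmax (f := fun j w => `|X w (dy n j) - X w (dy m (j %/ 2 ^ (n - m)))|)) => j.
  by apply: measurableT_comp => //; apply: measurable_funB; apply: (cmart_meas mX); exact: dy_ge0.
move=> w; rewrite ger0_norm ?exprn_ge0 ?fmax_ge0//.
by rewrite lerXn2r ?nnegrE ?fmax_ge0 ?mulr_ge0 ?bound_ge0// dosc_bound.
Qed.

(** The isometry bounds the left side by the expectation of [dosc ^ 2 * dqv]; the product is split
    by [x y <= a x ^ 2 + y ^ 2 / a], which stands in for the Cauchy-Schwarz inequality. *)
Lemma Ex_dint_diff m n (a : R) : (m <= n)%N -> 0 < a ->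
  Ex (fun w => (dint n w T - dint m w T) ^+ 2) <=
  a * Ex (fun w => dosc m n w ^+ 4) + 10 * K ^+ 4 / a.
Proof.
move=> mn a0; have [aX cX iX eX] := mX.
pose H j w := X w (dy n j) - X w (dy m (j %/ 2 ^ (n - m))).
have E : (fun w => (dint n w T - dint m w T) ^+ 2) =
    (fun w => simple_int X H (dy n) (2 ^ n) w T ^+ 2).
  apply/funext => w; rewrite (dint_refine w T mn) /dint /simple_int -sumrB.
  by congr (_ ^+ 2); apply: eq_bigr => i _; rewrite /H; ring.
have mH j : measurable_wrt (F (dy n j)) (H j).
  have [h1 _] := dy_floor T0 j mn.
  by apply: wrtB; [apply: aX; exact: dy_ge0|apply: (wrt_mono _ h1); [exact: dy_ge0|apply: aX; exact: dy_ge0]].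
have HK j w : `|H j w| <= 2 * K.
  by rewrite mulr_natl mulr2n (le_trans (ler_normB _ _))// lerD// XK// dy_ge0.
rewrite E (simple_int_isometry mX XK (dy_ge0 T0 n) (dy_homo T0 n) mH HK); last by rewrite dy_end.
have [iq Eq] := Ex_dqv_sq n.
apply: (@le_trans _ _ (Ex (fun w => a * dosc m n w ^+ 4 + a^-1 * dqv n w ^+ 2))).
  apply: Ex_le => [||w].
  - by apply: integ_sum => i; exact: (integ_sq_term mX XK (dy_ge0 T0 n) mH HK).
  - by apply: integD; apply: integZ => //; exact: integ_dosc.
  apply: (@le_trans _ _ (dosc m n w ^+ 2 * dqv n w)).
    rewrite /dqv mulr_sumr; apply: ler_sum => i _.
    rewrite ler_wpM2r ?sqr_ge0// -[leLHS]real_normK ?num_real//.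
    rewrite lerXn2r ?nnegrE ?fmax_ge0//.
    exact: (fmax_ge (fun j => `|H j w|) (ltn_ord i)).
  move: (dosc m n w) (dqv n w) => g q.
  rewrite (_ : a * g ^+ 4 = a * (g ^+ 2) ^+ 2); last by rewrite -exprM.
  move: (g ^+ 2) => {}g.
  rewrite -subr_ge0 (_ : _ - _ = a^-1 * ((a * g - q / 2) ^+ 2 + 3 / 4 * q ^+ 2)); last first.
    by field; rewrite gt_eqF.
  by rewrite mulr_ge0 ?invr_ge0 ?(ltW a0)// addr_ge0 ?sqr_ge0// mulr_ge0 ?sqr_ge0.
rewrite ExD; [|by apply: integZ; exact: integ_dosc|exact: integZ].
rewrite !ExZ//; last exact: integ_dosc.
by rewrite lerD2l mulrC ler_wpM2r ?invr_ge0 ?(ltW a0).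
Qed.

Lemma exp2_cvg (c : R) : c / (2 ^ n)%:R @[n --> \oo] --> 0.
Proof.
rewrite -[X in _ --> X](mulr0 c); apply: cvgM; first exact: cvg_cst.
apply/cvgr0Pnorm_le => e e0.
near=> n; rewrite ger0_norm ?invr_ge0//.
have : e^-1 < (2 ^ n)%:R.
  apply: lt_le_trans (truncnS_gt _) _; rewrite ler_nat.
  apply: (@leq_trans n); last exact/ltnW/ltn_expl.
  by near: n; exact: nbhs_infty_ge.
move=> h; rewrite -[leRHS]invrK lef_pV2 ?posrE ?invr_gt0// ?exp2_gt0//.
exact: ltW.
Unshelve. all: by end_near. Qed.

(* The oscillation of the path between the two grids is bounded and tends to 0
   pointwise, so its fourth moment tends to 0 and beats the factor [a] of
   [Ex_dint_diff]. *)
Lemma dint_cauchy (e : R) : 0 < e -> exists m0 : nat, forall m n, (m0 <= m)%N -> (m <= n)%N ->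
  Ex (fun w => (dint n w T - dint m w T) ^+ 2) <= e.
Proof.
move=> e0; apply: contrapT => /forallNP H.
(* The negation gives a bad pair of indices beyond each [k]; dominated convergence is then applied
   along a single sequence of pairs. *)
have {}H (k : nat) : exists p : nat * nat, [/\ (k <= p.1)%N, (p.1 <= p.2)%N &
    e < Ex (fun w => (dint p.2 w T - dint p.1 w T) ^+ 2)].
  apply: contrapT => /forallNP H'; apply: (H k) => m n km mn.
  by rewrite leNgt; apply/negP => h; apply: (H' (m, n)).
have [p Hp] := choice H.
have cv : Ex (fun w => dosc (p k).1 (p k).2 w ^+ 4) @[k --> \oo] --> 0.
  rewrite -[X in _ --> X](Ex_cst P).
  apply: (Ex_cvg (g := fun=> (2 * K) ^+ 4) _ _ _ _ _).2.
  - by move=> k; exact: (integ_meas (integ_dosc _ _)).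
  - exact: measurable_cst.
  - exact: integ_cst.
  - apply: aeW => w k; rewrite ger0_norm ?exprn_ge0 ?fmax_ge0//.
    by rewrite lerXn2r ?nnegrE ?fmax_ge0 ?mulr_ge0 ?bound_ge0// dosc_bound.
  - apply: aeW => w; have [_ cX _ _] := mX.
    have c0 : dosc (p k).1 (p k).2 w @[k --> \oo] --> 0.
      apply/cvgr0Pnorm_le => ep ep0.
      have [del del0 hdel] := hcont_unif T (cX w) ep0.
      have /cvgr0Pnorm_lt/(_ _ del0)[N _ hN] := exp2_cvg T.
      exists N => // k /= Nk; rewrite ger0_norm ?fmax_ge0//.
      have [kp pp _] := Hp k.
      apply: fmax_le => [|j jn]; first exact: ltW.
      have [h1 h2] := dy_floor T0 j pp.
      apply/ltW/hdel; [exact: dy_ge0| |exact: dy_ge0|].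
        by rewrite -[leRHS](dy_end T (p k).2); apply: dy_homo => //; exact: ltnW.
      apply: (le_lt_trans h2); apply: (le_lt_trans (ler_norm _)).
      by apply: hN => /=; exact: leq_trans kp.
    have -> : 0 = 0 ^+ 4 :> R by rewrite expr0n.
    exact: (cvg_comp _ _ c0 (@exprn_continuous R 4 0)).
have K4 : 0 <= K ^+ 4 by rewrite exprn_ge0// bound_ge0.
(* Chosen so that the second term of [Ex_dint_diff] is at most [e / 4]; the summand 1 keeps [a]
   positive when [K = 0]. *)
pose a := 40 * K ^+ 4 / e + 1.
have a0 : 0 < a.
  rewrite /a ltr_wpDl//; apply: divr_ge0; last exact: ltW.
  by apply: mulr_ge0.
have h1 : 10 * K ^+ 4 / a <= e / 4.
  rewrite ler_pdivrMr// /a mulrDr mulr1.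
  have -> : e / 4 * (40 * K ^+ 4 / e) = 10 * K ^+ 4 by field; rewrite gt_eqF.
  by rewrite lerDl divr_ge0// ltW.
have ea : 0 < e / 4 / a by rewrite !divr_gt0.
have /cvgr0Pnorm_lt/(_ _ ea)[N _ /(_ N (leqnn N))] := cv.
rewrite ger0_norm; last by apply: Ex_ge0 => w; rewrite exprn_ge0 ?fmax_ge0.
rewrite ltr_pdivlMr// => h2.
have [kp pp] := Hp N; have := Ex_dint_diff pp a0; lra.
Qed.

End dyadic_sums.

(** * Bracket of a bounded continuous martingale *)

Section geometric_limits.
Context {R : realType}.

Definition half_pow (k : nat) : R := (2 ^ k)%:R^-1.

Lemma half_pow_gt0 k : 0 < half_pow k.
Proof. by rewrite invr_gt0 ltr0n expn_gt0. Qed.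

Lemma half_powS k : half_pow k.+1 = half_pow k / 2.
Proof. by rewrite /half_pow expnS natrM invfM mulrC. Qed.

Lemma half_pow_cvg0 (c : R) : c * half_pow k @[k --> \oo] --> 0.
Proof. exact: exp2_cvg. Qed.

Lemma half_pow_sum n : \sum_(0 <= i < n) half_pow i <= 2.
Proof.
suff : \sum_(0 <= i < n) half_pow i = 2 - 2 * half_pow n.
  by move=> ->; have := half_pow_gt0 n; lra.
elim: n => [|n ih]; first by rewrite big_geq// /half_pow expn0 invr1; lra.
by rewrite big_nat_recr//= ih half_powS; field.
Qed.

Variables (f_ : nat -> R -> R) (k0 : nat).
Hypothesis f_step : forall k t, (k0 <= k)%N -> 0 <= t -> `|f_ k.+1 t - f_ k t| <= half_pow k.

Lemma geo_dist k j t : (k0 <= k)%N -> 0 <= t -> `|f_ (k + j)%N t - f_ k t| <= 2 * half_pow k.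
Proof.
move=> kk t0.
(* The induction has to carry the exact partial sum of the geometric series. *)
suff : `|f_ (k + j)%N t - f_ k t| <= 2 * half_pow k - 2 * half_pow (k + j).
  by have := half_pow_gt0 (k + j); lra.
elim: j => [|j ih]; first by rewrite addn0 !subrr normr0.
rewrite (_ : f_ (k + j.+1)%N t - f_ k t = (f_ (k + j).+1 t - f_ (k + j)%N t) + (f_ (k + j)%N t - f_ k t)).
  apply: (le_trans (ler_normD _ _)).
  have := f_step (leq_trans kk (leq_addr j k)) t0.
  by rewrite addnS half_powS; lra.
by rewrite addnS; ring.
Qed.

Lemma geo_cvg t : 0 <= t -> f_ k t @[k --> \oo] --> limn (fun k => f_ k t).
Proof.
move=> t0; apply/cauchy_cvgP/cauchy_exP => e e0.
have /cvgr0Pnorm_lt/(_ _ e0)[N _ hN] := half_pow_cvg0 2.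
pose k := maxn N k0.
exists (f_ k t), k => // n /= kn.
rewrite /ball/= distrC -(subnKC kn); apply: le_lt_trans (geo_dist _ _ t0) _.
  by rewrite leq_maxr.
by apply: le_lt_trans (ler_norm _) _; apply: hN => /=; rewrite leq_maxl.
Qed.

Lemma geo_lim_dist k t : (k0 <= k)%N -> 0 <= t ->
  `|limn (fun k => f_ k t) - f_ k t| <= 2 * half_pow k.
Proof.
move=> kk t0; apply/ler_addgt0Pr => e e0.
have /cvgrPdist_lt/(_ _ e0)[N _ /(_ (k + N)%N)] := geo_cvg t0.
rewrite /= leq_addl => /(_ isT) h.
have := geo_dist N kk t0.
rewrite (_ : limn _ - f_ k t = (limn (fun k => f_ k t) - f_ (k + N)%N t) + (f_ (k + N)%N t - f_ k t)); last by ring.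
by move=> h2; apply: (le_trans (ler_normD _ _)); lra.
Qed.

Lemma geo_hcont : (forall k, hcont (f_ k)) -> hcont (fun t => limn (fun k => f_ k t)).
Proof.
move=> cf; apply/hcontP => t; apply/cvgrPdist_lt => e e0.
have e3 : 0 < e / 3 by rewrite divr_gt0.
have /cvgr0Pnorm_lt/(_ _ e3)[N _ hN] := half_pow_cvg0 2.
pose k := maxn N k0.
have dk s : `|limn (fun k => f_ k (Num.max s 0)) - f_ k (Num.max s 0)| < e / 3.
  apply: (@le_lt_trans _ _ (2 * half_pow k)).
    by apply: geo_lim_dist; rewrite ?leq_maxr// le_max lexx orbT.
  by apply: le_lt_trans (ler_norm _) _; apply: hN => /=; rewrite leq_maxl.
have /hcontP := cf k => /(_ t)/cvgrPdist_lt/(_ _ e3).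
apply: filterS => s h.
have h1 := dk s; have h2 := dk t; rewrite distrC in h1.
move: h1 h2 h; set a := limn _; set b := limn _; set x := f_ _ _; set y := f_ _ _ => h1 h2 h.
rewrite (_ : b - a = (b - y) + (y - x) + (x - a)); last by ring.
apply: (le_lt_trans (ler_normD _ _)).
by have := ler_normD (b - y) (y - x); lra.
Qed.

End geometric_limits.

(** * Passage to the limit in the Riemann sums *)

Section bracket.
Context {d : measure_display} {Omega : measurableType d} {R : realType}.
Variables (P : probability Omega R) (F : filtration Omega R).
Local Notation Ex := (Ex P).
Local Notation integ := (integ P).

Lemma Ex_indic_prob A : measurable A -> P A = (Ex \1_A)%:E.
Proof.
move=> mA; rewrite -Ex_EFin.
  by rewrite integral_indic// setIT.
by apply: (@integ_bd _ _ _ _ _ 1); [exact: measurable_indic|exact: norm_indic_le1].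
Qed.

Lemma prob_lim_sup_eq0 (A : nat -> set Omega) : (forall k, measurable (A k)) ->
  (forall k, Ex \1_(A k) <= half_pow k) -> P (lim_sup_set A) = 0%E.
Proof.
move=> mA hA; apply: (lim_sup_set_cvg0 mA).
apply: (@le_lt_trans _ _ (2 : R)%:E); last exact: ltry.
apply: lime_le; first by apply: is_cvg_nneseries => n _ _; exact: measure_ge0.
apply: nearW => n.
apply: (@le_trans _ _ (\sum_(0 <= i < n) half_pow i)%:E); last by rewrite lee_fin half_pow_sum.
by rewrite -sumEFin; apply: lee_sum => i _; rewrite [leLHS](Ex_indic_prob (mA i)) lee_fin.
Qed.

(** Turns a bound on second moments into uniform integrability, with a rate in [k]. *)
Lemma excess_le_sq (k : nat) (x : R) : excess k%:R x <= (x ^+ 2 + 1) / k.+1%:R.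
Proof.
have k0 : 0 < k.+1%:R :> R by [].
rewrite /excess ge_max; apply/andP; split.
  by rewrite divr_ge0// addr_ge0// sqr_ge0.
rewrite ler_pdivlMr// -[x ^+ 2]real_normK ?num_real//.
move: (`|x|) => y; rewrite -natr1.
have k1 : 0 <= k%:R :> R by [].
move: (k%:R : R) k1 => q q0.
rewrite -subr_ge0 (_ : _ - _ = (y - (q + 1) / 2) ^+ 2 + (3 / 4 * q ^+ 2 + q / 2 + 3 / 4)); last by field.
by rewrite addr_ge0 ?sqr_ge0// !addr_ge0// ?mulr_ge0 ?sqr_ge0.
Qed.

Section bounded.
Variables (X : process (Omega := Omega) (R := R)) (K T : R).
Hypothesis HF : usual_conditions P F.
Hypothesis mX : cmart P F X.
Hypothesis XK : forall w t, 0 <= t -> `|X w t| <= K.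
Hypothesis T0 : 0 <= T.
Hypothesis XT : forall w t, T <= t -> X w t = X w T.
Local Notation dint := (dint X T).

(** Doob's inequality at level [half_pow k] will cost the factor [half_pow k ^+ 2]; the remaining
    [half_pow k] is summable, as the Borel-Cantelli lemma requires. *)
Lemma dint_subseq : exists n_ : nat -> nat, forall k, (k <= n_ k)%N /\
  Ex (fun w => (dint (n_ k.+1) w T - dint (n_ k) w T) ^+ 2) <= half_pow k * half_pow k ^+ 2.
Proof.
have e0 k : 0 < half_pow k * half_pow k ^+ 2 :> R.
  by rewrite mulr_gt0 ?exprn_gt0 ?half_pow_gt0.
have [c Hc] := choice (fun k => dint_cauchy mX XK T0 (e0 k)).
(* Partial sums make the indices nondecreasing in [k], at least [c k], and at least [k] thanks to
   the successors. *)
exists (fun k => \sum_(j < k.+1) (c j).+1)%N => k; split.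
  rewrite -[leqLHS]card_ord -sum1_card big_ord_recr/= (leq_trans _ (leq_addr _ _))//.
  exact: leq_sum.
apply: Hc; last by rewrite [leqRHS]big_ord_recr leq_addr.
by rewrite big_ord_recr/= (leq_trans (leqnSn _))// leq_addl.
Qed.

(** The threshold [k0] depends on the path but not on the time, whence uniform convergence. The
    complement of [G] is negligible, so [G] is in [F 0] and its indicator can multiply adapted
    processes. *)
Lemma dint_unif_cvg : exists (n_ : nat -> nat) (G : set Omega),
  (forall k, (k <= n_ k)%N) /\ F 0 G /\ {ae P, forall w, G w} /\
  forall w, G w -> exists k0 : nat, forall k t, (k0 <= k)%N -> 0 <= t ->
    `|dint (n_ k.+1) w t - dint (n_ k) w t| <= half_pow k.
Proof.
have [n_ Hn] := dint_subseq.
pose Z k : process (Omega := Omega) (R := R) := fun w t => dint (n_ k.+1) w t - dint (n_ k) w t.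
have mZ k : cmart P F (Z k) by apply: cmartB; exact: (dint_cmart mX XK T0).
have ZK k w t : 0 <= t -> `|Z k w t| <= (2 ^ n_ k.+1)%:R * (K * (2 * K)) + (2 ^ n_ k)%:R * (K * (2 * K)).
  by move=> t0; rewrite (le_trans (ler_normB _ _))// lerD// (dint_bound XK T0).
pose A k := [set w | (hit (fun w t => `|Z k w t|%R) (half_pow k) w <= T%:E)%E].
have cZ k w : hcont (fun t => `|Z k w t|) by apply: hcont_norm; have [_ cZ _ _] := mZ k; exact: cZ.
have sA k : stopping_time F (hit (fun w t => `|Z k w t|%R) (half_pow k)).
  by apply: hit_stopping => // t t0; apply: wrt_norm; have [aZ _ _ _] := mZ k; exact: aZ.
have mA k : measurable (A k) by exact: (Ft_meas T0 ((sA k).2 T T0)).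
have PA k : Ex \1_(A k) <= half_pow k.
  have D := doob_hit (mZ k) (ZK k) T0 (half_pow_gt0 k).
  have := le_trans D (Hn k).2; rewrite mulrC ler_pM2r// exprn_gt0//.
  exact: half_pow_gt0.
have P0 := prob_lim_sup_eq0 mA PA.
have nA : P.-negligible (lim_sup_set A).
  exists (lim_sup_set A); split=> //; apply: bigcap_measurable; first by exists 0%N.
  by move=> k _; apply: bigcup_measurable => j _; exact: mA.
exists n_, (~` lim_sup_set A); split; first by move=> k; exact: (Hn k).1.
split; first by apply: FtC => //; exact: (Ft_negl HF (lexx 0) nA).
split.
  by apply: negligibleS nA => w /= /contrapT.
move=> w /= nw.
have {nw} [k0 hk0] : exists k0, forall j, (k0 <= j)%N -> ~ A j w.
  apply: contrapT => /forallNP H; apply: nw => k _.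
  have /existsNP[j /not_implyP[kj /contrapT Aj]] := H k.
  by exists j.
exists k0 => k t kk t0.
wlog tT : t t0 / t <= T.
  move=> H; have [|/ltW Tt] := leP t T; first exact: H.
  by rewrite !(dint_after _ T0 _ _ Tt); exact: H.
have /negP := hk0 k kk; rewrite -ltNge => h.
by apply/ltW/(lt_hit (Y := fun w t => `|Z k w t|) t0); apply: le_lt_trans h; rewrite lee_fin.
Qed.

(* [C = X ^ 2 - X_0 ^ 2 - 2 W] with [W] the almost sure uniform limit of the
   Riemann sums; it is also the limit of the sums of squares, which are
   nondecreasing along the grids. *)
Lemma bounded_bracket : exists C : process (Omega := Omega) (R := R),
  [/\ adapted F C, forall w, hcont (C w), forall w, C w 0 = 0,
      forall w s t, 0 <= s -> s <= t -> C w s <= C w t &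
      cmart P F (fun w t => X w t ^+ 2 - X w 0 ^+ 2 - C w t)] /\
  forall w t, T <= t -> C w t = C w T.
Proof.
have [aX cX iX eX] := mX.
have [n_ [G [n_ge [FG [aeG HG]]]]] := dint_unif_cvg.
have mD k := dint_cmart mX XK T0 (n_ k).
have cD k w : hcont (dint (n_ k) w) by have [_ c _ _] := mD k; exact: c.
have aD k : adapted F (dint (n_ k)) by have [a _ _ _] := mD k.
(* Cutting by [G] makes every path of [W] continuous, and not merely almost every one. *)
pose W : process (Omega := Omega) (R := R) := fun w t => \1_G w * limn (fun k => dint (n_ k) w t).
have inG w : G w -> \1_G w = 1 :> R by move=> h; rewrite indicE mem_set.
have outG w : ~ G w -> \1_G w = 0 :> R by move=> h; rewrite indicE memNset.
have Wcv w t : 0 <= t -> \1_G w * dint (n_ k) w t @[k --> \oo] --> W w t.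
  move=> t0; have [Gw|nG] := pselect (G w).
    rewrite /W; apply: cvgM; first exact: cvg_cst.
    by have [k0 H] := HG w Gw; exact: (geo_cvg H t0).
  by rewrite /W outG//; under eq_fun do rewrite mul0r; rewrite mul0r; exact: cvg_cst.
have cW w : hcont (W w).
  have [Gw|nG] := pselect (G w); last first.
    by apply: (eq_hcont (f := fun=> 0)) (@hcont_cst R 0) => t _; rewrite /W outG// mul0r.
  apply: hcontZ; have [k0 H] := HG w Gw.
  by apply: (geo_hcont H).
have aW : adapted F W.
  move=> t t0; apply: (wrt_cvg (f_ := fun k w => \1_G w * dint (n_ k) w t)); last by move=> w; exact: Wcv.
  move=> k; apply: wrtM; last exact: aD.
  by apply: wrt_indic => //; exact: (filt_mono (lexx 0) t0).
have mW : cmart P F W.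
  (* The second moments of the Riemann sums stay below [K ^ 4]; the resulting uniform integrability
     lets the martingale identity pass to the limit. *)
  have key t : 0 <= t -> integ (W ^~ t) /\ forall B, measurable B ->
      Ex (fun w => \1_B w * dint (n_ k) w t) @[k --> \oo] --> Ex (fun w => \1_B w * W w t).
    move=> t0; apply: (unif_integ_cvg (dl := fun k => (K ^+ 4 + 1) / k.+1%:R)).
    - by move=> k; have [_ _ i _] := mD k; exact: i.
    - exact: (wrt_meas t0 (aW t t0)).
    - move: aeG; apply: filterS => w Gw; have := Wcv w t t0.
      by rewrite inG//; under eq_fun do rewrite mul1r.
    - move=> k m.
      have iN := integ_dint_sq mX XK T0 (n_ m) t0.
      have [_ _ i _] := mD m.
      apply: (@le_trans _ _ (Ex (fun w => (k.+1%:R)^-1 * (dint (n_ m) w t ^+ 2 + 1)))).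
        apply: Ex_le => [||w].
        + by apply: integ_excess => //; exact: i.
        + by apply: integZ; apply: integD => //; exact: integ_cst.
        + by rewrite mulrC excess_le_sq.
      rewrite ExZ; last by apply: integD => //; exact: integ_cst.
      rewrite ExD//; last exact: integ_cst.
      rewrite Ex_cst mulrC ler_wpM2r ?invr_ge0// lerD2r.
      apply: le_trans (Ex_dint_sq mX XK T0 (n_ m)).
      have [tT|/ltW Tt] := leP t T; last first.
        by under eq_fun do rewrite (dint_after _ T0 _ _ Tt).
      rewrite -subr_ge0 -(cmart_incr_sq (mD m) (fun w s s0 => dint_bound XK T0 (n_ m) w s0) t0 tT).
      by apply: Ex_ge0 => w; exact: sqr_ge0.
    - exact: invS_cvg0.
  split=> //; first by move=> t t0; exact: (key t t0).1.
  move=> s t A s0 st FA; have t0 := le_trans s0 st; have mA := Ft_meas s0 FA.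
  have h1 := (key t t0).2 A mA; have h2 := (key s s0).2 A mA.
  have E : (fun k => Ex (fun w => \1_A w * dint (n_ k) w t)) = (fun k => Ex (fun w => \1_A w * dint (n_ k) w s)).
    by apply/funext => k; have [_ _ _ e] := mD k; exact: e.
  by rewrite E in h1; apply: (cvg_unique _ h1 h2); exact: norm_hausdorff.
have WT w t : T <= t -> W w t = W w T.
  by move=> Tt; rewrite /W; congr (_ * _); under eq_fun do rewrite (dint_after _ T0 _ _ Tt).
(* The indicator also multiplies [X ^ 2 - X_0 ^ 2], so that off [G] the process is 0 and hence
   nondecreasing. *)
pose C : process (Omega := Omega) (R := R) := fun w t => \1_G w * (X w t ^+ 2 - X w 0 ^+ 2) - 2 * W w t.
have W0 w : W w 0 = 0.
  rewrite /W (_ : (fun k => _) = fun=> 0); last by apply/funext => k; exact: dint0.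
  by rewrite lim_cst// mulr0.
have cX2 w : hcont (fun t => X w t ^+ 2 - X w 0 ^+ 2).
  under eq_fun do rewrite expr2.
  by apply: hcontB; [exact: hcontM|exact: hcont_cst].
have cC w : hcont (C w) by apply: hcontB; apply: hcontZ.
exists C; split; last by move=> w t Tt; rewrite /C WT// XT.
split=> //.
- move=> t t0; apply: wrtB; last by apply: wrtZ; exact: aW.
  apply: wrtM; first by apply: wrt_indic => //; exact: (filt_mono (lexx 0) t0).
  have h1 : measurable_wrt (F t) (fun w => X w 0) by apply: (wrt_mono (lexx 0) t0); exact: aX.
  under eq_fun do rewrite !expr2.
  by apply: wrtB; apply: wrtM => //; exact: aX.
- by move=> w; rewrite /C W0 subrr !mulr0 subrr.
- move=> w s t s0 st.
  have [Gw|nG] := pselect (G w); last by rewrite /C /W outG// !mul0r mulr0 subrr.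
  wlog tT : s t s0 st / t <= T.
    move=> H; have [|/ltW Tt] := leP t T; first exact: H.
    have CT u : T <= u -> C w u = C w T by move=> Tu; rewrite /C WT// XT.
    have [sT|/ltW Ts] := leP s T; first by rewrite (CT t Tt); exact: H.
    by rewrite (CT t Tt) (CT s Ts).
  have [k0 H] := HG w Gw.
  (* The case [T = 0] is set apart because the index [fl] of the last dyadic point at or before [u]
     divides by [T]. *)
  have T_gt0 : 0 < T \/ T = 0 by move: T0; rewrite le_eqVlt => /orP[/eqP <-|]; [right|left].
  case: T_gt0 => [Tp|Tz]; last first.
    have -> : s = t by apply/eqP; rewrite eq_le st/= (le_trans tT)// Tz.
    exact: lexx.
  pose fl n u : nat := Num.trunc (u * (2 ^ n)%:R / T).
  have flP n u : 0 <= u -> dy T n (fl n u) <= u /\ u - dy T n (fl n u) <= T / (2 ^ n)%:R.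
    move=> u0; have p2 : 0 < (2 ^ n)%:R :> R by exact: exp2_gt0.
    have x0 : 0 <= u * (2 ^ n)%:R / T by rewrite divr_ge0 ?mulr_ge0// ltW.
    have hlo : (fl n u)%:R <= u * (2 ^ n)%:R / T by rewrite truncn_le.
    have hhi : u * (2 ^ n)%:R / T < (fl n u)%:R + 1 by rewrite natr1; exact: truncnS_gt.
    have q0 : 0 < T / (2 ^ n)%:R by rewrite divr_gt0.
    have uE : u = (u * (2 ^ n)%:R / T) * (T / (2 ^ n)%:R) by field; rewrite !gt_eqF.
    rewrite /dy; split.
      by rewrite {2}uE ler_wpM2r// ltW.
    rewrite {1}uE -mulrBl -[leRHS]mul1r ler_wpM2r ?(ltW q0)//.
    lra.
  have flcv u : 0 <= u -> dy T (n_ k) (fl (n_ k) u) @[k --> \oo] --> u.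
    move=> u0; apply/cvgrPdist_le => e e0.
    have /cvgr0Pnorm_le/(_ _ e0)[N _ hN] := exp2_cvg T.
    exists N => // k /= Nk; have [h1 h2] := flP (n_ k) u u0.
    rewrite ger0_norm ?subr_ge0// (le_trans h2)// (le_trans (ler_norm _))//.
    by apply: hN => /=; exact: leq_trans (n_ge k).
  have fl_le n u : 0 <= u -> u <= T -> (fl n u <= 2 ^ n)%N.
    move=> u0 uT; rewrite -(ler_nat R); have p2 : 0 < (2 ^ n)%:R :> R by exact: exp2_gt0.
    apply: (@le_trans _ _ (u * (2 ^ n)%:R / T)).
      by rewrite truncn_le divr_ge0 ?mulr_ge0// ltW.
    by rewrite ler_pdivrMr// mulrC ler_wpM2l// ltW.
  have fl_mono n : (fl n s <= fl n t)%N.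
    by apply: le_truncn; rewrite ler_wpM2r ?invr_ge0 ?(ltW Tp)// ler_wpM2r.
  have t0 := le_trans s0 st; have sT := le_trans st tT.
  pose qv k u := X w u ^+ 2 - X w 0 ^+ 2 - 2 * dint (n_ k) w u.
  have qvC k u : (k0 <= k)%N -> 0 <= u -> `|C w u - qv k u| <= 4 * half_pow k.
    move=> kk u0; rewrite /C /qv /W inG// !mul1r.
    have := geo_lim_dist H kk u0; set l := limn _ => h.
    rewrite (_ : _ - _ = - (2 * (l - dint (n_ k) w u))); last by ring.
    rewrite normrN normrM ger0_norm//.
    by rewrite (_ : 4 * half_pow k = 2 * (2 * half_pow k)) ?ler_wpM2l//; ring.
  have qv_mono k : qv k (dy T (n_ k) (fl (n_ k) s)) <= qv k (dy T (n_ k) (fl (n_ k) t)).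
    rewrite /qv !(dqv_at _ T0) ?fl_le//.
    rewrite -!(big_mkord xpredT (fun i => (X w (dy T (n_ k) i.+1) - X w (dy T (n_ k) i)) ^+ 2)).
    rewrite [leRHS](big_cat_nat (n := fl (n_ k) s))//= lerDl.
    by apply: sumr_ge0 => i _; exact: sqr_ge0.
  have c1 := hcont_cvg (cC w) (fun k => dy_ge0 T0 (n_ k) (fl (n_ k) s)) s0 (flcv s s0).
  have c2 := hcont_cvg (cC w) (fun k => dy_ge0 T0 (n_ k) (fl (n_ k) t)) t0 (flcv t t0).
  (* The constant 8 is twice the 4 of [qvC]: [C] is compared with the nondecreasing sums of squares
     at both dyadic times. *)
  have c3 : C w (dy T (n_ k) (fl (n_ k) t)) + 8 * half_pow k @[k --> \oo] --> C w t.
    by rewrite -[X in _ --> X]addr0; exact: cvgD c2 (half_pow_cvg0 8).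
  apply: (ler_cvg_to c1 c3); exists k0 => // k kk; rewrite /= in kk *.
  have h1 := qvC k _ kk (dy_ge0 T0 (n_ k) (fl (n_ k) s)).
  have h2 := qvC k _ kk (dy_ge0 T0 (n_ k) (fl (n_ k) t)).
  have h3 := qv_mono k; move: h1 h2; rewrite !ler_norml => /andP[h1 h1'] /andP[h2 h2'].
  lra.
- apply: (cmart_ae HF (cmartZ 2 mW)).
    by move=> w; apply: hcontB.
  move: aeG; apply: filterS => w Gw t t0; rewrite /C inG// mul1r; ring.
Qed.

End bounded.
End bracket.

(** * Covariation of continuous local martingales *)

Section covariation.
Context {d : measure_display} {Omega : measurableType d} {R : realType}.
Variables (P : probability Omega R) (F : filtration Omega R).
Implicit Types (L M N f g : process (Omega := Omega) (R := R)).
Local Notation Ex := (Ex P).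
Local Notation integ := (integ P).

Lemma hcont_local (f : R -> R) :
  (forall T, 0 <= T -> exists2 g : R -> R, hcont g & forall t, 0 <= t -> t <= T -> f t = g t) ->
  hcont f.
Proof.
move=> H; apply/hcontP => t.
have T0 : 0 <= Num.max t 0 + 1 by rewrite addr_ge0// le_max lexx orbT.
have [g /hcontP cg fg] := H _ T0.
have E s : s < t + 1 -> g (Num.max s 0) = f (Num.max s 0).
  move=> st; rewrite fg// ?le_max ?lexx ?orbT// ge_max; apply/andP; split.
    by rewrite (le_trans (ltW st))// lerD2r le_max lexx.
  exact: T0.
have := cg t; rewrite /continuous_at (E t); last by rewrite ltrDl.
apply: cvg_trans; apply: near_eq_cvg.
have : \forall s \near t, s < t + 1 by apply: lt_nbhsl; rewrite ltrDl.
by apply: filterS => s; exact: E.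
Qed.

Lemma cmart_Mcloc0 L : cmart P F L -> (forall w, L w 0 = 0) -> Mcloc0 P F L.
Proof.
move=> mL L0; have [aL cL iL eL] := mL; split=> //; split; last exact: cL.
split; first by exact: aL.
exists (fun n w => n%:R%:E); split; first exact: localizing_nat.
move=> n; apply: cmart_martingale.
have := stopped_cmart mL (stopping_cst F (ler0n R n)); congr cmart.
by apply/funext => w; apply/funext => t; rewrite L0 subr0.
Qed.

(** The variation of a difference is at most the sum of the variations, and for nondecreasing paths
    null at 0 these are the values, whose sum is at most [c]. *)
Lemma sub_integrable_variation f g (c : Omega -> R) : adapted F f -> adapted F g ->
  (forall w, hcont (f w)) -> (forall w, hcont (g w)) ->
  (forall w s t, 0 <= s -> s <= t -> f w s <= f w t) ->
  (forall w s t, 0 <= s -> s <= t -> g w s <= g w t) ->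
  (forall w, f w 0 = 0) -> (forall w, g w 0 = 0) -> integ c ->
  (forall w t, 0 <= t -> f w t + g w t <= c w) ->
  integrable_variation P F (fun w t => f w t - g w t).
Proof.
move=> af ag cf cg nf ng f0 g0 ic fgc.
have TV w t : 0 <= t -> (total_variation 0 t (fun t => (f w t - g w t)%R) <= (c w)%:E)%E.
  move=> t0; have := total_variation_le (f w) (\- (g w)) t0.
  rewrite total_variationN (nondecreasing_total_variation (f := f w) t0); last first.
    by move=> x y; rewrite !in_itv/= => /andP[x0 _] _ xy; apply: nf.
  rewrite (nondecreasing_total_variation (f := g w) t0); last first.
    by move=> x y; rewrite !in_itv/= => /andP[x0 _] _ xy; apply: ng.
  move=> /le_trans; apply.
  by rewrite f0 g0 !subr0 -EFinD lee_fin fgc.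
split.
- by move=> t t0; apply: wrtB; [exact: af|exact: ag].
- by apply: cadlag_hcont => w; exact: hcontB.
- move=> w t t0; apply/bounded_variationP => //.
  by rewrite ge0_fin_numE ?total_variation_ge0// (le_lt_trans (TV w t t0))// ltry.
- apply: (@le_lt_trans _ _ (\int[P]_w (c w)%:E)%E); last by rewrite Ex_EFin// ltry.
  apply: integral_mono => w.
    rewrite /path_variation adde_ge0//.
    apply: (@le_trans _ _ (total_variation 0 0 (fun t => (f w t - g w t)%R))).
      by rewrite total_variation_ge0.
    by apply: ereal_sup_ubound; exists 0 => /=.
  rewrite /path_variation f0 g0 subrr normr0 add0e.
  by apply: ge_ereal_sup => _ [t /= t0 <-]; exact: TV.
Qed.

(** The form taken by the glued covariation: stopped at a localizing time, it is a stopped piece cut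
    to the event [G] on which the pieces agree. *)
Lemma stopped_integrable_variation f g (c : Omega -> R) (G : set Omega)
    (theta : Omega -> \bar R) (Z : process (Omega := Omega) (R := R)) :
  adapted F f -> adapted F g -> (forall w, hcont (f w)) -> (forall w, hcont (g w)) ->
  (forall w s t, 0 <= s -> s <= t -> f w s <= f w t) ->
  (forall w s t, 0 <= s -> s <= t -> g w s <= g w t) ->
  (forall w, f w 0 = 0) -> (forall w, g w 0 = 0) -> integ c ->
  (forall w t, 0 <= t -> f w t + g w t <= c w) ->
  F 0 G -> stopping_time F theta -> (forall w, hcont (Z w)) ->
  (forall w t, 0 <= t -> Z w t = \1_G w * (stopped theta f w t - stopped theta g w t)) ->
  integrable_variation P F Z.
Proof.
move=> af ag cf cg nf ng f0 g0 ic fgc FG sth cZ ZE.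
have G1 w : 0 <= \1_G w :> R by rewrite indicE.
have sm w s t : s <= t -> stop_at s (theta w) <= stop_at t (theta w).
  have := sth.1 w; case: (theta w) => [r||]// _ st; rewrite ?stop_at_y// !stop_at_fin.
  exact: le_min2.
have s0 w t : 0 <= t -> 0 <= stop_at t (theta w).
  by move=> t0; apply: stop_at_ge0 => //; exact: sth.1.
have FtG t : 0 <= t -> F t G by move=> t0; exact: (filt_mono (lexx 0) t0).
pose g' : process (Omega := Omega) (R := R) := fun w t => \1_G w * stopped theta g w t.
(* [Z] is only known at times [>= 0]; adding [g'] back makes the decomposition
   hold everywhere. *)
pose f' : process (Omega := Omega) (R := R) := fun w t => Z w t + g' w t.
have f'E w t : 0 <= t -> f' w t = \1_G w * stopped theta f w t.
  by move=> t0; rewrite /f' /g' ZE//; ring.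
have cg' w : hcont (g' w) by apply: hcontZ; apply: stopped_hcont => //; exact: sth.1.
have -> : Z = (fun w t => f' w t - g' w t).
  by apply/funext => w; apply/funext => t; rewrite /f' addrK.
apply: (@sub_integrable_variation f' g' (fun w => \1_G w * c w)) => //.
- move=> t t0; rewrite (_ : (fun w => f' w t) = (fun w => \1_G w * stopped theta f w t)).
    by apply: wrtM; [apply: wrt_indic => //; exact: FtG|exact: (stopped_adapted sth af cf)].
  by apply/funext => w; exact: f'E.
- by move=> t t0; apply: wrtM; [apply: wrt_indic => //; exact: FtG|exact: (stopped_adapted sth ag cg)].
- by move=> w; exact: hcontD.
- move=> w s t s_ge0 st; have t0 := le_trans s_ge0 st.
  by rewrite !f'E// ler_wpM2l// !stoppedE nf ?s0 ?sm.
- by move=> w s t s_ge0 st; rewrite /g' ler_wpM2l// !stoppedE ng ?s0 ?sm.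
- by move=> w; rewrite f'E// stoppedE stop_at_id ?f0 ?mulr0//; exact: sth.1.
- by move=> w; rewrite /g' stoppedE stop_at_id ?g0 ?mulr0//; exact: sth.1.
- by apply: integ_indic => //; exact: (Ft_meas (lexx 0) FG).
- by move=> w t t0; rewrite f'E// /g' -mulrDr ler_wpM2l// !stoppedE fgc// s0.
Qed.

(* The indicator is there because [M w 0] need not be integrable; where it
   vanishes, [rho] is [0]. *)
Lemma stopped_bounded_cmart M N tau n (rho : Omega -> \bar R) :
  Mcloc P F M -> adapted F N -> (forall w, hcont (N w)) ->
  stopping_time F rho -> (forall w, (rho w <= tau w)%E) ->
  (forall sigma, stopping_time F sigma -> (forall w, (sigma w <= tau w)%E) ->
     cmart P F (fun w t => stopped sigma M w t - M w 0)) ->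
  (forall w, (rho w <= hit (fun w t => `|M w t| + `|N w t|)%R n%:R w)%E) ->
  let A := [set w | `|M w 0| + `|N w 0| < n%:R] in
  F 0 A /\ cmart P F (fun w t => \1_A w * stopped rho M w t) /\
  forall w t, 0 <= t -> `|\1_A w * stopped rho M w t| + `|\1_A w * stopped rho N w t| <= n%:R.
Proof.
move=> mM aN cN sr rt mt rh A.
have aM := Mcloc_adapted mM; have cM : forall w, hcont (M w) := mM.2.
pose Y : process (Omega := Omega) (R := R) := fun w t => `|M w t| + `|N w t|.
have aY : adapted F Y by move=> t t0; apply: wrtD; apply: wrt_norm; [exact: aM|exact: aN].
have cY w : hcont (Y w) by apply: hcontD; exact: hcont_norm.
have FA : F 0 A.
  rewrite (_ : A = ~` [set w | n%:R <= Y w 0]).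
    by apply: FtC => //; apply: wrt_ge => //; exact: aY.
  by apply/seteqP; split => w /=; rewrite /A/= ltNge => /negP.
have wA := wrt_indic (lexx 0) FA.
have B w t : 0 <= t -> `|\1_A w * stopped rho M w t| + `|\1_A w * stopped rho N w t| <= n%:R.
  move=> t0; rewrite indic_set; case: ifPn => h; last by rewrite !mul0r normr0 addr0.
  rewrite !mul1r !stoppedE; apply: (hit_reached (cY w) h).
    by apply: stop_at_ge0 => //; exact: sr.1.
  by apply: le_trans (rh w); apply: stop_at_lex; exact: sr.1.
split=> //; split=> //.
have m1 := cmart_wt_proc (mt rho sr rt) wA (norm_indic_le1 A).
have mF0 : measurable_wrt (F 0) (fun w => \1_A w * M w 0) by apply: wrtM => //; exact: aM.
have m2 : cmart P F (fun w _ => \1_A w * M w 0).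
  apply: cmart_F0 => //.
  apply: (@integ_bd _ _ _ P _ n%:R); first exact: (wrt_meas (lexx 0) mF0).
  move=> w; have := B w 0 (lexx 0); rewrite !stoppedE stop_at_id; last exact: sr.1.
  by have := normr_ge0 (\1_A w * N w 0); lra.
have := cmartD m1 m2; congr cmart; apply/funext => w; apply/funext => t; ring.
Qed.

(** The covariation is the difference [f - g] of two nondecreasing processes. Both brackets are
    constant after [T], so their integrable values at [T] supply the bound [c]. *)
Lemma bounded_covariation M N K T : usual_conditions P F -> cmart P F M -> cmart P F N ->
  (forall w t, 0 <= t -> `|M w t| + `|N w t| <= K) -> 0 <= T ->
  (forall w t, T <= t -> M w t = M w T) -> (forall w t, T <= t -> N w t = N w T) ->
  exists (f g : process (Omega := Omega) (R := R)) (c : Omega -> R),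
  [/\ adapted F f, adapted F g, forall w, hcont (f w), forall w, hcont (g w) & integ c] /\
  [/\ forall w s t, 0 <= s -> s <= t -> f w s <= f w t,
   forall w s t, 0 <= s -> s <= t -> g w s <= g w t,
   forall w, f w 0 = 0, forall w, g w 0 = 0 & forall w t, 0 <= t -> f w t + g w t <= c w] /\
  cmart P F (fun w t => M w t * N w t - M w 0 * N w 0 - (f w t - g w t)).
Proof.
move=> HF mM mN MNK T0 MT NT.
have BX w t : 0 <= t -> `|M w t + N w t| <= K.
  by move=> t0; rewrite (le_trans (ler_normD _ _))// MNK.
have BY w t : 0 <= t -> `|M w t - N w t| <= K.
  by move=> t0; rewrite (le_trans (ler_normB _ _))// MNK.
have [C [[aC cC C0 nC mC] CT]] := bounded_bracket HF (cmartD mM mN) BX T0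
  (fun w t Tt => congr2 +%R (MT w t Tt) (NT w t Tt)).
have [D [[aD cD D0 nD mD] DT]] := bounded_bracket HF (cmartB mM mN) BY T0
  (fun w t Tt => congr2 (fun x y => x - y) (MT w t Tt) (NT w t Tt)).
have [aM cM iM eM] := mM; have [aN cN iN eN] := mN.
have iC : integ (C ^~ T).
  have [_ _ i _] := mC; have [_ _ j _] := cmartD mM mN.
  have isq u : 0 <= u -> integ (fun w => (M w u + N w u) ^+ 2) by move=> u0; apply: (integ_sq (cmartD mM mN) BX).
  have := integB (integB (isq T T0) (isq 0 (lexx 0))) (i T T0).
  by congr integ; apply/funext => w; ring.
have iD : integ (D ^~ T).
  have [_ _ i _] := mD.
  have isq u : 0 <= u -> integ (fun w => (M w u - N w u) ^+ 2) by move=> u0; apply: (integ_sq (cmartB mM mN) BY).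
  have := integB (integB (isq T T0) (isq 0 (lexx 0))) (i T T0).
  by congr integ; apply/funext => w; ring.
(* Polarization. *)
exists (fun w t => 4^-1 * C w t), (fun w t => 4^-1 * D w t), (fun w => 4^-1 * (C w T + D w T)).
split.
  split.
  - by move=> t t0; apply: wrtZ; exact: aC.
  - by move=> t t0; apply: wrtZ; exact: aD.
  - by move=> w; exact: hcontZ.
  - by move=> w; exact: hcontZ.
  - by apply: integZ; exact: integD.
split.
  split.
  - by move=> w s t s0 st; rewrite ler_wpM2l ?invr_ge0// nC.
  - by move=> w s t s0 st; rewrite ler_wpM2l ?invr_ge0// nD.
  - by move=> w; rewrite C0 mulr0.
  - by move=> w; rewrite D0 mulr0.
  - move=> w t t0; rewrite -mulrDr ler_wpM2l ?invr_ge0//.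
    have [tT|/ltW Tt] := leP t T; last by rewrite (CT _ _ Tt) (DT _ _ Tt).
    by apply: lerD; [exact: nC|exact: nD].
have := cmartB (cmartZ 4^-1 mC) (cmartZ 4^-1 mD); congr cmart.
by apply/funext => w; apply/funext => t; field.
Qed.

Lemma Mcloc_covariation M N : usual_conditions P F -> Mcloc P F M -> Mcloc P F N ->
  exists V : process (Omega := Omega) (R := R),
    [/\ Aloc P F V, forall w, hcont (V w) & Mcloc0 P F (fun w t => M w t * N w t - V w t)].
Proof.
move=> HF mM mN.
have aM := Mcloc_adapted mM; have cM : forall w, hcont (M w) := mM.2.
have aN := Mcloc_adapted mN; have cN : forall w, hcont (N w) := mN.2.
have [tau1 lt1 mt1] := Mcloc_stopped mM.
have [tau2 lt2 mt2] := Mcloc_stopped mN.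
pose Y : process (Omega := Omega) (R := R) := fun w t => `|M w t| + `|N w t|.
have aY : adapted F Y by move=> t t0; apply: wrtD; apply: wrt_norm; [exact: aM|exact: aN].
have cY w : hcont (Y w) by apply: hcontD; exact: hcont_norm.
(* The constant times [n] are included so that the stopped processes are constant after [n], as
   [bounded_covariation] requires. *)
have lrho := localizing_min (localizing_min lt1 lt2)
  (localizing_min (localizing_hit aY cY) (localizing_nat F)).
set rho := (fun n w => _) in lrho.
have [srho hrho crho] := lrho.
have rt1 n w : (rho n w <= tau1 n w)%E by rewrite /rho !ge_min lexx.
have rt2 n w : (rho n w <= tau2 n w)%E by rewrite /rho !ge_min lexx !orbT.
have rh n w : (rho n w <= hit Y n%:R w)%E by rewrite /rho !ge_min lexx !orbT.
have rn n w : (rho n w <= n%:R%:E)%E by rewrite /rho !ge_min lexx !orbT.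
have r0 n w : (0 <= rho n w)%E by exact: (srho n).1.
have rhoS n w : (rho n w <= rho n.+1 w)%E by apply: hrho.
pose A n := [set w | `|M w 0| + `|N w 0| < n%:R].
pose Mn n : process (Omega := Omega) (R := R) := fun w t => \1_(A n) w * stopped (rho n) M w t.
pose Nn n : process (Omega := Omega) (R := R) := fun w t => \1_(A n) w * stopped (rho n) N w t.
have HM n : cmart P F (Mn n) /\ forall w t, 0 <= t -> `|Mn n w t| + `|Nn n w t| <= n%:R.
  by have [_ h] := stopped_bounded_cmart mM aN cN (srho n) (rt1 n) (mt1 n) (rh n).
have HN n : cmart P F (Nn n).
  have rh' w : (rho n w <= hit (fun w t => (`|N w t| + `|M w t|)%R) n%:R w)%E.
    rewrite (_ : (fun w t => _) = Y)//.
    by apply/funext => w'; apply/funext => t; rewrite addrC.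
  have [_ [h _]] := stopped_bounded_cmart mN aM cM (srho n) (rt2 n) (mt2 n) rh'.
  move: h; congr cmart; apply/funext => w; apply/funext => t; rewrite /Nn; congr (\1_ _ _ * _).
  by apply/seteqP; split => w' /=; rewrite /A/= addrC.
have stopT n w t : n%:R <= t -> stop_at t (rho n w) = stop_at n%:R (rho n w).
  move=> nt; have := rn n w; have := r0 n w; case: (rho n w) => [r||]// _.
  by rewrite lee_fin => rn'; rewrite !stop_at_r// (le_trans rn').
have MT n w t : n%:R <= t -> Mn n w t = Mn n w n%:R by move=> nt; rewrite /Mn !stoppedE stopT.
have NT n w t : n%:R <= t -> Nn n w t = Nn n w n%:R by move=> nt; rewrite /Nn !stoppedE stopT.
have H n : exists p : process * process * (Omega -> R), 
   [/\ adapted F p.1.1, adapted F p.1.2, forall w, hcont (p.1.1 w), forall w, hcont (p.1.2 w) & integ p.2] /\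
  [/\ forall w s t, 0 <= s -> s <= t -> p.1.1 w s <= p.1.1 w t,
   forall w s t, 0 <= s -> s <= t -> p.1.2 w s <= p.1.2 w t,
   forall w, p.1.1 w 0 = 0, forall w, p.1.2 w 0 = 0 &
   forall w t, 0 <= t -> p.1.1 w t + p.1.2 w t <= p.2 w] /\
  cmart P F (fun w t => Mn n w t * Nn n w t - Mn n w 0 * Nn n w 0 - (p.1.1 w t - p.1.2 w t)).
  have [f [g [c h]]] := bounded_covariation HF (HM n).1 (HN n) (HM n).2 (ler0n R n) (MT n) (NT n).
  by exists (f, g, c).
have {H} [p Hp] := choice H.
pose Vn n : process (Omega := Omega) (R := R) := fun w t => (p n).1.1 w t - (p n).1.2 w t.
pose Ln n : process (Omega := Omega) (R := R) := fun w t => Mn n w t * Nn n w t - Mn n w 0 * Nn n w 0 - Vn n w t.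
have Vn0 n w : Vn n w 0 = 0.
  by have [_ [[_ _ h1 h2 _] _]] := Hp n; rewrite /Vn h1 h2 subrr.
have cVn n w : hcont (Vn n w).
  by have [[_ _ h1 h2 _] _] := Hp n; apply: hcontB; [exact: h1|exact: h2].
have aVn n : adapted F (Vn n).
  by have [[h1 h2 _ _ _] _] := Hp n; move=> t t0; apply: wrtB; [exact: h1|exact: h2].
have mLn n : cmart P F (Ln n) by have [_ [_ h]] := Hp n.
have L0n n : Mcloc0 P F (Ln n).
  by apply: cmart_Mcloc0 => // w; rewrite /Ln Vn0 !subrr.
have ivn n (G : set Omega) (theta : Omega -> \bar R) (Z : process (Omega := Omega) (R := R)) :
    F 0 G -> stopping_time F theta -> (forall w, hcont (Z w)) ->
    (forall w t, 0 <= t -> Z w t = \1_G w * stopped theta (Vn n) w t) -> integrable_variation P F Z.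
  have [[h1 h2 h3 h4 h5] [[k1 k2 k3 k4 k5] _]] := Hp n.
  exact: (stopped_integrable_variation h1 h2 h3 h4 k1 k2 k3 k4 h5 k5).
have AVn n : Aloc P F (Vn n).
  split; first exact: aVn.
  exists (fun k w => k%:R%:E); split; first exact: localizing_nat.
  move=> k; apply: (ivn n setT _ _ (FtT F (lexx 0)) (stopping_cst F (ler0n R k))).
    by move=> w; apply: hcontB; [apply: stopped_hcont; rewrite ?lee_fin|exact: hcont_cst].
  by move=> w t _; rewrite indicT mul1r Vn0 subr0.
have A1 n w : (0%:E < rho n w)%E -> \1_(A n) w = 1 :> R.
  move=> r_gt0; rewrite indic_set ifT//.
  by apply: (lt_hit (Y := Y) (lexx 0)); exact: lt_le_trans (rh n w).
have Mnt n w t : 0 <= t -> (t%:E <= rho n w)%E -> (0%:E < rho n w)%E -> Mn n w t = M w t /\ Nn n w t = N w t.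
  by move=> t0 tr r_gt0; rewrite /Mn /Nn A1// !mul1r !stoppedE stop_at_id.
have cons n : {ae P, forall w t, 0 <= t -> (t%:E <= rho n w)%E -> Vn n.+1 w t = Vn n w t}.
  have := fv_part_unique (L0n n) (L0n n.+1) (AVn n.+1) (cVn n.+1) (AVn n) (cVn n) (srho n).
  have hyp : {ae P, forall w t, 0 <= t -> (t%:E < rho n w)%E ->
     Ln n w t - Ln n.+1 w t = (Vn n.+1 w t - Vn n.+1 w 0) - (Vn n w t - Vn n w 0)}.
    apply: aeW => w t t0 tr; rewrite !Vn0 !subr0 /Ln.
    have r_gt0 : (0%:E < rho n w)%E by apply: le_lt_trans tr; rewrite lee_fin.
    have r_gt0' := lt_le_trans r_gt0 (rhoS n w).
    have [-> ->] := Mnt n w t t0 (ltW tr) r_gt0.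
    have [-> ->] := Mnt n.+1 w t t0 (le_trans (ltW tr) (rhoS n w)) r_gt0'.
    have [-> ->] := Mnt n w 0 (lexx 0) (ltW r_gt0) r_gt0.
    have [-> ->] := Mnt n.+1 w 0 (lexx 0) (ltW r_gt0') r_gt0'.
    ring.
  move=> /(_ hyp); apply: filterS => w h t t0 tr.
  by have := h t t0 tr; rewrite !Vn0 !subr0.
(* The paths on which consecutive pieces agree; the complement is negligible, so that [G] belongs to
   [F 0]. *)
pose G := [set w | forall n t, 0 <= t -> (t%:E <= rho n w)%E -> Vn n.+1 w t = Vn n w t].
have aeG : {ae P, forall w, G w} := ae_nat cons.
have FG : F 0 G.
  rewrite -(setCK G); apply: FtC => //.
  exact: (Ft_negl HF (lexx 0) aeG).
pose W : process (Omega := Omega) (R := R) := fun w t => \1_G w * limn (fun n => Vn n w t).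
have inG w : G w -> \1_G w = 1 :> R by move=> h; rewrite indicE mem_set.
have outG w : ~ G w -> \1_G w = 0 :> R by move=> h; rewrite indicE memNset.
have Vconst w n m t : G w -> 0 <= t -> (t%:E <= rho n w)%E -> (n <= m)%N -> Vn m w t = Vn n w t.
  move=> Gw t0 tr /subnKC <-; elim: (m - n)%N => [|k ih]; first by rewrite addn0.
  by rewrite addnS Gw// (le_trans tr)// hrho// leq_addr.
have WE w n t : G w -> 0 <= t -> (t%:E <= rho n w)%E -> W w t = Vn n w t.
  move=> Gw t0 tr; rewrite /W inG// mul1r.
  by apply: lim_near_cst => //; exists n => // m /= nm; exact: Vconst.
have rho_ge w t : exists n, (t%:E <= rho n w)%E.
  by have /cvgeyPge/(_ t)[n _ /(_ n (leqnn n)) h] := crho w; exists n.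
have W0 w : W w 0 = 0.
  have [Gw|nG] := pselect (G w); last by rewrite /W outG// mul0r.
  by rewrite (WE w 0%N)// Vn0.
have cW w : hcont (W w).
  have [Gw|nG] := pselect (G w); last first.
    by apply: (eq_hcont (f := fun=> 0)) (@hcont_cst R 0) => t _; rewrite /W outG// mul0r.
  apply: hcont_local => T T0; have [n hn] := rho_ge w T; exists (Vn n w) => // t t0 tT.
  by apply: WE => //; apply: le_trans hn; rewrite lee_fin.
have aW : adapted F W.
  move=> t t0; apply: (wrt_cvg (f_ := fun n w => \1_G w * Vn n w t)).
    move=> n; apply: wrtM; last exact: aVn.
    by apply: wrt_indic => //; exact: (filt_mono (lexx 0) t0).
  move=> w; have [Gw|nG] := pselect (G w); last first.
    by rewrite /W outG//; under eq_fun do rewrite mul0r; rewrite mul0r; exact: cvg_cst.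
  have [n hn] := rho_ge w t; apply: cvg_near_cst; exists n => // m /= nm.
  by rewrite inG// mul1r (WE w n)//; exact: Vconst.
have sW n w t : 0 <= t -> stopped (rho n) W w t = \1_G w * stopped (rho n) (Vn n) w t.
  move=> t0; rewrite !stoppedE.
  have [Gw|nG] := pselect (G w); last by rewrite /W outG// !mul0r.
  rewrite (WE w n)// ?inG ?mul1r//; first exact: stop_at_ge0.
  exact: stop_at_lex.
(* The pieces are null at 0, and the product of the initial values is restored here; [localized]
   asks only measurability of an initial value, so it may fail to be integrable. *)
pose V : process (Omega := Omega) (R := R) := fun w t => M w 0 * N w 0 + W w t.
have V0 w : V w 0 = M w 0 * N w 0 by rewrite /V W0 addr0.
have cV w : hcont (V w) by apply: hcontD => //; exact: hcont_cst.
have mMN0 : measurable_wrt (F 0) (fun w => M w 0 * N w 0) by apply: wrtM; [exact: aM|exact: aN].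
exists V; split=> //.
- split; first by under eq_fun do rewrite V0.
  exists rho; split; first exact: lrho.
  move=> n; apply: (ivn n G (rho n) _ FG (srho n)).
    by move=> w; apply: hcontB; [apply: stopped_hcont|exact: hcont_cst].
  by move=> w t t0; rewrite -sW// V0 /V !stoppedE addrC addKr.
- split; last by move=> w; rewrite V0 subrr.
  split; last first.
    by move=> w; apply: hcontB => //; exact: hcontM.
  split; first by under eq_fun do rewrite V0 subrr; exact: wrt_cst.
  exists rho; split; first exact: lrho.
  move=> n; apply: cmart_martingale.
  apply: (cmart_ae HF (stopped_cmart (mLn n) (srho n))).
    move=> w; apply: hcontB; last exact: hcont_cst.
    apply: stopped_hcont => //.
    by apply: hcontB => //; exact: hcontM.
  move: aeG; apply: filterS => w Gw t t0.
  rewrite V0 subrr subr0 !stoppedE; set u := stop_at _ _.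
  have u0 : 0 <= u by exact: stop_at_ge0.
  have ur : (u%:E <= rho n w)%E by exact: stop_at_lex.
  rewrite /V (WE w n u Gw u0 ur).
  (* Where [rho n] is 0 the indicator in [Mn] and [Nn] may vanish, but then [u] is 0 and both sides
     are 0. *)
  have := r0 n w; rewrite le_eqVlt => /orP[/eqP rz|rpos].
    have -> : u = 0 by move: ur; rewrite -rz lee_fin => ur; apply/le_anti; rewrite u0 andbT.
    by rewrite (L0n n).2 Vn0 addr0 subrr.
  rewrite /Ln; have [-> ->] := Mnt n w u u0 ur rpos.
  have [-> ->] := Mnt n w 0 (lexx 0) (ltW rpos) rpos.
  ring.
Qed.

End covariation.

(** * Processes on a set of interval type *)

Section processes_on_interval_sets.
Context {d : measure_display} {Omega : measurableType d} {R : realType}.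
Variables (P : probability Omega R) (F : filtration Omega R).
Implicit Types (X Y V M N : process (Omega := Omega) (R := R)).
Implicit Types (B : set (Omega * R)) (tau sigma : nat -> Omega -> \bar R).

(** A time outside [B] contributes 0 on both sides, and stopping at [theta] reaches only times up to
    [theta]. *)
Lemma indistinguishable_stopped_restr B (theta : Omega -> \bar R) X Y :
  (forall w, (0 <= theta w)%E) ->
  indistinguishable P (stopped theta (restr B X)) (stopped theta (restr B Y)) <->
  {ae P, forall w t, 0 <= t -> B (w, t) -> (t%:E <= theta w)%E -> X w t = Y w t}.
Proof.
move=> th0; split; apply: filterS => w H t t0.
- move=> Bt tth; have := H t t0; rewrite !stoppedE stop_at_id// /restr.
  by rewrite indicE mem_set// !mulr1.
- rewrite !stoppedE /restr; set u := stop_at _ _.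
  have [Bu|nB] := pselect (B (w, u)).
    by rewrite H//; [exact: stop_at_ge0|exact: stop_at_lex].
  by rewrite indicE memNset// !mulr0.
Qed.

Lemma eq_onP B X Y : {ae P, forall w t, 0 <= t -> B (w, t) -> X w t = Y w t} -> eq_on P B X Y.
Proof.
apply: filterS => w H t t0; rewrite /restr.
have [Bt|nB] := pselect (B (w, t)); first by rewrite H.
by rewrite indicE memNset// !mulr0.
Qed.

Definition exhausting B tau := [/\ forall n, stopping_time F (tau n),
  forall w, {homo (fun n => tau n w) : m n / (m <= n)%N >-> (m <= n)%E},
  forall w, tau n w @[n --> \oo] --> end_time B w &
  B `<=` \bigcup_n stochastic_interval (cst 0%E) (tau n)].

Lemma on_setP (D : set (process (Omega := Omega) (R := R))) B X :
  on_set P F D B X <-> exists tau, exhausting B tau /\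
    exists Xn : nat -> process (Omega := Omega) (R := R), forall n, D (Xn n) /\
    {ae P, forall w t, 0 <= t -> B (w, t) -> (t%:E <= tau n w)%E -> X w t = Xn n w t}.
Proof.
split.
- move=> [tau [Xn [h1 h2 h3 h4 h5]]]; exists tau; split=> //; exists Xn => n.
  have [Dn h] := h5 n; split=> //.
  by apply: (indistinguishable_stopped_restr _ _ _ _).1 h; exact: (h1 n).1.
- move=> [tau [[h1 h2 h3 h4] [Xn H]]]; exists tau, Xn; split=> // n.
  have [Dn h] := H n; split=> //.
  by apply: (indistinguishable_stopped_restr _ _ _ _).2 h; exact: (h1 n).1.
Qed.

Lemma exhausting_min B tau sigma : exhausting B tau -> exhausting B sigma ->
  exhausting B (fun n w => Order.min (tau n w) (sigma n w)).
Proof.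
move=> [t1 t2 t3 t4] [s1 s2 s3 s4]; split.
- by move=> n; exact: stopping_min.
- by move=> w m n mn; apply: le_min2; [exact: t2|exact: s2].
- by move=> w; exact: cvg_min_same.
- move=> [w t] Bt; have [n _ [t0 _ tn]] := t4 _ Bt; have [m _ [_ _ sm]] := s4 _ Bt.
  exists (maxn n m) => //; split=> //=.
  rewrite le_min; apply/andP; split.
    by apply: le_trans tn _; apply: t2; rewrite leq_maxl.
  by apply: le_trans sm _; apply: s2; rewrite leq_maxr.
Qed.

Lemma exhausting_le_end B tau n w : exhausting B tau -> (tau n w <= end_time B w)%E.
Proof.
move=> [_ h2 h3 _].
have := h3 w => /[dup] /cvg_lim <-// cv; apply: lime_ge.
  by apply/cvg_ex; exists (end_time B w).
by exists n => // m /= nm; exact: h2.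
Qed.

Lemma before_end_time B w (t : R) : 0 <= t -> (t%:E < end_time B w)%E -> B (w, t).
Proof.
move=> t0 te; apply: contrapT => nB.
have : (end_time B w <= t%:E)%E.
  apply: ereal_inf_lbound; exists t => //=.
  by rewrite /xsection/= inE; split.
by rewrite leNgt te.
Qed.

Lemma interval_type0 B w : interval_type F B -> B (w, 0).
Proof.
move=> [_ [T [_ T0 /(_ w)[[t Bt] HB]]]].
suff : xsection B w 0 by rewrite /xsection/= inE.
case: HB Bt => -> /= [t0 tT]; split=> //.
by apply: le_lt_trans tT; rewrite lee_fin.
Qed.

(** At [tau n w] itself this may fail: the section may be [[0, T[] with [tau n w = T]. *)
Lemma exhausting_lt B tau n w (t : R) : exhausting B tau -> 0 <= t ->
  (t%:E < tau n w)%E -> B (w, t).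
Proof.
move=> ex t0 tt; apply: before_end_time => //; apply: lt_le_trans tt _.
exact: exhausting_le_end.
Qed.

Lemma covariation_unique B M N V V' : interval_type F B ->
  on_set P F (Aloc P F `&` Cont) B V ->
  on_set P F (Mcloc0 P F) B (fun w t => M w t * N w t - V w t) ->
  on_set P F (Aloc P F `&` Cont) B V' ->
  on_set P F (Mcloc0 P F) B (fun w t => M w t * N w t - V' w t) ->
  eq_on P B V V'.
Proof.
move=> HB /on_setP[t1 [e1 [A1 H1]]] /on_setP[t2 [e2 [L1 H2]]]
  /on_setP[t3 [e3 [A2 H3]]] /on_setP[t4 [e4 [L2 H4]]].
have e := exhausting_min (exhausting_min e1 e2) (exhausting_min e3 e4).
set rho := (fun n w => _) in e.
have [sr _ _ cover] := e.
have r1 n w : (rho n w <= t1 n w)%E by rewrite /rho !ge_min lexx.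
have r2 n w : (rho n w <= t2 n w)%E by rewrite /rho !ge_min lexx !orbT.
have r3 n w : (rho n w <= t3 n w)%E by rewrite /rho !ge_min lexx !orbT.
have r4 n w : (rho n w <= t4 n w)%E by rewrite /rho !ge_min lexx !orbT.
have key n : {ae P, forall w t, 0 <= t -> B (w, t) -> (t%:E <= rho n w)%E -> V w t = V' w t}.
  have [[vA1 cA1] h1] := H1 n; have [mL1 h2] := H2 n.
  have [[vA2 cA2] h3] := H3 n; have [mL2 h4] := H4 n.
  have eq : {ae P, forall w t, 0 <= t -> B (w, t) -> (t%:E <= rho n w)%E ->
      L2 n w t - L1 n w t = A1 n w t - A2 n w t /\ A1 n w t = V w t /\ A2 n w t = V' w t}.
    have h12 : {ae P, forall w t, 0 <= t -> B (w, t) -> (t%:E <= rho n w)%E ->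
        A1 n w t = V w t /\ L1 n w t = M w t * N w t - V w t}.
      move: h1 h2; apply: filterS2 => w h1 h2 t t0 Bt tr.
      rewrite (h1 t t0 Bt (le_trans tr (r1 n w))).
      by rewrite -(h2 t t0 Bt (le_trans tr (r2 n w))) (h1 t t0 Bt (le_trans tr (r1 n w))).
    move: h12 h3 h4; apply: filterS3 => w h12 h3 h4 t t0 Bt tr.
    have [-> ->] := h12 t t0 Bt tr.
    rewrite -(h3 t t0 Bt (le_trans tr (r3 n w))) -(h4 t t0 Bt (le_trans tr (r4 n w))).
    by split=> //; ring.
  (* [fv_part_unique] compares increments only. The initial values agree because both local
     martingales are null at 0 and time 0 belongs to [B]. *)
  have eq0 : {ae P, forall w, A1 n w 0 = A2 n w 0}.
    move: eq; apply: filterS => w /(_ 0 (lexx 0) (interval_type0 w HB)).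
    rewrite mL1.2 mL2.2 subrr => /(_ ((sr n).1 w))[/esym/eqP].
    by rewrite subr_eq0 => /eqP.
  have := fv_part_unique mL2 mL1 vA1 cA1 vA2 cA2 (sr n).
  have hyp : {ae P, forall w t, 0 <= t -> (t%:E < rho n w)%E ->
     L2 n w t - L1 n w t = (A1 n w t - A1 n w 0) - (A2 n w t - A2 n w 0)}.
    move: eq eq0; apply: filterS2 => w h h0 t t0 tr.
    have [-> _] := h t t0 (exhausting_lt e t0 tr) (ltW tr).
    by rewrite h0; ring.
  move=> /(_ hyp); move: eq eq0; apply: filterS3 => w h h0 h' t t0 Bt tr.
  have [_ [<- <-]] := h t t0 Bt tr.
  by have := h' t t0 tr; rewrite h0 => /addIr.
apply: eq_onP; have := ae_nat key; apply: filterS => w h t t0 Bt.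
by have [n _ [_ _ /= tn]] := cover _ Bt; exact: (h n).
Qed.

Lemma covariation_exists B M N : usual_conditions P F -> interval_type F B ->
  on_set P F (Mcloc P F) B M -> on_set P F (Mcloc P F) B N ->
  exists V, on_set P F (Aloc P F `&` Cont) B V /\
    on_set P F (Mcloc0 P F) B (fun w t => M w t * N w t - V w t).
Proof.
move=> HF HB /on_setP[t1 [e1 [Mn HM]]] /on_setP[t2 [e2 [Nn HN]]].
have e := exhausting_min e1 e2.
set rho := (fun n w => _) in e.
have [sr hr _ _] := e.
have r1 n w : (rho n w <= t1 n w)%E by rewrite /rho ge_min lexx.
have r2 n w : (rho n w <= t2 n w)%E by rewrite /rho ge_min lexx orbT.
have [Vn HV] := choice (fun n => Mcloc_covariation HF (HM n).1 (HN n).1).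
have eqMN n : {ae P, forall w t, 0 <= t -> B (w, t) -> (t%:E <= rho n w)%E ->
    M w t = Mn n w t /\ N w t = Nn n w t}.
  have [_ h1] := HM n; have [_ h2] := HN n; move: h1 h2; apply: filterS2 => w h1 h2 t t0 Bt tr.
  by split; [apply: h1 => //; exact: le_trans (r1 n w)|apply: h2 => //; exact: le_trans (r2 n w)].
have V0 n w : Vn n w 0 = Mn n w 0 * Nn n w 0.
  by have [_ _ [_ /(_ w)/eqP]] := HV n; rewrite subr_eq0 => /eqP.
have cons n : {ae P, forall w t, 0 <= t -> (t%:E <= rho n w)%E -> Vn n.+1 w t = Vn n w t}.
  have [vA cA mL] := HV n; have [vA' cA' mL'] := HV n.+1.
  have := fv_part_unique mL mL' vA' cA' vA cA (sr n).
  have hS w : (rho n w <= rho n.+1 w)%E by exact: hr.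
  have eq0 : {ae P, forall w, Vn n w 0 = Vn n.+1 w 0}.
    move: (eqMN n) (eqMN n.+1); apply: filterS2 => w h h'; rewrite !V0.
    have [<- <-] := h 0 (lexx 0) (interval_type0 w HB) ((sr n).1 w).
    by have [<- <-] := h' 0 (lexx 0) (interval_type0 w HB) ((sr n.+1).1 w).
  have hyp : {ae P, forall w t, 0 <= t -> (t%:E < rho n w)%E ->
      (Mn n w t * Nn n w t - Vn n w t) - (Mn n.+1 w t * Nn n.+1 w t - Vn n.+1 w t) =
      (Vn n.+1 w t - Vn n.+1 w 0) - (Vn n w t - Vn n w 0)}.
    move: (eqMN n) (eqMN n.+1) eq0; apply: filterS3 => w h h' h0 t t0 tr.
    have Bt := exhausting_lt e t0 tr.
    have [<- <-] := h t t0 Bt (ltW tr).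
    have [<- <-] := h' t t0 Bt (le_trans (ltW tr) (hS w)).
    by rewrite h0; ring.
  move=> /(_ hyp); move: eq0; apply: filterS2 => w h0 h t t0 tr.
  by have := h t t0 tr; rewrite h0 => /addIr.
(* The value is arbitrary on a null set and at times beyond every [rho n], which lie outside [B].
   Membership in a class on [B] puts the regularity on the pieces [Vn n], so no cutting by an event
   is made here. *)
pose V : process (Omega := Omega) (R := R) := fun w t => limn (fun n => Vn n w t).
have VE : {ae P, forall w n t, 0 <= t -> (t%:E <= rho n w)%E -> V w t = Vn n w t}.
  have := ae_nat cons; apply: filterS => w h n t t0 tr.
  apply: lim_near_cst => //; exists n => // m /= /subnKC <-.
  elim: (m - n)%N => [|k ih]; first by rewrite addn0.
  by rewrite addnS h// (le_trans tr)// hr// leq_addr.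
exists V; split; apply/on_setP; exists rho; split=> //.
- exists Vn => n; have [vA cA _] := HV n; split=> //.
  by move: VE; apply: filterS => w h t t0 _; exact: h.
- exists (fun n w t => Mn n w t * Nn n w t - Vn n w t) => n; have [_ _ mL] := HV n; split=> //.
  move: VE (eqMN n); apply: filterS2 => w h h' t t0 Bt tr.
  by rewrite (h n t t0 tr); have [-> ->] := h' t t0 Bt tr.
Qed.

End processes_on_interval_sets.

Theorem lemma4p1 (d : measure_display) (Omega : measurableType d)
    (R : realType) (P : probability Omega R) (F : filtration Omega R)
    (HF : usual_conditions P F)
    (B : set (Omega * R)) (HB : interval_type F B)
    (M N : process (Omega := Omega) (R := R))
    (HM : on_set P F (Mcloc P F) B M)
    (HN : on_set P F (Mcloc P F) B N) :
  exists V : process (Omega := Omega) (R := R),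
    [/\ on_set P F (Aloc P F `&` Cont) B V,
        on_set P F (Mcloc0 P F) B (fun w t => M w t * N w t - V w t) &
        forall V' : process (Omega := Omega) (R := R),
          on_set P F (Aloc P F `&` Cont) B V' ->
          on_set P F (Mcloc0 P F) B (fun w t => M w t * N w t - V' w t) ->
          eq_on P B V V'].
Proof.
have [V [h1 h2]] := covariation_exists HF HB HM HN.
by exists V; split=> // V'; exact: covariation_unique.
Qed.
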